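(* One cannot determine whether a non-compact Riemannian manifold is naturally reductive using the Laplace-Beltrami operator. That is, there exist two non-compact Riemannian manifolds $M$ and $M'$, with Laplace-Beltrami operators $\Delta$ and $\Delta'$ respectively, that are isospectral, meaning that there is a unitary operator $T:L^2(M')\to L^2(M)$ with $T\circ\Delta'=\Delta\circ T$, and such that one of $M$, $M'$ is naturally reductive while the other is not.
   Context: Isospectrality: Two Riemannian manifolds $M$ and $M'$ are called isospectral if there exists a unitary operator $T:L^2(M')\to L^2(M)$ which intertwines their Laplace-Beltrami operators, i.e. $T\circ\Delta'=\Delta\circ T$. Here $\Delta$ and $\Delta'$ are regarded as self-adjoint (unbounded) operators on $L^2$, namely the Friedrichs extensions of the Laplace-Beltrami operators on smooth compactly supported functions (on complete manifolds this is the unique self-adjoint extension), and the intertwining relation is one of unbounded operators: $T$ maps the domain of $\Delta'$ onto the domain of $\Delta$. Inaudibility: A geometric property is called inaudible (it cannot be determined using the Laplace-Beltrami operator) if there exist isospectral Riemannian manifolds such that one of them satisfies the property and the other does not. Naturally reductive: A homogeneous Riemannian manifold $M$, with isometry group $G$ (acting transitively), isotropy group $H\subseteq G$ of a point $o\in M$, and Lie algebras $\mathfrak{g}$ and $\mathfrak{h}$ of $G$ and $H$, is called naturally reductive if there is a reductive decomposition $\mathfrak{g}=\mathfrak{h}\oplus\mathfrak{m}$ (vector space direct sum with $\mathrm{Ad}(H)\mathfrak{m}\subseteq\mathfrak{m}$) such that every geodesic of $M$ through $o$ is of the form $t\mapsto \exp(tX)\cdot o$ for some $X\in\mathfrak{m}$,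 i.e. is the orbit of a one-parameter subgroup of isometries generated by a vector of $\mathfrak{m}$. A Riemannian manifold that is not homogeneous is not naturally reductive. *)

(* Defs.v *)
From mathcomp Require Import all_boot all_order all_algebra.
From mathcomp Require Import complex.
From mathcomp Require Import all_classical all_reals all_analysis.

Set Implicit Arguments.
Unset Strict Implicit.
Unset Printing Implicit Defensive.

Import Order.TTheory GRing.Theory Num.Theory.
Import numFieldNormedType.Exports.

Local Open Scope classical_set_scope.
Local Open Scope complex_scope.
Local Open Scope ring_scope.

(** * Calculus on open subsets of [R^n] *)

Section Calculus.
Context {R : realType}.

Definition partial n (i : 'I_n) (f : 'rV[R]_n -> R) : 'rV[R]_n -> R :=
  fun x => 'D_(delta_mx 0 i : 'rV[R]_n) f x.

(* [U] is open in all uses. *)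
Fixpoint Ck_on n (k : nat) (U : set 'rV[R]_n) (f : 'rV[R]_n -> R) : Prop :=
  (forall x, U x -> {for x, continuous f}) /\
  (if k is k'.+1 then
     forall i : 'I_n,
       (forall x, U x -> derivable f x (delta_mx 0 i : 'rV[R]_n)) /\
       Ck_on k' U (partial i f)
   else True).

Definition smooth_on n (U : set 'rV[R]_n) (f : 'rV[R]_n -> R) : Prop :=
  forall k, Ck_on k U f.

Definition smooth_map_on m n (U : set 'rV[R]_m) (f : 'rV[R]_m -> 'rV[R]_n) :=
  forall j, smooth_on U (fun x => f x 0 j).

(* The integral of a nonnegative Borel function against Lebesgue measure on
   [R^n], as an iterated integral (Tonelli). *)
Fixpoint lebesgue_int n : ('rV[R]_n -> \bar R) -> \bar R :=
  match n return ('rV[R]_n -> \bar R) -> \bar R with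
  | 0 => fun f => f 0
  | m.+1 => fun f =>
      (\int[lebesgue_measure]_t
         lebesgue_int (fun v : 'rV[R]_m => f (row_mx t%:M v : 'rV[R]_(1 + m))))%E
  end.

End Calculus.

(** * Riemannian manifolds *)

(* The atlas is indexed by the points of the manifold, [chart p] being a chart
   around [p] with domain [chart_dom p] and inverse [chart_inv p].  The values
   of [chart p] and [chart_inv p] outside [chart_dom p] and its image are
   irrelevant.  The tangent space at [p] is identified with [R^n], as row
   vectors, by means of the chart [chart p]. *)
Record atlas_data (R : realType) := AtlasData {
  space :> ptopologicalType;
  dim : nat;
  chart_dom : space -> set space;
  chart : space -> space -> 'rV[R]_dim;
  chart_inv : space -> 'rV[R]_dim -> space
}.
Arguments dim {R}.
Arguments chart_dom {R a}.
Arguments chart {R a}.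
Arguments chart_inv {R a}.

Section Maps.
Context {R : realType} {M : atlas_data R}.

Definition chart_img (p : M) : set 'rV[R]_(dim M) := chart p @` chart_dom p.

Definition in_charts (f : M -> M) (p q : M) : 'rV[R]_(dim M) -> 'rV[R]_(dim M) :=
  chart q \o f \o chart_inv p.

Definition in_charts_dom (f : M -> M) (p q : M) : set 'rV[R]_(dim M) :=
  [set x | chart_img p x /\ chart_dom q (f (chart_inv p x))].

Definition smooth_map (f : M -> M) : Prop :=
  continuous f /\
  forall p q, smooth_map_on (in_charts_dom f p q) (in_charts f p q).

Definition smooth_fun (u : M -> R) : Prop :=
  forall p, smooth_on (chart_img p) (u \o chart_inv p).

(* [g p x] is the Gram matrix at the point of coordinates [x] in the chart
   [chart p].  Vectors are rows and [jacobian] acts on the right. *)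
Definition metric_preserving
    (g : M -> 'rV[R]_(dim M) -> 'M[R]_(dim M)) (f : M -> M) : Prop :=
  forall p q x, in_charts_dom f p q x ->
    let J := jacobian (in_charts f p q) x in
    J *m g q (in_charts f p q x) *m J^T = g p x.

End Maps.

Record is_smooth_manifold (R : realType) (M : atlas_data R) : Prop := {
  manifold_hausdorff : hausdorff_space M;
  manifold_second_countable : @second_countable M;
  manifold_connected : connected [set: M];
  chart_dom_mem : forall p : M, chart_dom p p;
  chart_dom_open : forall p : M, open (chart_dom p);
  chart_img_open : forall p : M, open (chart_img p);
  chartK : forall p x : M, chart_dom p x -> chart_inv p (chart p x) = x;
  chart_continuous : forall p : M, {within chart_dom p, continuous (chart p)};
  chart_inv_continuous :
    forall p : M, {within chart_img p, continuous (chart_inv p)};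
  transition_smooth : smooth_map (@idfun M)
}.

Record riemannian_manifold (R : realType) := RiemannianManifold {
  manifold :> atlas_data R;
  metric : manifold -> 'rV[R]_(dim manifold) -> 'M[R]_(dim manifold);
  manifoldP : is_smooth_manifold manifold;
  metric_smooth : forall (p : manifold) (i j : 'I_(dim manifold)),
    smooth_on (chart_img p) (fun x => metric p x i j);
  metric_sym : forall (p : manifold) x, chart_img p x ->
    (metric p x)^T = metric p x;
  metric_posdef : forall (p : manifold) x, chart_img p x ->
    forall v : 'rV[R]_(dim manifold), v != 0 ->
    0 < (v *m metric p x *m v^T) 0 0;
  metric_compatible : metric_preserving metric idfun
}.
Arguments metric {R r}.

Definition noncompact (R : realType) (M : riemannian_manifold R) : Prop :=
  ~ compact [set: M].

Notation borel M := (g_sigma_algebraType (@open M)).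

(** * The Laplace-Beltrami operator *)

Section Laplacian.
Context {R : realType} {M : riemannian_manifold R}.

Definition vol_density (p : M) (x : 'rV[R]_(dim M)) : R :=
  Num.sqrt (\det (metric p x)).

Definition is_volume_measure (mu : {measure set (borel M) -> \bar R}) : Prop :=
  forall (p : M) (A : set (borel M)), measurable A -> A `<=` chart_dom p ->
    mu A = lebesgue_int
             (fun x => (\1_(chart p @` A) x * vol_density p x)%:E).

(* [- div grad u]; its value at [q] is computed in the chart [chart q]. *)
Definition laplacian_real (u : M -> R) : M -> R := fun q =>
  let x := chart q q in
  - (vol_density q x)^-1 *
    \sum_i \sum_j
      partial i (fun y => vol_density q y * invmx (metric q y) i j *
                          partial j (u \o chart_inv q) y) x.

Definition laplacian (f : M -> R[i]) : M -> R[i] := fun q =>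
  laplacian_real (fun y => complex.Re (f y)) q +i*
  laplacian_real (fun y => complex.Im (f y)) q.

Definition test_function (f : M -> R[i]) : Prop :=
  [/\ smooth_fun (fun y => complex.Re (f y)),
      smooth_fun (fun y => complex.Im (f y)) &
      compact (closure [set y | f y != 0])].

End Laplacian.

(** * Complex [L^2] spaces and unbounded operators *)

(* Elements of [L^2] are represented by functions, up to equality almost
   everywhere; an unbounded operator is represented by its graph. *)
Section L2.
Context {R : realType} {d : measure_display} {X : measurableType d}.
Variable mu : {measure set X -> \bar R}.
Implicit Types f g u w : X -> R[i].

Definition normsq (z : R[i]) : R := complex.Re z ^+ 2 + complex.Im z ^+ 2.

Definition L2 f : Prop :=
  [/\ measurable_fun setT (fun x => complex.Re (f x)),
      measurable_fun setT (fun x => complex.Im (f x)) &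
      (\int[mu]_x (normsq (f x))%:E < +oo)%E].

Definition ae_eq2 f g : Prop := {ae mu, forall x, f x = g x}.

Definition inner f g : R[i] :=
  Rintegral mu setT (fun x => complex.Re (f x * (g x)^*)) +i*
  Rintegral mu setT (fun x => complex.Im (f x * (g x)^*)).

(* The Friedrichs extension of the nonnegative symmetric operator [A] with
   domain [D]: the restriction of the adjoint of [A] to the domain of the
   closure of the quadratic form [f |-> inner (A f) f]. *)
Definition form_closure (D : set (X -> R[i])) (A : (X -> R[i]) -> (X -> R[i]))
    u : Prop :=
  exists phi : nat -> X -> R[i],
    [/\ forall k, D (phi k),
        (fun k => let h := fun x => u x - phi k x in complex.Re (inner h h))
          @ \oo --> (0 : R) &
        forall e : R, 0 < e -> exists N, forall j k, (N <= j)%N -> (N <= k)%N ->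
          let h := fun x => phi j x - phi k x in complex.Re (inner (A h) h) < e].

Definition friedrichs (D : set (X -> R[i])) (A : (X -> R[i]) -> (X -> R[i]))
    u w : Prop :=
  [/\ L2 u, L2 w, form_closure D A u &
      forall phi, D phi -> inner u (A phi) = inner w phi].

End L2.

Section Operators.
Context {R : realType} {d d' : measure_display}.
Context {X' : measurableType d'} {X : measurableType d}.
Variables (mu' : {measure set X' -> \bar R}) (mu : {measure set X -> \bar R}).

Definition unitary (T : (X' -> R[i]) -> (X -> R[i])) : Prop :=
  [/\ (forall f, L2 mu' f -> L2 mu (T f)) /\
      (forall f g, L2 mu' f -> L2 mu' g -> ae_eq2 mu' f g ->
         ae_eq2 mu (T f) (T g)),
      forall (a : R[i]) f g, L2 mu' f -> L2 mu' g ->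
        ae_eq2 mu (T (fun x => a * f x + g x)) (fun x => a * T f x + T g x),
      forall f g, L2 mu' f -> L2 mu' g ->
        inner mu (T f) (T g) = inner mu' f g &
      forall h, L2 mu h -> exists2 f, L2 mu' f & ae_eq2 mu (T f) h].

(* Equality of the graphs of [T \o A'] and [A \o T]. *)
Definition intertwines (T : (X' -> R[i]) -> (X -> R[i]))
    (A' : (X' -> R[i]) -> (X' -> R[i]) -> Prop)
    (A : (X -> R[i]) -> (X -> R[i]) -> Prop) : Prop :=
  forall u v, L2 mu' u -> L2 mu v ->
    (exists2 w, A' u w & ae_eq2 mu (T w) v) <-> A (T u) v.

End Operators.

Definition laplace_beltrami (R : realType) (M : riemannian_manifold R)
    (mu : {measure set (borel M) -> \bar R}) :
    (borel M -> R[i]) -> (borel M -> R[i]) -> Prop :=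
  friedrichs mu (@test_function R M) (@laplacian R M).

(* The Riemannian volume measure exists and is unique. *)
Definition isospectral (R : realType) (M M' : riemannian_manifold R) : Prop :=
  exists (mu : {measure set (borel M) -> \bar R})
         (mu' : {measure set (borel M') -> \bar R}),
    [/\ is_volume_measure mu, is_volume_measure mu' &
        exists2 T : (borel M' -> R[i]) -> (borel M -> R[i]),
          unitary mu' mu T &
          intertwines mu' mu T (laplace_beltrami mu') (laplace_beltrami mu)].

(** * Naturally reductive manifolds *)

Section NaturallyReductive.
Context {R : realType} {M : riemannian_manifold R}.

Definition isometry (f : M -> M) : Prop :=
  metric_preserving metric f /\
  exists h : M -> M, [/\ cancel f h, cancel h f, smooth_map f & smooth_map h].

Definition homogeneous : Prop :=
  forall p q : M, exists2 f, isometry f & f p = q.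

(* Joint continuity of the action amounts to continuity of [t |-> gamma t] for
   the compact-open topology, that is, the Lie group topology. *)
Definition one_parameter_subgroup (gamma : R -> M -> M) : Prop :=
  [/\ forall t, isometry (gamma t),
      forall s t p, gamma (s + t) p = gamma s (gamma t p) &
      continuous (fun z : R * M => gamma z.1 z.2)].

Definition vector_field : Type := M -> 'rV[R]_(dim M).

(* An element [X] of the Lie algebra of the isometry group is represented by
   the vector field [p |-> d/dt (exp(tX) p)] at [t = 0]; this is linear and
   injective in [X].  [generates gamma X] means that [gamma t = exp(tX)]. *)
Definition generates (gamma : R -> M -> M) (X : vector_field) : Prop :=
  one_parameter_subgroup gamma /\
  forall p : M, is_derive (0 : R) (1 : R) (fun t => chart p (gamma t p)) (X p).

Definition isom_algebra : set vector_field :=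
  [set X | exists gamma, generates gamma X].

Definition isotropy_group (o : M) : set (M -> M) :=
  [set h | isometry h /\ h o = o].

Definition isotropy_algebra (o : M) : set vector_field :=
  [set X | exists2 gamma, generates gamma X &
             forall t, isotropy_group o (gamma t)].

(* [Y = Ad(h) X], that is, [exp(tY) = h exp(tX) h^-1]. *)
Definition Ad (h : M -> M) (X Y : vector_field) : Prop :=
  exists gamma gamma', [/\ generates gamma X, generates gamma' Y &
    forall t p, gamma' t (h p) = h (gamma t p)].

Definition reductive_decomposition (o : M) (m : set vector_field) : Prop :=
  [/\ m `<=` isom_algebra,
      m (fun=> 0) /\
      (forall (a : R) (X Y : vector_field), m X -> m Y ->
         m (fun p => a *: X p + Y p)),
      isotropy_algebra o `&` m `<=` [set (fun=> 0)],
      forall X, isom_algebra X -> exists Y Z : vector_field,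
        [/\ isotropy_algebra o Y, m Z & forall p, X p = Y p + Z p] &
      forall h X Y, isotropy_group o h -> m X -> Ad h X Y -> m Y].

Definition christoffel (q : M) (x : 'rV[R]_(dim M)) (k i j : 'I_(dim M)) : R :=
  2^-1 * \sum_l invmx (metric q x) k l *
    (partial i (fun y => metric q y j l) x +
     partial j (fun y => metric q y i l) x -
     partial l (fun y => metric q y i j) x).

(* [J] is an open interval. *)
Definition geodesic (J : set R) (c : R -> M) : Prop :=
  forall t, J t -> {for t, continuous c} /\
  forall q : M, chart_dom q (c t) ->
    let x k (s : R) : R := chart q (c s) 0 k in
    let x' k := derive1 (x k) in
    forall k, [/\ derivable (x k) t 1, derivable (x' k) t 1 &
      derive1 (x' k) t +
        \sum_i \sum_j christoffel q (chart q (c t)) k i j * x' i t * x' j t = 0].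

End NaturallyReductive.
Arguments homogeneous {R}.

Definition naturally_reductive (R : realType) (M : riemannian_manifold R) :
    Prop :=
  homogeneous M /\
  exists (o : M) (m : set (@vector_field R M)),
    reductive_decomposition o m /\
    forall (J : set R) (c : R -> M),
      open J -> is_interval J -> J 0 -> geodesic J c -> c 0 = o ->
      exists2 X, m X &
        exists2 gamma, generates gamma X & forall t, J t -> c t = gamma t o.

(* Main.v *)
Require Import Defs.
From HB Require Import structures.
From mathcomp Require Import all_boot all_order all_algebra.
From mathcomp Require Import complex ring lra.
From mathcomp Require Import all_classical all_reals all_analysis.
From mathcomp Require Import measurable_realfun.

(** The two manifolds are the flat space R^5 and the same space with the origin
    removed.

    Only the first one is naturally reductive.  In R^5 the translations form a
    complement of the isotropy algebra of the origin, and the geodesics through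
    the origin, being straight lines, are orbits of translation groups
    ([euclid_naturally_reductive]).  The punctured space is not even homogeneous:
    an isometry that moves a point away from the puncture would carry a segment
    that runs into the puncture to a curve of the same length that stays in a
    compact set, whose preimage would be compact as well
    ([punctured_not_homogeneous]).

    The spectrum does not see the puncture.  A point is a null set, so that both
    manifolds have the same L^2 space, and what remains is to compare two
    Friedrichs extensions of the Laplacian: one starting from all test functions
    on R^5, the other from those that vanish near the origin.  Multiplying a test
    function by a cutoff supported in a ball of radius of order t gives a function
    that is small for the graph norm: two derivatives of the cutoff cost a factor
    t^-2, the volume of the ball is of order t^n, and t^(n - 4) tends to 0 since
    n = 5 exceeds 4 ([cutoff_small]).  Subtracting it shows that the test functions
    vanishing near the origin are dense in all test functions for the graph norm,
    and a Friedrichs extension does not change when its initial domain is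
    restricted to such a subspace ([friedrichs_core]).

    The unitary operator is f |-> f \o ret, where ret maps R^5 to the punctured
    space, fixing all points but the origin.  It transports inner products and
    Laplacians ([friedrichs_pull]); test functions on the punctured space are the
    restrictions of those on R^5 that vanish near the origin
    ([punctured_test_functionE]).  The analysis rests on two facts about Lebesgue
    measure, obtained from the iterated integral that defines it: translation
    invariance, which gives the symmetry of the Laplacian ([nlap_sym]), and the
    volume of cubes. *)

Set Implicit Arguments.
Unset Strict Implicit.
Unset Printing Implicit Defensive.

Import Order.TTheory GRing.Theory Num.Theory.
Import numFieldNormedType.Exports.

Local Open Scope classical_set_scope.
Local Open Scope complex_scope.
Local Open Scope ring_scope.

(** * Row vectors and their Borel sets *)

Lemma continuous_shift (R : numFieldType) (V : normedModType R) (w : V) :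
  continuous (fun x : V => x + w).
Proof. by move=> x; apply: continuousD; [exact: cvg_id|exact: cvg_cst]. Qed.

Section RowSpaces.
Context {R : realType}.
Implicit Types (m n : nat) (r : R).

(** The norm of row vectors is the sup norm, so that balls are cubes. *)
Lemma ball_rowP n (c x : 'rV[R]_n) r : 0 < r ->
  ball c r x <-> forall i, ball (c 0 i) r (x 0 i).
Proof.
move=> r0; split=> [[_ h] i|h]; first exact: h.
by split=> // i j; rewrite ord1.
Qed.

Lemma coord_norm_le n (x : 'rV[R]_n) i : `|x 0 i| <= `|x|.
Proof.
rewrite [leRHS]/Num.norm /= mx_normrE.
by apply/bigmax_geP; right; exists (0, i).
Qed.

Lemma norm_row_le n (x : 'rV[R]_n) r :
  0 <= r -> (forall i, `|x 0 i| <= r) -> `|x| <= r.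
Proof.
move=> r0 h; rewrite [leLHS]/Num.norm /= mx_normrE.
by apply/bigmax_leP; split=> // -[i j] _ /=; rewrite ord1.
Qed.

(** Rational centres and radii [1/(k+1)] give a countable base of the topology,
    through which measurability is tested. *)
Definition rational_ball n (p : 'rV[rat]_n * nat) : set 'rV[R]_n :=
  ball (map_mx ratr p.1 : 'rV[R]_n) (p.2.+1%:R^-1).

Lemma rational_ball_nbhs n (O : set 'rV[R]_n) (x : 'rV[R]_n) : nbhs x O ->
  exists2 p, rational_ball p x & rational_ball p `<=` O.
Proof.
move=> /nbhs_ballP[e /= e0 eO].
pose k := Num.truncn (2 / e).
have k0 : 0 < k.+1%:R^-1 :> R by rewrite invr_gt0.
have ke : k.+1%:R^-1 < e / 2.
  by rewrite -[e / 2]invrK ltf_pV2 ?posrE ?invr_gt0 ?divr_gt0// invf_div truncnS_gt.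
have Hq i : exists q : rat, `|x 0 i - ratr q| < k.+1%:R^-1.
  have /rat_in_itvoo[q] : x 0 i - k.+1%:R^-1 < x 0 i + k.+1%:R^-1.
    by rewrite ltrD2l (lt_trans _ k0)// oppr_lt0.
  rewrite in_itv/= => /andP[h1 h2]; exists q.
  by rewrite ltr_distlC h1 h2.
pose c := \row_i (sval (cid (Hq i))).
exists (c, k).
  rewrite /rational_ball; apply/ball_rowP => //= i; rewrite !mxE.
  by case: cid => q /= ?; rewrite /ball/= distrC.
move=> y; rewrite /rational_ball /= => cy; apply: eO.
apply/ball_rowP => // i; move/ball_rowP: cy => /(_ k0 i).
rewrite !mxE; case: cid => q /= xq; rewrite /ball/= => qy.
apply: (le_lt_trans (ler_distD (ratr q) _ _)).
by rewrite [e]splitr ltrD// (lt_trans _ ke).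
Qed.

Lemma open_bigcup_rational_ball n (O : set 'rV[R]_n) : open O ->
  O = \bigcup_(p in [set p | rational_ball p `<=` O]) rational_ball p.
Proof.
rewrite openE => oO; apply/seteqP; split=> [x Ox|x [p /= pO] px]; last exact: pO.
by have [p px pO] := rational_ball_nbhs (oO _ Ox); exists p.
Qed.

Lemma open_rational_ball n (p : 'rV[rat]_n * nat) : open (rational_ball p).
Proof. exact: ball_open. Qed.

Lemma open_borel n (O : set 'rV[R]_n) :
  open O -> measurable (O : set (borel 'rV[R]_n)).
Proof. by move=> oO; apply: sub_sigma_algebra. Qed.

Lemma continuous_borel_fun (T : ptopologicalType) (f : T -> R) :
  continuous f -> measurable_fun setT (f : borel T -> R).
Proof.
move=> /continuousP cf; apply: (measurability _ (RGenOpens.measurableE R)).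
move=> _ [_ [x [y ->]] <-]; rewrite setTI; apply: sub_sigma_algebra.
by apply: cf; exact: interval_open.
Qed.

Lemma continuous_borel_map (S T : ptopologicalType) (f : S -> T) :
  continuous f -> measurable_fun setT (f : borel S -> borel T).
Proof.
move=> /continuousP cf.
apply: (@measurability _ _ (borel S) (borel T) setT f (@open T)) => //.
move=> _ [U oU <-].
by rewrite setTI; apply: sub_sigma_algebra; exact: cf.
Qed.

Definition consrow m (p : R * 'rV[R]_m) : 'rV[R]_m.+1 :=
  row_mx (p.1%:M : 'rV_1) p.2 : 'rV[R]_(1 + m).
Arguments consrow {m}.

Lemma consrow0 m (p : R * 'rV[R]_m) : consrow p 0 ord0 = p.1.
Proof.
by rewrite /consrow mxE; case: splitP => // j _; rewrite mxE ord1 eqxx.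
Qed.

Lemma consrowS m (p : R * 'rV[R]_m) i :
  consrow p 0 (lift ord0 i) = p.2 0 i.
Proof.
rewrite /consrow mxE; case: splitP => [j|k] /=; first by rewrite ord1.
by move=> [ik]; congr (p.2 0 _); apply: val_inj.
Qed.

Lemma consrowD m (p q : R * 'rV[R]_m) :
  consrow (p + q) = consrow p + consrow q.
Proof.
apply/rowP => i; rewrite [RHS]mxE.
by case: (unliftP ord0 i) => [j ->|->]; rewrite !(consrowS, consrow0) //= mxE.
Qed.

Lemma consrow_surj m (x : 'rV[R]_m.+1) : exists p, x = consrow p.
Proof.
exists (x 0 ord0, \row_i x 0 (lift ord0 i)); apply/rowP => i.
by case: (unliftP ord0 i) => [j ->|->]; rewrite !(consrowS, consrow0) //= mxE.
Qed.

Lemma preimage_consrow_ball m (c : R * 'rV[R]_m) r : 0 < r ->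
  consrow @^-1` ball (consrow c) r = ball c.1 r `*` ball c.2 r.
Proof.
move=> r0; apply/seteqP; split=> [[t v]|[t v] [/= h1 h2]].
  move=> /(ball_rowP _ _ r0) h; split=> /=; first by have := h ord0; rewrite !consrow0.
  by apply/ball_rowP => // i; have := h (lift ord0 i); rewrite !consrowS.
apply/ball_rowP => // i; case: (unliftP ord0 i) => [j ->|->].
  by rewrite !consrowS; move/ball_rowP: h2; exact.
by rewrite !consrow0.
Qed.

(** The source carries the product sigma-algebra; it contains the preimage of an
    open set because that preimage is a countable union of boxes. *)
Lemma measurable_consrow m :
  measurable_fun setT
    (consrow : measurableTypeR R * borel 'rV[R]_m -> borel 'rV[R]_m.+1).
Proof.
apply: (@measurability _ _ _ (borel 'rV[R]_m.+1) setT _ (@open 'rV[R]_m.+1)) => //.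
move=> _ [U oU <-].
rewrite setTI (open_bigcup_rational_ball oU) preimage_bigcup bigcup_mkcond.
apply: countable_bigcupT_measurable => // p; case: ifPn => // _.
rewrite /rational_ball; have [c ->] := consrow_surj (map_mx ratr p.1 : 'rV[R]_m.+1).
rewrite preimage_consrow_ball ?invr_gt0//; apply: measurableX.
  exact: open_measurable (ball_open _ _).
exact: open_borel (ball_open _ _).
Qed.

End RowSpaces.
Arguments consrow {R m}.

(** * Lebesgue measure on R^n *)

(** The set function [pushforward] packaged as a measure. *)
Definition pushforward_measure d d' (T1 : measurableType d)
    (T2 : measurableType d') (R : realType) (mu : {measure set T1 -> \bar R})
    (f : T1 -> T2) (mf : measurable_fun setT f) : {measure set T2 -> \bar R} :=
  measure_function_pushforward__canonical__measure_function_Measure mu mf.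

Section SigmaFiniteMeasureOf.
Context d (T : measurableType d) (R : realType) (mu : {measure set T -> \bar R}).
Hypothesis mu_sigma_finite : sigma_finite setT mu.

Definition sigma_finite_copy : set T -> \bar R := mu.
HB.instance Definition _ := Measure.on sigma_finite_copy.
HB.instance Definition _ :=
  Measure_isSigmaFinite.Build d T R sigma_finite_copy mu_sigma_finite.

(** Tonelli's theorem asks for a factor that carries a sigma-finite structure;
    this attaches one to a measure for which sigma-finiteness is only a
    hypothesis. *)
Definition sigma_finite_measure_of : {sigma_finite_measure set T -> \bar R} :=
  sigma_finite_copy.

End SigmaFiniteMeasureOf.

Section LebesgueRow.
Context {R : realType}.
Local Open Scope ereal_scope.

(** Lebesgue measure is determined by its values on half-open intervals, whose
    length does not change under translation. *)
Lemma lebesgue_measure_shift (c : R) (A : set (measurableTypeR R)) :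
  measurable A ->
  pushforward lebesgue_measure
    (fun t : measurableTypeR R => (t + c)%R : measurableTypeR R) A =
  lebesgue_measure A.
Proof.
move=> mA.
have mf : measurable_fun setT (fun t : measurableTypeR R => (t + c)%R : measurableTypeR R).
  by apply: measurable_funD.
pose m := pushforward_measure lebesgue_measure mf.
suff h X : ocitv X -> lebesgue_measure X = m X.
  by rewrite (lebesgue_measure_unique h mA).
move=> [[a b] _ <-]; rewrite /m /= /pushforward /=.
rewrite (_ : _ @^-1` _ = `](a - c)%R, (b - c)%R]%classic); last first.
  by apply/seteqP; split=> x /=; rewrite !in_itv /= ltrBlDr lerBrDr.
rewrite !lebesgue_measure_itv/= !lte_fin ltrD2r; case: ifPn => // _.
by rewrite -!EFinD; congr (_%:E); ring.
Qed.

Lemma integral_shift (c : R) (f : R -> \bar R) :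
  measurable_fun setT f -> (forall x, 0 <= f x) ->
  \int[lebesgue_measure]_t f (t + c)%R = \int[lebesgue_measure]_t f t.
Proof.
move=> mf f0.
have mc : measurable_fun setT (fun t : measurableTypeR R => (t + c)%R : measurableTypeR R).
  by apply: measurable_funD.
transitivity (\int[pushforward_measure lebesgue_measure mc]_t f t).
  by rewrite ge0_integral_pushforward.
by apply: eq_measure_integral => A mA _; exact: lebesgue_measure_shift.
Qed.

Lemma row_sigma_finite n (mu : {measure set (borel 'rV[R]_n) -> \bar R}) :
  (forall r : R, (0 < r)%R -> mu (ball 0%R r) = ((2 * r) ^+ n)%:E) ->
  sigma_finite setT mu.
Proof.
move=> muB; exists (fun k => ball 0%R k.+1%:R) => [|k]; last first.
  split; first exact: open_borel (ball_open _ _).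
  by rewrite muB// ltry.
apply/seteqP; split=> // x _; exists (Num.truncn `|x|) => //.
by rewrite -ball_normE /= sub0r normrN truncnS_gt.
Qed.

(** By Tonelli's theorem the iterated integral is integration against a product
    of one-dimensional Lebesgue measures.  The volume of cubes is part of the
    induction because it provides the sigma-finiteness that the next product
    needs. *)
Lemma lebesgue_row_exists n :
  exists mu : {measure set (borel 'rV[R]_n) -> \bar R},
    (forall f : borel 'rV[R]_n -> \bar R, measurable_fun setT f ->
       (forall x, 0 <= f x) -> lebesgue_int f = \int[mu]_x f x) /\
    (forall r : R, (0 < r)%R -> mu (ball 0%R r) = ((2 * r) ^+ n)%:E).
Proof.
elim: n => [|m [mu [muE muB]]].
  exists (dirac (0%R : borel 'rV[R]_0)); split=> [f mf f0|r r0].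
    by rewrite integral_dirac// diracT mul1e.
  rewrite expr0 -[LHS]/(\d_(0%R : borel 'rV[R]_0) (ball (0%R : 'rV[R]_0) r)) diracE.
  by rewrite mem_set//; exact: ballxx.
have sf := row_sigma_finite muB.
pose nu := sigma_finite_measure_of sf.
pose pm : {measure set _ -> \bar R} := (@lebesgue_measure R \x nu).
have mc := @measurable_consrow R m.
exists (pushforward_measure pm mc).
split=> [f mf f0|r r0].
  have mfc : measurable_fun setT (f \o consrow : measurableTypeR R * borel 'rV[R]_m -> _).
    exact: measurableT_comp.
  rewrite ge0_integral_pushforward// preimage_setT fubini_tonelli1//=.
  apply: eq_integral => t _; rewrite /fubini_F /=.
  rewrite -muE//=.
  exact: measurableT_comp mfc (pair1_measurable t).
rewrite /= /pushforward.
have -> : (0 : 'rV[R]_m.+1)%R = consrow (0, 0)%R.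
  apply/rowP => i; rewrite mxE.
  by case: (unliftP ord0 i) => [j ->|->]; rewrite !(consrowS, consrow0) //= mxE.
rewrite preimage_consrow_ball//.
rewrite [LHS]product_measure1E /=; last 2 first.
- exact: open_measurable (ball_open _ _).
- exact: open_borel (ball_open _ _).
rewrite muB// lebesgue_measure_ball ?ltW// -EFinM exprS.
by congr (_%:E); ring.
Qed.

Definition lebesgue_row n : {measure set (borel 'rV[R]_n) -> \bar R} :=
  projT1 (cid (lebesgue_row_exists n)).

Lemma lebesgue_intE n (f : borel 'rV[R]_n -> \bar R) :
  measurable_fun setT f -> (forall x, 0 <= f x) ->
  lebesgue_int f = \int[lebesgue_row n]_x f x.
Proof. by rewrite /lebesgue_row; case: cid => mu [/= h _]; exact: h. Qed.

Lemma lebesgue_row_ball n (r : R) : (0 < r)%R ->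
  lebesgue_row n (ball 0%R r) = ((2 * r) ^+ n)%:E.
Proof. by rewrite /lebesgue_row; case: cid => mu [/= _ h]; exact: h. Qed.

(** Translation invariance passes through the iterated integral one coordinate
    at a time. *)
Lemma lebesgue_int_shift n (w : 'rV[R]_n) (f : borel 'rV[R]_n -> \bar R) :
  measurable_fun setT f -> (forall x, 0 <= f x) ->
  lebesgue_int (fun x => f (x + w)%R) = lebesgue_int f.
Proof.
elim: n w f => [|m ih] w f mf f0 /=.
  by congr (f _); apply/rowP => -[].
have [[c z] ->] := consrow_surj w.
have mfc : measurable_fun setT (f \o consrow : measurableTypeR R * borel 'rV[R]_m -> _).
  exact: measurableT_comp mf (@measurable_consrow R m).
have mt t : measurable_fun setT (fun v : borel 'rV[R]_m => f (consrow (t, v))).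
  exact: measurableT_comp mfc (pair1_measurable t).
pose G t := lebesgue_int (fun v : 'rV[R]_m => f (consrow (t, v))).
transitivity (\int[lebesgue_measure]_t G (t + c)%R).
  apply: eq_integral => t _; rewrite /G -[RHS](ih z)//.
  congr lebesgue_int; apply/funext => v; congr (f _).
  by rewrite -[RHS]/(consrow ((t : R, v) + (c, z))%R) consrowD.
have sf := row_sigma_finite (@lebesgue_row_ball m).
have GE : G = fubini_F (sigma_finite_measure_of sf)
    (f \o consrow : measurableTypeR R * borel 'rV[R]_m -> _).
  by apply/funext => t; rewrite /G lebesgue_intE.
rewrite integral_shift//.
  by rewrite GE; apply: measurable_fun_fubini_tonelli_F => // x; exact: f0.
by move=> t; rewrite /G lebesgue_intE //; exact: integral_ge0.
Qed.

Lemma integral_lebesgue_row_shift n (w : 'rV[R]_n)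
    (f : borel 'rV[R]_n -> \bar R) :
  measurable_fun setT f -> (forall x, 0 <= f x) ->
  \int[lebesgue_row n]_x f (x + w)%R = \int[lebesgue_row n]_x f x.
Proof.
move=> mf f0; rewrite -[RHS]lebesgue_intE// -(lebesgue_int_shift w)// lebesgue_intE//.
apply: (measurableT_comp mf).
apply: (@continuous_borel_map 'rV[R]_n 'rV[R]_n).
exact: continuous_shift.
Qed.

End LebesgueRow.

(** * Real square-integrable functions *)

Section SquareIntegrable.
Context {R : realType} {d : measure_display} {X : measurableType d}.
Variable mu : {measure set X -> \bar R}.
Implicit Types a b c : X -> R.

Definition sqint a : Prop :=
  measurable_fun setT a /\ mu.-integrable setT (EFin \o (fun x => a x ^+ 2)).

Definition ip a b : R := \int[mu]_x (a x * b x).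

Lemma integrable_scale k a : mu.-integrable setT (EFin \o a) ->
  mu.-integrable setT (EFin \o (fun x => k * a x)).
Proof.
move=> /(integrableZl measurableT k).
by apply: eq_integrable => // x _ /=; rewrite EFinM.
Qed.

Lemma integrable_add a b : mu.-integrable setT (EFin \o a) ->
  mu.-integrable setT (EFin \o b) ->
  mu.-integrable setT (EFin \o (fun x => a x + b x)).
Proof. exact: integrableD. Qed.

Lemma sqint_mul a b : sqint a -> sqint b ->
  mu.-integrable setT (EFin \o (fun x => a x * b x)).
Proof.
move=> [ma ia] [mb ib].
apply: (@le_integrable _ _ _ mu setT measurableT _
  (EFin \o (fun x => a x ^+ 2 + b x ^+ 2))).
- by apply/measurable_EFinP; exact: measurable_funM.
- move=> x _ /=; rewrite lee_fin (@ger0_norm _ (_ + _)) ?addr_ge0 ?sqr_ge0//.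
  by rewrite ler_norml; apply/andP; split; nra.
- exact: (integrableD measurableT ia ib).
Qed.

Lemma sqintD a b : sqint a -> sqint b -> sqint (fun x => a x + b x).
Proof.
move=> [ma ia] [mb ib]; split; first exact: measurable_funD.
apply: (@le_integrable _ _ _ mu setT measurableT _
  (EFin \o (fun x => 2 * a x ^+ 2 + 2 * b x ^+ 2))).
- by apply/measurable_EFinP/measurable_funX; exact: measurable_funD.
- move=> x _ /=; rewrite lee_fin.
  have h1 := sqr_ge0 (a x); have h2 := sqr_ge0 (b x).
  have h3 := sqr_ge0 (a x - b x); rewrite !ger0_norm ?sqr_ge0//; nra.
- exact: (integrable_add (integrable_scale 2 ia) (integrable_scale 2 ib)).
Qed.

Lemma sqintZ k a : sqint a -> sqint (fun x => k * a x).
Proof.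
move=> [ma ia]; split; first exact: measurable_funM.
by have := integrable_scale (k ^+ 2) ia; apply: eq_integrable => // x _ /=; rewrite exprMn.
Qed.

Lemma sqintN a : sqint a -> sqint (fun x => - a x).
Proof.
by move=> /(sqintZ (-1)); congr sqint; apply/funext => x; rewrite mulN1r.
Qed.

Lemma sqintB a b : sqint a -> sqint b -> sqint (fun x => a x - b x).
Proof. by move=> ha hb; exact: (sqintD ha (sqintN hb)). Qed.

Lemma ipC a b : ip a b = ip b a.
Proof. by apply: eq_Rintegral => x _; rewrite mulrC. Qed.

Lemma ipBl a b c : sqint a -> sqint b -> sqint c ->
  ip (fun x => a x - b x) c = ip a c - ip b c.
Proof.
move=> ha hb hc; rewrite /ip -RintegralB//; try exact: sqint_mul.
by apply: eq_Rintegral => x _; rewrite mulrBl.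
Qed.

Lemma ipBr a b c : sqint a -> sqint b -> sqint c ->
  ip c (fun x => a x - b x) = ip c a - ip c b.
Proof. by move=> ha hb hc; rewrite ipC ipBl// !(ipC c). Qed.

Lemma ip_ge0 a : 0 <= ip a a.
Proof. by apply: Rintegral_ge0 => x _; rewrite -expr2 sqr_ge0. Qed.

(** The weight [s] is free, so that this inequality replaces that of
    Cauchy-Schwarz without square roots.  The two signs come from integrating
    [s^-1 (s a - b)^2 >= 0] and [s^-1 (s a + b)^2 >= 0]. *)
Lemma ip_young (s : R) a b : 0 < s -> sqint a -> sqint b ->
  `|ip a b| <= (s * ip a a + s^-1 * ip b b) / 2.
Proof.
move=> s0 ha hb; rewrite /ip.
have hab := sqint_mul ha hb; have haa := sqint_mul ha ha.
have hbb := sqint_mul hb hb.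
have hs : mu.-integrable setT
    (EFin \o (fun x => (s * (a x * a x) + s^-1 * (b x * b x)))).
  exact: (integrable_add (integrable_scale s haa) (integrable_scale s^-1 hbb)).
apply: (le_trans (le_normr_Rintegral _ _)) => //.
rewrite -!RintegralZl// -RintegralD//; last 2 first.
- exact: (integrable_scale s haa).
- exact: (integrable_scale s^-1 hbb).
rewrite -RintegralZr//; apply: le_Rintegral => //.
- exact: (integrable_abse hab).
- by have := integrable_scale 2^-1 hs; apply: eq_integrable => // x _ /=; rewrite mulrC.
move=> x _; set p := a x; set q := b x.
have s1 : s * s^-1 = 1 by rewrite mulfV// gt_eqF.
have si : 0 < s^-1 by rewrite invr_gt0.
have h1 : 0 <= s^-1 * (s * p - q) ^+ 2 by rewrite mulr_ge0 ?sqr_ge0 ?ltW.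
have h2 : 0 <= s^-1 * (s * p + q) ^+ 2 by rewrite mulr_ge0 ?sqr_ge0 ?ltW.
have e1 : s^-1 * (s * p - q) ^+ 2 = s * (p * p) + s^-1 * (q * q) - 2 * (p * q).
  by field; rewrite gt_eqF.
have e2 : s^-1 * (s * p + q) ^+ 2 = s * (p * p) + s^-1 * (q * q) + 2 * (p * q).
  by field; rewrite gt_eqF.
rewrite e1 in h1; rewrite e2 in h2.
move: h1 h2; set u := s * (p * p); set v := s^-1 * (q * q).
by set w := p * q => h1 h2; rewrite ler_norml; apply/andP; split; lra.
Qed.

Lemma ip_sub_le a b : sqint a -> sqint b ->
  ip (fun x => a x - b x) (fun x => a x - b x) <= 2 * ip a a + 2 * ip b b.
Proof.
move=> ha hb; have hab := sqintB ha hb; rewrite ipBl// !ipBr// (ipC b a).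
have := ip_young ltr01 ha hb; rewrite invr1 !mul1r ler_norml => /andP[].
lra.
Qed.

(** Young's inequality with [s = e / (B + 1)]: the pairing is continuous in [b]
    at 0, uniformly for bounded [a]. *)
Lemma ip_small (B e : R) : 0 <= B -> 0 < e -> exists2 dt, 0 < dt &
  forall a b, sqint a -> sqint b -> ip a a <= B -> ip b b < dt -> `|ip a b| < e.
Proof.
move=> B0 e0; pose s := e / (B + 1).
have B1 : 0 < B + 1 by rewrite ltr_wpDl.
have s0 : 0 < s by rewrite divr_gt0.
exists (e * s); first exact: mulr_gt0.
move=> a b ha hb aB bd; apply: (le_lt_trans (ip_young s0 ha hb)).
have h1 : s * ip a a < e.
  have : s * (B + 1) = e by rewrite /s; field; rewrite gt_eqF.
  nra.
have h2 : s^-1 * ip b b < e by rewrite mulrC ltr_pdivrMr.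
by rewrite ltr_pdivrMr//; lra.
Qed.

Lemma ip_ae a a' b : sqint a -> sqint a' -> sqint b ->
  {ae mu, forall x, a x = a' x} -> ip a b = ip a' b.
Proof.
move=> ha ha' hb haa; congr fine; apply: ae_eq_integral => //.
- by apply/measurable_EFinP/measurable_funM; [exact: ha.1|exact: hb.1].
- by apply/measurable_EFinP/measurable_funM; [exact: ha'.1|exact: hb.1].
by apply: filterS haa => x /= -> _.
Qed.

End SquareIntegrable.

(** * The complex Hilbert space *)

Section ComplexL2.
Context {R : realType} {d : measure_display} {X : measurableType d}.
Variable mu : {measure set X -> \bar R}.
Implicit Types f g h u w : X -> R[i].
Local Notation re f := (fun x => complex.Re (f x)).
Local Notation im f := (fun x => complex.Im (f x)).
Local Notation csub f g := (fun x => f x - g x).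

Lemma ReB (z w : R[i]) : complex.Re (z - w) = complex.Re z - complex.Re w.
Proof. by case: z; case: w. Qed.

Lemma ImB (z w : R[i]) : complex.Im (z - w) = complex.Im z - complex.Im w.
Proof. by case: z; case: w. Qed.

Lemma complex_eqP (z w : R[i]) :
  complex.Re z = complex.Re w -> complex.Im z = complex.Im w -> z = w.
Proof. by case: z; case: w => a b a' b' /= -> ->. Qed.

(** Splitting into two copies of the real space; the properties of [inner] are
    read off from the real and imaginary parts. *)
Lemma L2P f : L2 mu f <-> sqint mu (re f) /\ sqint mu (im f).
Proof.
split=> [[mre mim fin]|[[mre ire] [mim iim]]].
  have i2 : mu.-integrable setT (EFin \o (fun x => normsq (f x))).
    apply/integrableP; split.
      by apply/measurable_EFinP; apply: measurable_funD; exact: measurable_funX.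
    rewrite (eq_integral (fun x => (normsq (f x))%:E))// => x _ /=.
    by rewrite ger0_norm// addr_ge0 ?sqr_ge0.
  by split; split=> //; apply: (le_integrable measurableT _ _ i2);
    try (by apply/measurable_EFinP; exact: measurable_funX);
    move=> x _ /=; rewrite lee_fin /normsq !ger0_norm ?addr_ge0 ?sqr_ge0//;
    rewrite ?lerDl ?lerDr sqr_ge0.
split=> //.
by have /integrable_lty := integrable_add ire iim; exact.
Qed.

Lemma Re_inner f g : L2 mu f -> L2 mu g ->
  complex.Re (inner mu f g) = ip mu (re f) (re g) + ip mu (im f) (im g).
Proof.
move=> /L2P[fr fi] /L2P[gr gi].
rewrite /ip -RintegralD//; try exact: sqint_mul.
by apply: eq_Rintegral => x _; case: (f x) => a b; case: (g x) => a' b' /=; ring.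
Qed.

Lemma Im_inner f g : L2 mu f -> L2 mu g ->
  complex.Im (inner mu f g) = ip mu (im f) (re g) - ip mu (re f) (im g).
Proof.
move=> /L2P[fr fi] /L2P[gr gi].
rewrite /ip -RintegralB//; try exact: sqint_mul.
by apply: eq_Rintegral => x _; case: (f x) => a b; case: (g x) => a' b' /=; ring.
Qed.

Lemma re_csub f g : re (csub f g) = (fun x => re f x - re g x).
Proof. by apply/funext => x; rewrite ReB. Qed.

Lemma im_csub f g : im (csub f g) = (fun x => im f x - im g x).
Proof. by apply/funext => x; rewrite ImB. Qed.

Lemma L2B f g : L2 mu f -> L2 mu g -> L2 mu (csub f g).
Proof.
move=> /L2P[fr fi] /L2P[gr gi]; apply/L2P.
by rewrite re_csub im_csub; split; exact: sqintB.
Qed.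

Lemma innerBl f g h : L2 mu f -> L2 mu g -> L2 mu h ->
  inner mu (csub f g) h = inner mu f h - inner mu g h.
Proof.
move=> hf hg hh; have hfg := L2B hf hg.
apply: complex_eqP.
  rewrite ReB !Re_inner// re_csub im_csub.
  by move/L2P: hf hg hh => [? ?] /L2P[? ?] /L2P[? ?]; rewrite !ipBl//; ring.
rewrite ImB !Im_inner// re_csub im_csub.
by move/L2P: hf hg hh => [? ?] /L2P[? ?] /L2P[? ?]; rewrite !ipBl//; ring.
Qed.

Lemma innerBr f g h : L2 mu f -> L2 mu g -> L2 mu h ->
  inner mu h (csub f g) = inner mu h f - inner mu h g.
Proof.
move=> hf hg hh; have hfg := L2B hf hg.
apply: complex_eqP.
  rewrite ReB !Re_inner// re_csub im_csub.
  by move/L2P: hf hg hh => [? ?] /L2P[? ?] /L2P[? ?]; rewrite !ipBr//; ring.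
rewrite ImB !Im_inner// re_csub im_csub.
by move/L2P: hf hg hh => [? ?] /L2P[? ?] /L2P[? ?]; rewrite !ipBr//; ring.
Qed.

Definition sqnorm f : R := complex.Re (inner mu f f).

Lemma Re_innerC f g : L2 mu f -> L2 mu g ->
  complex.Re (inner mu f g) = complex.Re (inner mu g f).
Proof. by move=> hf hg; rewrite !Re_inner// (ipC _ (re f)) (ipC _ (im f)). Qed.

Lemma sqnorm_ge0 f : L2 mu f -> 0 <= sqnorm f.
Proof. by move=> hf; rewrite /sqnorm Re_inner// addr_ge0 ?ip_ge0. Qed.

Lemma sqnorm_subC f g : sqnorm (csub f g) = sqnorm (csub g f).
Proof.
by apply: eq_Rintegral => x _; case: (f x) => a b; case: (g x) => a' b' /=; ring.
Qed.

(** The parallelogram law with one term dropped. *)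
Lemma sqnormB f g : L2 mu f -> L2 mu g ->
  sqnorm (csub f g) <= 2 * sqnorm f + 2 * sqnorm g.
Proof.
move=> hf hg; have hd := L2B hf hg; rewrite /sqnorm !Re_inner// re_csub im_csub.
move/L2P: hf hg => [? ?] /L2P[? ?].
have -> : forall a b : R, 2 * a + 2 * b = 2 * (a + b) by move=> *; ring.
rewrite addrACA mulrDr; apply: lerD; rewrite mulrDr; exact: ip_sub_le.
Qed.

Lemma inner_small (B e : R) : 0 <= B -> 0 < e -> exists2 dt, 0 < dt &
  forall f g, L2 mu f -> L2 mu g -> sqnorm f <= B -> sqnorm g < dt ->
    `|complex.Re (inner mu f g)| < e /\ `|complex.Im (inner mu f g)| < e.
Proof.
move=> B0 e0; have e20 : 0 < e / 2 by rewrite divr_gt0.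
have [dt dt0 small] := ip_small mu B0 e20.
exists dt => // f g hf hg; rewrite /sqnorm !Re_inner// Im_inner//.
have := ip_ge0 mu (re f); have := ip_ge0 mu (im f).
have := ip_ge0 mu (re g); have := ip_ge0 mu (im g) => *.
move/L2P: hf hg => [fr fi] /L2P[gr gi].
have h1 : `|ip mu (re f) (re g)| < e / 2 by apply: small => //; lra.
have h2 : `|ip mu (im f) (im g)| < e / 2 by apply: small => //; lra.
have h3 : `|ip mu (im f) (re g)| < e / 2 by apply: small => //; lra.
have h4 : `|ip mu (re f) (im g)| < e / 2 by apply: small => //; lra.
rewrite [e]splitr; split.
  by apply: (le_lt_trans (ler_normD _ _)); exact: ltrD.
by apply: (le_lt_trans (ler_normB _ _)); exact: ltrD.
Qed.

Lemma inner_ae f f' g : L2 mu f -> L2 mu f' -> L2 mu g ->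
  ae_eq2 mu f f' -> inner mu f g = inner mu f' g.
Proof.
move=> hf hf' hg ff.
have er : {ae mu, forall x, re f x = re f' x} by apply: filterS ff => x /= ->.
have ei : {ae mu, forall x, im f x = im f' x} by apply: filterS ff => x /= ->.
apply: complex_eqP; rewrite ?Re_inner ?Im_inner//.
  move/L2P: hf hf' hg => [? ?] /L2P[? ?] /L2P[? ?].
  by rewrite (ip_ae _ _ _ er)// (ip_ae _ _ _ ei).
move/L2P: hf hf' hg => [? ?] /L2P[? ?] /L2P[? ?].
by rewrite (ip_ae _ _ _ er)// (ip_ae _ _ _ ei).
Qed.

Lemma conj_inner f g : L2 mu f -> L2 mu g -> (inner mu f g)^* = inner mu g f.
Proof.
move=> hf hg; apply: complex_eqP.
  by rewrite -Re_innerC//; case: inner.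
transitivity (- complex.Im (inner mu f g)); first by case: inner.
by rewrite !Im_inner// opprB (ipC _ (im f)) (ipC _ (re f)).
Qed.

Lemma inner_aer f g g' : L2 mu f -> L2 mu g -> L2 mu g' ->
  ae_eq2 mu g g' -> inner mu f g = inner mu f g'.
Proof.
by move=> hf hg hg' gg; rewrite -conj_inner// (inner_ae hg hg' hf gg) conj_inner.
Qed.

End ComplexL2.

(** * Friedrichs extensions and cores *)

(** The final estimate of [friedrichs_core], with [p - q - (q - r)] standing for
    [<A (a - b), a - b>]. *)
Fact form_lt (R : realFieldType) (p q r e : R) :
  p < e / 4 -> - (e / 4) < q -> r < e / 4 -> p - q - (q - r) < e.
Proof. lra. Qed.

Fact quarter_add_lt (R : realFieldType) (x y e : R) :
  x < e / 4 -> y < e / 4 -> 2 * x + 2 * y < e.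
Proof. lra. Qed.

Lemma ge0_cvg0P (R : realType) (a : nat -> R) : (forall k, 0 <= a k) ->
  a @ \oo --> (0 : R) <-> forall e : R, 0 < e -> \forall k \near \oo, a k < e.
Proof.
move=> a0; split=> [/cvgrPdist_lt cva e e0|h].
  by near=> k; rewrite -[a k]ger0_norm// -normrN -sub0r; near: k; exact: cva.
apply/cvgrPdist_lt => e e0; near=> k.
by rewrite sub0r normrN ger0_norm//; near: k; exact: h.
Unshelve. all: by end_near. Qed.

Section FriedrichsCore.
Context {R : realType} {d : measure_display} {X : measurableType d}.
Variable mu : {measure set X -> \bar R}.
Implicit Types f g u w : X -> R[i].
Local Notation csub f g := (fun x => f x - g x).

Variables (D D0 : set (X -> R[i])) (A : (X -> R[i]) -> (X -> R[i])).
Hypothesis D0D : D0 `<=` D.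
Hypothesis D_L2 : forall f, D f -> L2 mu f.
Hypothesis A_L2 : forall f, D f -> L2 mu (A f).
Hypothesis D_sub : forall f g, D f -> D g -> D (csub f g).
Hypothesis A_sub : forall f g, D f -> D g -> A (csub f g) = csub (A f) (A g).
Hypothesis A_sym : forall f g, D f -> D g -> inner mu (A f) g = inner mu f (A g).
Hypothesis D0_dense : forall f (e : R), D f -> 0 < e ->
  exists g, [/\ D0 g, sqnorm mu (csub f g) < e & sqnorm mu (csub (A f) (A g)) < e].

(** A form-Cauchy sequence [phi] in [D] is replaced term by term by a sequence
    [psi] in [D0] that is closer and closer to it in the graph norm.  With
    [a = phi j - phi k] and [b = (phi j - psi j) - (phi k - psi k)] one has
    [psi j - psi k = a - b], and the value of the form at [a - b] differs from
    its value at [a] by [2 Re <a, A b>] and [<A b, b>]; these are small since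
    [a] is bounded while [b] and [A b] are small.  The adjoint relation passes
    from [D0] to [D] because both of its sides are continuous for the graph
    norm. *)
Lemma friedrichs_core u w : friedrichs mu D A u w <-> friedrichs mu D0 A u w.
Proof.
split=> -[u2 w2 [phi [Dphi cvphi cauphi]] adj]; split=> //; last 2 first.
- exists phi; split=> //; move=> k; exact: D0D.
- move=> f Df; have Af := A_L2 Df; have f2 := D_L2 Df.
  have key (e : R) : 0 < e ->
      `|complex.Re (inner mu u (A f) - inner mu w f)| < e /\
      `|complex.Im (inner mu u (A f) - inner mu w f)| < e.
    move=> e0; have e20 : 0 < e / 2 by rewrite divr_gt0.
    have [d1 d10 s1] := inner_small mu (sqnorm_ge0 u2) e20.
    have [d2 d20 s2] := inner_small mu (sqnorm_ge0 w2) e20.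
    have d0 : 0 < Num.min d1 d2 by rewrite lt_min d10.
    have [g [D0g fg Afg]] := D0_dense Df d0.
    move: fg Afg; rewrite !lt_min => /andP[_ fg] /andP[Afg _].
    have Ag := A_L2 (D0D D0g); have g2 := D_L2 (D0D D0g).
    have [a1 a2] := s1 _ _ u2 (L2B Af Ag) (lexx _) Afg.
    have [b1 b2] := s2 _ _ w2 (L2B f2 g2) (lexx _) fg.
    have E : inner mu u (A f) - inner mu w f =
        inner mu u (csub (A f) (A g)) - inner mu w (csub f g).
      by rewrite !innerBr// (adj _ D0g); ring.
    rewrite E ReB ImB [e]splitr; split;
      by apply: (le_lt_trans (ler_normB _ _)); exact: ltrD.
  apply/eqP; rewrite -subr_eq0; apply/eqP; apply: complex_eqP => /=;
    apply/eqP; rewrite -normr_le0; apply/ler_addgt0Pr => e /key[h1 h2];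
    by rewrite add0r ltW.
- have d0 k : 0 < k.+1%:R^-1 :> R by rewrite invr_gt0.
  pose psi k := projT1 (cid (D0_dense (Dphi k) (d0 k))).
  have psiP k : [/\ D0 (psi k), sqnorm mu (csub (phi k) (psi k)) < k.+1%:R^-1 &
      sqnorm mu (csub (A (phi k)) (A (psi k))) < k.+1%:R^-1].
    by rewrite /psi; case: cid.
  have phi2 k : L2 mu (phi k) by exact: D_L2.
  have Dpsi k : D (psi k) by have [/D0D] := psiP k.
  have psi2 k : L2 mu (psi k) by exact: D_L2.
  have harm (e : R) : 0 < e -> \forall k \near \oo, k.+1%:R^-1 < e.
    by move=> e0; near=> k; near: k; exact: (near_infty_natSinv_lt (PosNum e0)).
  have cvphi' := (ge0_cvg0P (fun k => sqnorm_ge0 (L2B u2 (phi2 k)))).1 cvphi.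
  exists psi; split=> [k|/=|e e0]; first by have [] := psiP k.
    apply/ge0_cvg0P => [k|e e0]; first exact: sqnorm_ge0 (L2B u2 (psi2 k)).
    have e4 : 0 < e / 4 by rewrite divr_gt0.
    have cvphi4 := cvphi' _ e4; near=> k.
    rewrite -[X in X < e]/(sqnorm mu (csub u (psi k))).
    have -> : csub u (psi k) = csub (csub u (phi k)) (csub (psi k) (phi k)).
      by apply/funext => x; ring.
    apply: (le_lt_trans (sqnormB (L2B u2 (phi2 k)) (L2B (psi2 k) (phi2 k)))).
    have h1 : sqnorm mu (csub (psi k) (phi k)) < e / 4.
      rewrite sqnorm_subC; have [_ h _] := psiP k; apply: (lt_trans h).
      by near: k; exact: harm.
    have h2 : sqnorm mu (csub u (phi k)) < e / 4 by near: k.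
    by apply: quarter_add_lt.
  have e4 : 0 < e / 4 by rewrite divr_gt0.
  have [dt dt0 small] := inner_small mu (ler0n _ 4) e4.
  have m0 : 0 < Num.min 1 (dt / 4) by rewrite lt_min ltr01 divr_gt0.
  have [N1 _ h1] := harm _ m0.
  have [N2 _ h2] := cvphi' _ ltr01.
  have [N3 h3] := cauphi _ e4.
  exists (maxn N1 (maxn N2 N3)) => j k.
  rewrite !geq_max => /and3P[j1 j2 j3] /and3P[k1 k2 k3] /=.
  pose eta i := csub (phi i) (psi i).
  pose a := csub (phi j) (phi k); pose b := csub (eta j) (eta k).
  have Deta i : D (eta i) by exact: D_sub.
  have Da : D a by exact: D_sub.
  have Db : D b by exact: D_sub.
  rewrite -[X in X < e]/(complex.Re (inner mu (A (csub (psi j) (psi k)))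
    (csub (psi j) (psi k)))).
  have -> : csub (psi j) (psi k) = csub a b.
    by apply/funext => x; rewrite /a /b /eta; ring.
  have a2 := D_L2 Da; have b2 := D_L2 Db; have Aa := A_L2 Da; have Ab := A_L2 Db.
  have ndist i : (N2 <= i)%N -> sqnorm mu (csub u (phi i)) < 1.
    by move=> /h2.
  (* [a] is the difference of two functions at distance at most 1 from [u]. *)
  have na : sqnorm mu a <= 4.
    have -> : a = csub (csub u (phi k)) (csub u (phi j)).
      by apply/funext => x; rewrite /a; ring.
    apply: (le_trans (sqnormB (L2B u2 (phi2 k)) (L2B u2 (phi2 j)))).
    by apply/ltW/quarter_add_lt; rewrite divff ?pnatr_eq0//; exact: ndist.
  have [_ bj bj'] := psiP j; have [_ bk bk'] := psiP k.
  have := h1 _ j1; have := h1 _ k1; rewrite /= !lt_min => /andP[k11 k1d] /andP[j11 j1d].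
  have nb : sqnorm mu b < dt.
    apply: (le_lt_trans (sqnormB (D_L2 (Deta j)) (D_L2 (Deta k)))).
    by apply: quarter_add_lt; [exact: lt_trans bj j1d|exact: lt_trans bk k1d].
  have nAb : sqnorm mu (A b) < dt /\ sqnorm mu (A b) <= 4.
    have AE i : A (eta i) = csub (A (phi i)) (A (psi i)) by exact: A_sub.
    have := sqnormB (A_L2 (Deta j)) (A_L2 (Deta k)).
    rewrite -A_sub// -/b !AE => le; split; apply: (le_lt_trans le) || apply: (le_trans le).
      by apply: quarter_add_lt; [exact: lt_trans bj' j1d|exact: lt_trans bk' k1d].
    apply/ltW/quarter_add_lt; rewrite divff ?pnatr_eq0//;
      [exact: lt_trans bj' j11|exact: lt_trans bk' k11].
  have [s1 _] := small _ _ a2 Ab na nAb.1.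
  have [s2 _] := small _ _ Ab b2 nAb.2 nb.
  have s3 := h3 _ _ j3 k3; rewrite -/a in s3.
  change (complex.Re (inner mu (A (csub a b)) (csub a b)) < e).
  rewrite (A_sub Da Db) (innerBl Aa Ab (L2B a2 b2)).
  rewrite (innerBr a2 b2 Aa) (innerBr a2 b2 Ab).
  rewrite !ReB (A_sym Da Db) (Re_innerC Ab a2).
  move: s1 s2; rewrite !ltr_norml => /andP[s1 _] /andP[_ s2].
  exact: form_lt s3 s1 s2.
- by move=> f /D0D; exact: adj.
Unshelve. all: by end_near. Qed.

End FriedrichsCore.

(** * Transport along a bijection up to a null set *)

Section Transport.
Context {R : realType} {d d' : measure_display}.
Context {X' : measurableType d'} {X : measurableType d}.
Variable mu : {measure set X -> \bar R}.
Variables (emb : X' -> X) (ret : X -> X').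
Hypothesis memb : measurable_fun setT emb.
Hypothesis mret : measurable_fun setT ret.
Hypothesis embK : cancel emb ret.
Hypothesis retK_ae : {ae mu, forall x, emb (ret x) = x}.
Let mu' := pushforward_measure mu mret.
Local Notation pull f := (fun x => f (ret x)).
Local Notation res f := (fun y => f (emb y)).

Lemma sqint_pull (a : X' -> R) : sqint mu' a <-> sqint mu (pull a).
Proof.
split=> -[ma ia]; split.
- exact: measurableT_comp ma mret.
- move/integrableP : ia => [mia fia]; apply/integrableP; split.
    exact: measurableT_comp mia mret.
  have mabs : measurable_fun setT
      (fun y => `|(EFin \o (fun x0 => (a x0 ^+ 2)%R)) y|%E).
    by apply: measurableT_comp mia.
  by move: fia; rewrite ge0_integral_pushforward.
- rewrite (_ : a = (fun y => (pull a) (emb y))).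
    exact: measurableT_comp ma memb.
  by apply/funext => y; rewrite embK.
- apply: integrable_pushforward => //.
  apply/measurable_EFinP/measurable_funX.
  rewrite (_ : a = (fun y => (pull a) (emb y))).
    exact: measurableT_comp ma memb.
  by apply/funext => y; rewrite embK.
Qed.

Lemma ip_pull (a b : X' -> R) : sqint mu' a -> sqint mu' b ->
  ip mu' a b = ip mu (pull a) (pull b).
Proof.
move=> ha hb; congr fine; have [ma _] := ha; have [mb _] := hb.
rewrite integral_pushforward//.
  by apply/measurable_EFinP; exact: measurable_funM.
by apply: sqint_mul; apply/sqint_pull.
Qed.

Lemma L2_pull (f : X' -> R[i]) : L2 mu' f <-> L2 mu (pull f).
Proof.
have [r1 r2] := sqint_pull (fun y => complex.Re (f y)).
have [i1 i2] := sqint_pull (fun y => complex.Im (f y)).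
by split=> /L2P[hr hi]; apply/L2P; split; [exact: r1|exact: i1|exact: r2|exact: i2].
Qed.

Lemma inner_pull (f g : X' -> R[i]) : L2 mu' f -> L2 mu' g ->
  inner mu' f g = inner mu (pull f) (pull g).
Proof.
move=> hf hg; have hf' := (L2_pull f).1 hf; have hg' := (L2_pull g).1 hg.
apply: complex_eqP; rewrite ?Re_inner ?Im_inner//.
  by move/L2P: hf hg => [? ?] /L2P[? ?]; rewrite !ip_pull.
by move/L2P: hf hg => [? ?] /L2P[? ?]; rewrite !ip_pull.
Qed.

Lemma pull_res_ae (f : X -> R[i]) : ae_eq2 mu (pull (res f)) f.
Proof. by apply: filterS retK_ae => x /= ->. Qed.

Lemma L2_res (f : X -> R[i]) : L2 mu f -> L2 mu' (res f).
Proof.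
move=> /L2P[[mre ire] [mim iim]]; apply/L2P.
split; apply/sqint_pull; split.
- exact: measurableT_comp (measurableT_comp mre memb) mret.
- apply/integrableP; split.
    apply/measurable_EFinP/measurable_funX.
    exact: measurableT_comp (measurableT_comp mre memb) mret.
  move/integrableP : ire => [mre2]; congr (_ < _)%E; apply: ae_eq_integral => //.
  + exact: measurableT_comp.
  + do 2 apply: measurableT_comp => //; apply: measurable_funX.
    exact: measurableT_comp (measurableT_comp mre memb) mret.
  by apply: filterS retK_ae => x /= ->.
- exact: measurableT_comp (measurableT_comp mim memb) mret.
- apply/integrableP; split.
    apply/measurable_EFinP/measurable_funX.
    exact: measurableT_comp (measurableT_comp mim memb) mret.
  move/integrableP : iim => [mim2]; congr (_ < _)%E; apply: ae_eq_integral => //.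
  + exact: measurableT_comp.
  + do 2 apply: measurableT_comp => //; apply: measurable_funX.
    exact: measurableT_comp (measurableT_comp mim memb) mret.
  by apply: filterS retK_ae => x /= ->.
Qed.

(** The inverse is [res], up to a null set. *)
Lemma pull_unitary : unitary mu' mu (fun f => pull f).
Proof.
split.
- split=> [f /L2_pull//|f g _ _ [N [mN N0 fgN]]].
  exists (ret @^-1` N); split; first by rewrite -[X in measurable X]setTI; exact: mret.
    exact: N0.
  by move=> x /= fg; apply: fgN.
- by move=> a f g _ _; apply: aeW.
- by move=> f g hf hg; rewrite inner_pull.
- by move=> h hh; exists (res h); [exact: L2_res|exact: pull_res_ae].
Qed.

Variables (D' : set (X' -> R[i])) (A' : (X' -> R[i]) -> (X' -> R[i])).
Variables (D0 : set (X -> R[i])) (A : (X -> R[i]) -> (X -> R[i])).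
Hypothesis D0_L2 : forall f, D0 f -> L2 mu f.
Hypothesis A_L2 : forall f, D0 f -> L2 mu (A f).
Hypothesis D0_sub : forall f g, D0 f -> D0 g -> D0 (fun x => f x - g x).
Hypothesis D'_res : D' = [set res f | f in D0].
Hypothesis A'_res : forall f, D0 f -> A' (res f) = res (A f).

Lemma inner_pull_res (f : X' -> R[i]) (g : X -> R[i]) :
  L2 mu' f -> L2 mu g -> inner mu' f (res g) = inner mu (pull f) g.
Proof.
move=> hf hg; rewrite inner_pull//; last exact: L2_res.
exact: inner_aer ((L2_pull f).1 hf) ((L2_pull (res g)).1 (L2_res hg)) hg
  (@pull_res_ae g).
Qed.

Lemma inner_res_res (f g : X -> R[i]) :
  L2 mu f -> L2 mu g -> inner mu' (res f) (res g) = inner mu f g.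
Proof.
move=> hf hg; rewrite inner_pull_res//; last exact: L2_res.
exact: inner_ae ((L2_pull (res f)).1 (L2_res hf)) hf hg (@pull_res_ae f).
Qed.

(** All clauses of [friedrichs] are expressed by inner products, which [pull] and
    [res] preserve, being inverse to each other almost everywhere. *)
Lemma friedrichs_pull u w :
  friedrichs mu' D' A' u w <-> friedrichs mu D0 A (pull u) (pull w).
Proof.
have sqn f : L2 mu f -> L2 mu' u ->
    sqnorm mu' (fun y => u y - res f y) = sqnorm mu (fun x => pull u x - f x).
  move=> hf hu; have hu' := (L2_pull u).1 hu; have hrf := L2_res hf.
  have ae : ae_eq2 mu (fun x => pull u x - pull (res f) x)
      (fun x => pull u x - f x) by apply: filterS retK_ae => x /= ->.
  have h1 : L2 mu (fun x => pull u x - pull (res f) x).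
    exact: (L2_pull (fun y => u y - res f y)).1 (L2B hu hrf).
  have h2 : L2 mu (fun x => pull u x - f x) by exact: L2B.
  rewrite /sqnorm inner_pull; [|exact: L2B|exact: L2B].
  by rewrite (inner_ae h1 h2 h1 ae) (inner_aer h2 h1 h2 ae).
have form f g : D0 f -> D0 g ->
    inner mu' (A' (fun y => res f y - res g y)) (fun y => res f y - res g y) =
    inner mu (A (fun x => f x - g x)) (fun x => f x - g x).
  move=> Df Dg; have Dfg := D0_sub Df Dg.
  rewrite (A'_res Dfg) (@inner_res_res (A (fun x => f x - g x)) (fun x => f x - g x))//;
    [exact: A_L2|exact: D0_L2].
split=> -[u2 w2 [phi [Dphi cvphi cauphi]] adj].
- split; [exact: (L2_pull u).1 u2|exact: (L2_pull w).1 w2| |].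
    have /choice[psi psiP] : forall k, exists f, D0 f /\ phi k = res f.
      by move=> k; have := Dphi k; rewrite D'_res => -[f Df <-]; exists f.
    have D0psi k : D0 (psi k) by case: (psiP k).
    have phiE : phi = fun k => res (psi k).
      by apply/funext => k; case: (psiP k).
    rewrite phiE in cvphi cauphi.
    exists psi; split=> //.
    + have E : (fun k => sqnorm mu' (fun y => u y - res (psi k) y)) =
          (fun k => sqnorm mu (fun x => pull u x - psi k x)).
        by apply/funext => k; exact: sqn (D0_L2 (D0psi k)) u2.
      change ((fun k => sqnorm mu (fun x => pull u x - psi k x)) @ \oo --> (0 : R)).
      by rewrite -E; exact: cvphi.
    + move=> e e0; have [N hN] := cauphi e e0; exists N => j k Nj Nk.
      by have := hN j k Nj Nk; cbv zeta; rewrite form.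
  move=> f Df; rewrite -inner_pull_res//; last exact: A_L2.
  rewrite -A'_res// adj; last by rewrite D'_res; exists f.
  by rewrite inner_pull_res//; exact: D0_L2.
- move: ((L2_pull u).2 u2) ((L2_pull w).2 w2) => {}u2 {}w2.
  split=> //.
    exists (fun k => res (phi k)); split.
    + by move=> k; rewrite D'_res; exists (phi k).
    + have E : (fun k => sqnorm mu' (fun y => u y - res (phi k) y)) =
          (fun k => sqnorm mu (fun x => pull u x - phi k x)).
        by apply/funext => k; exact: sqn (D0_L2 (Dphi k)) u2.
      change ((fun k => sqnorm mu' (fun y => u y - res (phi k) y)) @ \oo --> (0 : R)).
      by rewrite E; exact: cvphi.
    + move=> e e0; have [N hN] := cauphi e e0; exists N => j k Nj Nk.
      by have := hN j k Nj Nk; cbv zeta; rewrite form.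
  rewrite D'_res => _ [f Df <-]; rewrite A'_res// inner_pull_res//; last exact: A_L2.
  by rewrite adj// inner_pull_res//; exact: D0_L2.
Qed.

End Transport.

(** * Calculus of C^k functions *)

Section CkCalculus.
Context {R : realType}.
Implicit Types (n k : nat).

(** Restriction to the line [h |-> h v + x] reduces a directional derivative to
    the one-variable case, where the chain rule and the mean value theorem
    apply. *)
Lemma is_derive_lineP (V : normedModType R) (f : V -> R) x v (a : R) :
  is_derive x v f a <-> is_derive (0 : R) (1 : R) (fun h : R => f (h *: v + x)) a.
Proof.
have E : 'D_v f x = 'D_1 (fun h : R => f (h *: v + x)) 0.
  rewrite /derive; set g1 := fun h => h^-1 *: _; set g2 := fun h => h^-1 *: _.
  suff -> : g1 = g2 by []; apply/funext => h; rewrite /g1 /g2 /=.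
  by rewrite addr0 scale0r add0r [_%:A]mulr1.
split=> -[df dfE]; split; [|by rewrite -E| |by rewrite E].
  exact: (derivable1P f x v).1 df.
exact: (derivable1P f x v).2 df.
Qed.

Lemma is_derive_comp_real (V : normedModType R) (g : R -> R) (f : V -> R) x v
    (a b : R) : is_derive (f x) (1 : R) g a -> is_derive x v f b ->
  is_derive x v (fun y => g (f y)) (a * b).
Proof.
move=> ga /is_derive_lineP fb; apply/is_derive_lineP.
by apply: (@is_derive1_comp _ g (fun h => f (h *: v + x)) 0); rewrite ?scale0r ?add0r.
Qed.

Lemma Ck_onS n k (U : set 'rV[R]_n) f : Ck_on k.+1 U f -> Ck_on k U f.
Proof.
elim: k f => [|k ih] f; first by case.
by move=> [cf df]; split=> // i; have [dfi /ih] := df i; split.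
Qed.

Lemma Ck_on_le n j k (U : set 'rV[R]_n) f :
  (j <= k)%N -> Ck_on k U f -> Ck_on j U f.
Proof.
elim: k => [|k ih]; first by rewrite leqn0 => /eqP ->.
by rewrite leq_eqVlt => /orP[/eqP ->//|/ih h /Ck_onS].
Qed.

Lemma Ck_on_derivable n k (U : set 'rV[R]_n) f : Ck_on k.+1 U f ->
  forall i x, U x ->
    is_derive x (delta_mx 0 i : 'rV[R]_n) f (partial i f x).
Proof. by move=> [_ df] i x Ux; apply: derivableP; have [+ _] := df i; exact. Qed.

Lemma Ck_on_partial n k (U : set 'rV[R]_n) f i :
  Ck_on k.+1 U f -> Ck_on k U (partial i f).
Proof. by move=> [_ df]; have [] := df i. Qed.

Lemma Ck_onSI n k (U : set 'rV[R]_n) (f : 'rV[R]_n -> R)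
    (df : 'I_n -> 'rV[R]_n -> R) :
  (forall x, U x -> {for x, continuous f}) ->
  (forall i x, U x -> is_derive x (delta_mx 0 i : 'rV[R]_n) f (df i x)) ->
  (forall i, Ck_on k U (partial i f)) -> Ck_on k.+1 U f.
Proof. by move=> cf hf h; split=> // i; split=> // x Ux; have [] := hf i x Ux. Qed.

Lemma near_open n (U : set 'rV[R]_n) x (P : 'rV[R]_n -> Prop) :
  open U -> U x -> (forall y, U y -> P y) -> \forall y \near x, P y.
Proof. by move=> oU Ux h; apply: filterS h _; exact: open_nbhs_nbhs. Qed.

Lemma partial_eq n (U : set 'rV[R]_n) f g i : open U ->
  (forall x, U x -> f x = g x) -> forall x, U x -> partial i f x = partial i g x.
Proof. by move=> oU fg x Ux; apply: near_eq_derive; exact: near_open fg. Qed.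

Lemma Ck_on_eq n k (U : set 'rV[R]_n) f g : open U ->
  (forall x, U x -> f x = g x) -> Ck_on k U f -> Ck_on k U g.
Proof.
move=> oU; elim: k f g => [|k ih] f g fg.
  move=> [cf _]; split=> // x Ux; have fgx := near_open oU Ux fg.
  rewrite /prop_for /continuous_at -(fg _ Ux).
  exact: cvg_trans (near_eq_cvg fgx) (cf _ Ux).
move=> [cf df]; split=> [x Ux|i].
  rewrite /prop_for /continuous_at -(fg _ Ux); have fgx := near_open oU Ux fg.
  exact: cvg_trans (near_eq_cvg fgx) (cf _ Ux).
have [dfi Cdf] := df i; split=> [x Ux|].
  by apply: near_eq_derivable (dfi _ Ux); exact: near_open fg.
by apply: ih Cdf; exact: partial_eq.
Qed.

Lemma Ck_on_sub n k (U V : set 'rV[R]_n) f :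
  U `<=` V -> Ck_on k V f -> Ck_on k U f.
Proof.
move=> UV; elim: k f => [|k ih] f [cf df]; split=> //.
- by move=> x /UV; exact: cf.
- by move=> x /UV; exact: cf.
- by move=> i; have [dfi /ih Cd] := df i; split=> // x /UV; exact: dfi.
Qed.

(** Smoothness is local; this glues a function on an open set with zero on the
    complement of its support. *)
Lemma Ck_on_setU n k (U V : set 'rV[R]_n) f :
  Ck_on k U f -> Ck_on k V f -> Ck_on k (U `|` V) f.
Proof.
elim: k f => [|k ih] f [cU dU] [cV dV]; split=> //.
- by move=> x [/cU|/cV].
- by move=> x [/cU|/cV].
- move=> i; have [dUi CU] := dU i; have [dVi CV] := dV i.
  by split=> [x [/dUi|/dVi]//|]; exact: ih.
Qed.

Lemma Ck_on_cst n k (U : set 'rV[R]_n) (c : R) : Ck_on k U (fun=> c).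
Proof.
elim: k c => [|k ih] c; first by split=> // x _; exact: cst_continuous.
split=> [x _|i]; first exact: cst_continuous.
split=> [x _|]; first by apply: (@ex_derive _ _ _ _ _ _ _ (is_derive_cst c x _)).
rewrite (_ : partial i _ = fun=> 0) //.
by apply/funext => x; rewrite /partial derive_cst.
Qed.

Lemma is_derive_coord n (i j : 'I_n) (x : 'rV[R]_n) :
  is_derive x (delta_mx 0 i : 'rV[R]_n) (fun y : 'rV[R]_n => y 0 j) (i == j)%:R.
Proof.
apply/is_derive_lineP.
rewrite (_ : (fun h : R => _) = (fun h : R => h * (i == j)%:R + x 0 j)); last first.
  by apply/funext => h; rewrite !mxE eqxx eq_sym.
apply: is_derive_eq; by rewrite addr0 !(scaler0, add0r) /GRing.scale /= !mulr1.
Qed.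

Lemma Ck_on_coord n k (U : set 'rV[R]_n) j : Ck_on k U (fun x => x 0 j).
Proof.
case: k => [|k]; first by split=> // x _; exact: coord_continuous.
apply: (Ck_onSI (df := fun i _ => (i == j)%:R)).
- by move=> x _; exact: coord_continuous.
- by move=> i x _; exact: is_derive_coord.
- move=> i; rewrite (_ : partial i _ = fun=> (i == j)%:R); first exact: Ck_on_cst.
  by apply/funext => x; rewrite /partial; have [_ ->] := is_derive_coord i j x.
Qed.

Lemma Ck_onD n k (U : set 'rV[R]_n) f g : open U ->
  Ck_on k U f -> Ck_on k U g -> Ck_on k U (fun x => f x + g x).
Proof.
move=> oU; elim: k f g => [|k ih] f g Cf Cg.
  by split=> // x Ux; apply: continuousD; [exact: Cf.1|exact: Cg.1].
have h i x : U x -> is_derive x (delta_mx 0 i : 'rV[R]_n) (fun x => f x + g x)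
    (partial i f x + partial i g x).
  move=> Ux; have fi := Ck_on_derivable Cf i Ux.
  by have gi := Ck_on_derivable Cg i Ux; exact: is_deriveD.
apply: (Ck_onSI _ h) => [x Ux|i].
  by apply: continuousD; [exact: Cf.1|exact: Cg.1].
apply: (Ck_on_eq oU _ (ih _ _ (Ck_on_partial i Cf) (Ck_on_partial i Cg))).
by move=> x Ux; rewrite {3}/partial; have [_ ->] := h i x Ux.
Qed.

Lemma Ck_onM n k (U : set 'rV[R]_n) f g : open U ->
  Ck_on k U f -> Ck_on k U g -> Ck_on k U (fun x => f x * g x).
Proof.
move=> oU; elim: k f g => [|k ih] f g Cf Cg.
  by split=> // x Ux; apply: continuousM; [exact: Cf.1|exact: Cg.1].
have h i x : U x -> is_derive x (delta_mx 0 i : 'rV[R]_n) (fun x => f x * g x)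
    (f x * partial i g x + g x * partial i f x).
  move=> Ux; have fi := Ck_on_derivable Cf i Ux.
  by have gi := Ck_on_derivable Cg i Ux; exact: is_deriveM.
apply: (Ck_onSI _ h) => [x Ux|i].
  by apply: continuousM; [exact: Cf.1|exact: Cg.1].
have C1 := ih _ _ (Ck_onS Cf) (Ck_on_partial i Cg).
have C2 := ih _ _ (Ck_onS Cg) (Ck_on_partial i Cf).
apply: (Ck_on_eq oU _ (Ck_onD oU C1 C2)).
by move=> x Ux; rewrite {3}/partial; have [_ ->] := h i x Ux.
Qed.

(** [G] lists the successive derivatives of one function, so that the chain rule
    stays within the family and the induction on [k] goes through. *)
Lemma Ck_on_comp n k (U : set 'rV[R]_n) (G : nat -> R -> R) f m : open U ->
  (forall m t, is_derive t (1 : R) (G m) (G m.+1 t)) ->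
  Ck_on k U f -> Ck_on k U (fun x => G m (f x)).
Proof.
move=> oU hG; have cG m' t : {for t, continuous (G m')}.
  by apply/differentiable_continuous/derivable1_diffP; have [] := hG m' t.
elim: k f m => [|k ih] f m Cf.
  split=> // x Ux; apply: continuous_comp; [exact: Cf.1|exact: cG].
have h i x : U x -> is_derive x (delta_mx 0 i : 'rV[R]_n) (fun x => G m (f x))
    (G m.+1 (f x) * partial i f x).
  by move=> Ux; exact: is_derive_comp_real (hG _ _) (Ck_on_derivable Cf i Ux).
apply: (Ck_onSI _ h) => [x Ux|i].
  by apply: continuous_comp; [exact: Cf.1|exact: cG].
have C1 := ih _ m.+1 (Ck_onS Cf).
apply: (Ck_on_eq oU _ (Ck_onM oU C1 (Ck_on_partial i Cf))).
by move=> x Ux; rewrite {2}/partial; have [_ ->] := h i x Ux.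
Qed.

Lemma is_derive_scale_arg (V : normedModType R) (f : V -> R) x v (c a : R) :
  is_derive (c *: x) v f a -> is_derive x v (fun y => f (c *: y)) (c * a).
Proof.
move=> /is_derive_lineP fa; apply/is_derive_lineP.
rewrite (_ : (fun h : R => _) = (fun h : R => f (h *: v + c *: x)) \o ( *%R c)).
  rewrite mulrC; apply: is_derive1_comp; first by rewrite mulr0.
  by apply: is_derive_eq; rewrite /GRing.scale /= mulr1.
by apply/funext => h /=; rewrite scalerDr scalerA.
Qed.

Lemma partial_scale n (f : 'rV[R]_n -> R) i c : Ck_on 1 setT f ->
  partial i (fun x => f (c *: x)) = fun x => c * partial i f (c *: x).
Proof.
move=> Cf; apply/funext => x; rewrite {1}/partial.
have H : is_derive (c *: x) (delta_mx 0 i : 'rV[R]_n) f (partial i f (c *: x)).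
  exact: (Ck_on_derivable Cf).
by have [_ ->] := is_derive_scale_arg H.
Qed.

Lemma Ck_on_scale n k (f : 'rV[R]_n -> R) c :
  Ck_on k setT f -> Ck_on k setT (fun x => f (c *: x)).
Proof.
elim: k f => [|k ih] f Cf.
  split=> // x _; apply: continuous_comp; last exact: Cf.1.
  exact: scaler_continuous.
apply: (Ck_onSI (df := fun i x => c * partial i f (c *: x))).
- move=> x _; apply: continuous_comp; last exact: Cf.1.
  exact: scaler_continuous.
- by move=> i x _; apply: is_derive_scale_arg; exact: (Ck_on_derivable Cf).
- move=> i; rewrite partial_scale; last exact: Ck_on_le Cf.
  by apply: (Ck_onM openT (Ck_on_cst _ _ _)); apply: ih; exact: Ck_on_partial.
Qed.

End CkCalculus.

(** * A smooth bump function *)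

Section Bump.
Context {R : realType}.

(** Induction on [p] for all [k] at once, since Horner's rule trades a degree of
    [p] for a power of [y]; the constant case follows from
    [y / (k + 1) <= exp (y / (k + 1))]. *)
Lemma expR_decay (p : {poly R}) k :
  exists2 C : R, 0 <= C & forall y, 0 <= y -> `|p.[y]| * y ^+ k * expR (- y) <= C.
Proof.
elim/poly_ind: p k => [|p c ih] k.
  by exists 0 => // y y0; rewrite horner0 normr0 !mul0r.
have hpow : exists2 C : R, 0 <= C & forall y : R, 0 <= y -> y ^+ k * expR (- y) <= C.
  exists (k.+1%:R ^+ k.+1 + 1); first by rewrite addr_ge0 ?exprn_ge0.
  move=> y y0; have [y1|y1] := leP y 1.
    apply: (@le_trans _ _ 1); last by rewrite lerDr exprn_ge0.
    rewrite -[leRHS]mulr1; apply: ler_pM; rewrite ?exprn_ge0 ?expR_ge0//.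
      by rewrite exprn_ile1.
    by rewrite -expR0 ler_expR oppr_le0.
  apply: (@le_trans _ _ (k.+1%:R ^+ k.+1)); last by rewrite lerDl.
  have h : y ^+ k.+1 <= k.+1%:R ^+ k.+1 * expR y.
    have -> : expR y = expR (y / k.+1%:R) ^+ k.+1.
      by rewrite -expRM_natl mulrC divfK// pnatr_eq0.
    rewrite -exprMn; apply: lerXn2r; rewrite ?nnegrE ?mulr_ge0 ?expR_ge0//.
    rewrite mulrC -ler_pdivrMr ?ltr0n//.
    by apply: le_trans (expR_ge1Dx _); rewrite lerDr.
  rewrite expRN ler_pdivrMr ?expR_gt0//; apply: le_trans h.
  by apply: ler_weXn2l => //; exact: ltW.
have [C1 C10 h1] := ih k.+1; have [C2 C20 h2] := hpow.
exists (C1 + `|c| * C2); first by rewrite addr_ge0 ?mulr_ge0.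
move=> y y0; rewrite hornerMXaddC.
apply: (@le_trans _ _ (`|p.[y]| * y ^+ k.+1 * expR (- y) + `|c| * (y ^+ k * expR (- y)))).
  rewrite mulrA -mulrDl ler_wpM2r ?expR_ge0//.
  rewrite exprS mulrA -mulrDl ler_wpM2r ?exprn_ge0//.
  by apply: (le_trans (ler_normD _ _)); rewrite lerD2r normrM (ger0_norm y0).
by rewrite lerD ?h1// ler_wpM2l ?h2.
Qed.

(** [p(1/s) exp(-1/s)] extended by zero: a family that is stable under
    differentiation and contains the classical flat function, [p = 1]. *)
Definition flat_exp (p : {poly R}) (s : R) : R :=
  if 0 < s then p.[s^-1] * expR (- s^-1) else 0.

(** Being quadratic, this bound makes the difference quotient at 0 tend to 0. *)
Lemma flat_exp_bound p : exists2 C : R, 0 <= C &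
  forall s, `|flat_exp p s| <= C * s ^+ 2.
Proof.
have [C C0 h] := expR_decay p 2; exists C => // s.
rewrite /flat_exp; case: ifPn => s0; last by rewrite normr0 mulr_ge0 ?sqr_ge0.
have /h : 0 <= s^-1 by rewrite invr_ge0 ltW.
rewrite mulrAC exprVn ler_pdivrMr ?exprn_gt0// => le.
by rewrite normrM (ger0_norm (expR_ge0 _)).
Qed.

(** For [s > 0] the derivative of [p(1/s) exp(-1/s)] is
    [s^-2 (p - p')(1/s) exp(-1/s)], whence the polynomial on the right. *)
Lemma is_derive_flat_exp p s :
  is_derive s (1 : R) (flat_exp p) (flat_exp ('X^2 * (p - p^`())) s).
Proof.
have [s0|s0|->] := ltgtP s 0.
- have -> : flat_exp ('X^2 * (p - p^`())) s = 0.
    by rewrite /flat_exp ltNge (ltW s0).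
  apply: (near_eq_is_derive (f := cst 0)).
  near=> t; rewrite /flat_exp ltNge ltW//=.
  by near: t; exact: lt_nbhsl.
- apply: (near_eq_is_derive (f := (fun t : R => p.[t^-1] * expR (- t^-1) : R))).
    near=> t; rewrite /flat_exp (_ : 0 < t)//.
    by near: t; exact: lt_nbhsr.
  have dV : is_derive s (1 : R) (fun t : R => t^-1) (- s ^- 2).
    apply: is_derive_eq (is_deriveV _ _) _; rewrite ?gt_eqF//.
    by rewrite /GRing.scale /= mulr1.
  rewrite /flat_exp s0 hornerM hornerXn hornerD hornerN -mulrA.
  have dp : is_derive s (1 : R) (fun t => p.[t^-1]) (p^`().[s^-1] * - s ^- 2).
    by apply: (@is_derive1_comp _ (horner p) (fun t => t^-1)).
  have de : is_derive s (1 : R) (fun t => expR (- t^-1)) (expR (- s^-1) * - (- s ^- 2)).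
    exact: (@is_derive1_comp _ expR (fun t => - t^-1)).
  apply: is_derive_eq (is_deriveM dp de) _.
  by rewrite /GRing.scale /= opprK exprVn; ring.
- have [C C0 hC] := flat_exp_bound p.
  have -> : flat_exp ('X^2 * (p - p^`())) 0 = 0 by rewrite /flat_exp ltxx.
  have H : (fun h : R => h^-1 *: ((flat_exp p \o shift 0) (h *: (1 : R)) - flat_exp p 0))
      @ 0^' --> (0 : R).
    apply/cvgrPdist_lt => e e0; near=> h.
    have h0 : h != 0 by near: h; exact: nbhs_dnbhs_neq.
    rewrite sub0r normrN /= addr0 {2}/flat_exp ltxx subr0 /GRing.scale /= mulr1.
    rewrite normrM normfV ltr_pdivrMl ?normr_gt0//.
    apply: (le_lt_trans (hC h)); rewrite -[h ^+ 2]ger0_norm ?sqr_ge0// normrX.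
    rewrite expr2 mulrCA ltr_pM2l ?normr_gt0//.
    have he : `|h| < e / (C + 1).
      by near: h; apply: dnbhs0_lt; rewrite divr_gt0// ltr_wpDl.
    rewrite ltr_pdivlMr ?ltr_wpDl// in he.
    by apply: le_lt_trans he; rewrite mulrC ler_wpM2l// lerDl.
  by split; [apply/cvg_ex; exists 0|exact/cvg_lim].
Unshelve. all: by end_near. Qed.

(** The [m]-th derivative of the flat function. *)
Definition flat_expn m := flat_exp (iter m (fun p => 'X^2 * (p - p^`())) 1).

Lemma flat_exp0 s : s <= 0 -> flat_expn 0 s = 0.
Proof. by move=> s0; rewrite /flat_expn /flat_exp ltNge s0. Qed.

Lemma flat_expE s : 0 < s -> flat_expn 0 s = expR (- s^-1).
Proof. by move=> s0; rewrite /flat_expn /flat_exp s0 hornerC mul1r. Qed.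

Lemma Ck_on_sum n k (U : set 'rV[R]_n) I (r : seq I) (F : I -> 'rV[R]_n -> R) :
  open U -> (forall i, Ck_on k U (F i)) -> Ck_on k U (fun x => \sum_(i <- r) F i x).
Proof.
move=> oU CF; elim: r => [|i r ih].
  rewrite (_ : (fun _ => _) = fun=> 0); first exact: Ck_on_cst.
  by apply/funext => x; rewrite big_nil.
rewrite (_ : (fun _ => _) = fun x => F i x + \sum_(j <- r) F j x).
  exact: Ck_onD.
by apply/funext => x; rewrite big_cons.
Qed.

(** Let [g] be the flat function and [q] the squared Euclidean norm, and consider
    [exp 2 * g (1/2 - g (q x - 1))].  Near 0, [q x < 1], so that the inner [g]
    vanishes and the value is [exp 2 * g (1/2) = 1].  Where the sup norm is at
    least 2, [q x - 1 >= 2], so that the inner [g] is at least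
    [exp (- 1/2) >= 1/2] and the outer one vanishes. *)
Lemma bump_exists n : exists chi : 'rV[R]_n -> R,
  [/\ smooth_on setT chi, forall x, 2 <= `|x| -> chi x = 0 &
      \forall x \near (0 : 'rV[R]_n), chi x = 1].
Proof.
pose q (x : 'rV[R]_n) := \sum_i x 0 i ^+ 2.
pose psi x := flat_expn 0 (2^-1 - flat_expn 0 (q x - 1)).
have h2 : flat_expn 0 2^-1 = expR (- 2) by rewrite flat_expE ?invr_gt0// invrK.
have Dg m t : is_derive t (1 : R) (flat_expn m) (flat_expn m.+1 t).
  exact: is_derive_flat_exp.
have Cq k : Ck_on k setT q.
  apply: Ck_on_sum openT _ => i.
  by apply: Ck_onM openT _ _; exact: Ck_on_coord.
exists (fun x => expR 2 * psi x); split.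
- move=> k; apply: Ck_onM (openT) (Ck_on_cst _ _ _) _.
  apply: Ck_on_comp => //; first exact: openT.
  apply: Ck_onD openT (Ck_on_cst _ _ _) _.
  rewrite (_ : (fun x => _) = fun x => -1 * flat_expn 0 (q x - 1)); last first.
    by apply/funext => x; rewrite mulN1r.
  apply: Ck_onM openT (Ck_on_cst _ _ _) _.
  apply: Ck_on_comp => //; first exact: openT.
  exact: Ck_onD openT (Cq k) (Ck_on_cst _ _ _).
- move=> x x2; rewrite /psi.
  have [[i j] /= xi] : exists ij, mx_norm x = `|x ij.1 ij.2|.
    by apply: mx_norm_neq0; rewrite gt_eqF// (lt_le_trans _ x2).
  rewrite [X in _ <= X]xi ord1 in x2.
  have q4 : 4 <= q x.
    have x4 : 4 <= x 0 j ^+ 2.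
      by rewrite -[leRHS]ger0_norm ?sqr_ge0// normrX; nra.
    rewrite /q (bigD1 j)//= -[leLHS]addr0; apply: lerD => //.
    by apply: sumr_ge0 => ? _; rewrite sqr_ge0.
  have q1 : 2 <= q x - 1 by lra.
  rewrite (@flat_exp0 (_ - _)) ?mulr0// subr_le0 flat_expE; last by lra.
  apply: le_trans (expR_ge1Dx _).
  have : (q x - 1)^-1 <= 2^-1 by rewrite lef_pV2 ?posrE//; lra.
  lra.
- have /cvgr_lt : {for (0 : 'rV[R]_n), continuous q} by exact: (Cq 0%N).1.
  rewrite (_ : q 0 = 0); last by rewrite /q big1// => i _; rewrite mxE expr0n.
  move=> /(_ 1 ltr01); apply: filterS => x qx; rewrite /psi.
  rewrite (@flat_exp0 (_ - 1)) ?subr_le0 ?ltW// subr0 h2.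
  by rewrite -expRD subrr expR0.
Qed.

End Bump.

(** * Integration by parts *)

Section IntegrationByParts.
Context {R : realType}.
Variable n : nat.
Implicit Types (f g F : 'rV[R]_n -> R) (r B : R).
Local Notation mu := (@lebesgue_row R n).
Local Notation e_ i := (delta_mx 0 i : 'rV[R]_n).

Lemma is_derive_along (V : normedModType R) (f : V -> R) x v (t a : R) :
  is_derive (t *: v + x) v f a ->
  is_derive t (1 : R) (fun s : R => f (s *: v + x)) a.
Proof.
move=> /is_derive_lineP fa.
have -> : (fun s : R => f (s *: v + x)) =
    (fun h : R => f (h *: v + (t *: v + x))) \o (fun s => s - t).
  by apply/funext => s /=; rewrite addrA -scalerDl subrK.
rewrite -[a]mulr1; apply: is_derive1_comp; first by rewrite subrr.
by apply: is_derive_eq; rewrite subr0.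
Qed.

Definition bounded_support f := exists2 r, 0 < r & forall x, r <= `|x| -> f x = 0.

Lemma bounded_support_le f : continuous f -> bounded_support f ->
  exists2 B, 0 <= B & forall x, `|f x| <= B.
Proof.
move=> cf [r r0 f0].
pose A : set 'rV[R]_n := [set v | forall i, `[- r, r]%classic (v 0 i)].
have cA : compact A.
  by apply: (@rV_compact _ _ (fun=> `[- r, r]%classic)) => _; exact: segment_compact.
have A0 : A 0 by move=> i; rewrite mxE /= in_itv /= oppr_le0 ltW.
have [||c cA' maxc] := @EVT_max_rV R n (fun x => `|f x|) A _ cA; first by exists 0.
  apply: continuous_subspaceT => x; apply: continuous_comp; first exact: cf.
  exact: norm_continuous.
exists `|f c| => // x; have [xr|/f0 ->] := ltP `|x| r; last by rewrite normr0.
apply: maxc; rewrite inE => i /=; rewrite in_itv /= -ler_norml.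
exact: le_trans (coord_norm_le x i) (ltW xr).
Qed.

Lemma integrable_bounded_support f B r : measurable_fun setT (f : borel 'rV[R]_n -> R) ->
  0 < r -> (forall x, `|f x| <= B) -> (forall x, r <= `|x| -> f x = 0) ->
  mu.-integrable setT (EFin \o (f : borel 'rV[R]_n -> R)).
Proof.
move=> mf r0 fB f0; have mball : measurable (ball 0 r : set (borel 'rV[R]_n)).
  by apply: open_borel; exact: ball_open.
apply: (@le_integrable _ _ _ mu setT measurableT _
  (EFin \o (fun x : borel 'rV[R]_n => B * \1_(ball (0 : 'rV[R]_n) r) x))).
- exact/measurable_EFinP.
- move=> x _ /=; rewrite lee_fin indicE.
  have [xr|xr] := ltP `|x : 'rV[R]_n| r.
    rewrite mem_set ?mulr1; last by rewrite -ball_normE /= sub0r normrN.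
    exact: le_trans (fB x) (ler_norm _).
  by rewrite f0// normr0.
- apply: integrable_scale; apply/integrableP; split.
    by apply/measurable_EFinP; exact: measurable_indic.
  rewrite (eq_integral (fun x : borel 'rV[R]_n => (\1_(ball (0 : 'rV[R]_n) r) x)%:E)); last first.
    by move=> x _ /=; rewrite ger0_norm.
  by rewrite integral_indic// setIT lebesgue_row_ball// ltry.
Qed.

Lemma integrable_continuous_support f : continuous f -> bounded_support f ->
  mu.-integrable setT (EFin \o (f : borel 'rV[R]_n -> R)).
Proof.
move=> cf bf; have [B _ fB] := bounded_support_le cf bf.
have [r r0 f0] := bf; apply: integrable_bounded_support r0 fB f0.
exact: continuous_borel_fun.
Qed.

Lemma measurable_row_shift w :
  measurable_fun setT (fun x : borel 'rV[R]_n => (x + w : borel 'rV[R]_n)).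
Proof.
by apply: (@continuous_borel_map 'rV[R]_n 'rV[R]_n); exact: continuous_shift.
Qed.

Lemma integrable_shift f w :
  mu.-integrable setT (EFin \o (f : borel 'rV[R]_n -> R)) ->
  mu.-integrable setT (EFin \o ((fun x => f (x + w)) : borel 'rV[R]_n -> R)).
Proof.
move=> /integrableP[mf fin]; apply/integrableP; split.
  exact: measurableT_comp mf (measurable_row_shift w).
rewrite (integral_lebesgue_row_shift w (f := fun x => `|(f x)%:E|%E))//.
by apply: measurableT_comp mf.
Qed.

Lemma Rintegral_shift f w : mu.-integrable setT (EFin \o (f : borel 'rV[R]_n -> R)) ->
  \int[mu]_x f (x + w) = \int[mu]_x f x.
Proof.
move=> fint; have msh := measurable_row_shift w.
have E (A : set (borel 'rV[R]_n)) : measurable A -> A `<=` setT ->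
    pushforward_measure mu msh A = mu A.
  move=> mA _.
  have ind (C : set (borel 'rV[R]_n)) : measurable C ->
      mu C = (\int[mu]_x (\1_C x)%:E)%E.
    by move=> mC; rewrite integral_indic// setIT.
  rewrite [RHS]ind// -(integral_lebesgue_row_shift w); last 2 first.
  - by apply/measurable_EFinP; exact: measurable_indic.
  - by move=> x; rewrite lee_fin.
  by rewrite /= /pushforward ind// -[X in measurable X]setTI; exact: msh.
have [mf _] := integrableP _ _ _ fint.
transitivity (\int[pushforward_measure mu msh]_x f x).
  apply/esym; congr fine.
  exact: (integral_pushforward msh mf (integrable_shift w fint) measurableT).
by congr fine; exact: eq_measure_integral E.
Qed.

Lemma norm_scale_delta (h : R) i : `|h *: e_ i| <= `|h|.
Proof.
apply: norm_row_le => // j; rewrite !mxE eqxx normrM /=.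
by case: eqP => _; rewrite ?normr1 ?normr0 ?mulr1 ?mulr0.
Qed.

Lemma bounded_support_partial F i : bounded_support F -> bounded_support (partial i F).
Proof.
move=> [r r0 F0]; exists (r + 1) => [|x xr]; first by rewrite addr_gt0.
rewrite /partial (near_eq_derive (g := cst 0)) ?derive_cst//.
near=> y; apply: F0; rewrite leNgt; apply/negP => yr.
have xy : `|x - y| < 1.
  by near: y; have := nbhsx_ballx x (1:R) ltr01; rewrite -ball_normE.
have xle : `|x| <= `|x - y| + `|y| by rewrite -{1}(subrK y x) ler_normD.
have := le_lt_trans (le_trans xr xle) (ltrD xy yr).
by rewrite addrC ltxx.
Unshelve. all: by end_near. Qed.

(** The mean value theorem along the [i]-th axis. *)
Lemma diff_quotient F x i (h : R) : 0 < h -> Ck_on 1 setT F ->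
  exists c, F (h *: e_ i + x) - F x = partial i F (c *: e_ i + x) * h.
Proof.
move=> h0 CF.
have D t : is_derive t (1 : R) (fun s : R => F (s *: e_ i + x))
    (partial i F (t *: e_ i + x)).
  by apply: is_derive_along; exact: (Ck_on_derivable CF).
have [|c _] := MVT h0 (fun t _ => D t).
  apply: continuous_subspaceT => t; apply/differentiable_continuous/derivable1_diffP.
  by have [] := D t.
by rewrite scale0r add0r subr0 => ->; exists c.
Qed.

(** The difference quotients [D k] have integral 0 by translation invariance.
    They converge to the partial derivative, are bounded by its supremum and
    vanish outside a fixed ball, so that dominated convergence applies. *)
Lemma integral_partial0 F i : Ck_on 1 setT F -> bounded_support F ->
  \int[mu]_x partial i F x = 0.
Proof.
move=> CF sF; have cF : continuous F by move=> x; exact: CF.1.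
have cdF : continuous (partial i F) by move=> x; exact: (Ck_on_partial i CF).1.
have [B B0 dFB] := bounded_support_le cdF (bounded_support_partial i sF).
have [r r0 F0] := sF.
pose D (k : nat) (x : 'rV[R]_n) : R := k.+1%:R * (F (x + k.+1%:R^-1 *: e_ i) - F x).
have iF := integrable_continuous_support cF sF.
have k0 k : 0 < k.+1%:R^-1 :> R by rewrite invr_gt0.
have cD k : continuous (D k).
  have cs : continuous (fun x : 'rV[R]_n => F (x + k.+1%:R^-1 *: e_ i)).
    move=> x; apply: (@continuous_comp 'rV[R]_n 'rV[R]_n R
      (fun y => y + k.+1%:R^-1 *: e_ i) F x _ (cF _)).
    exact: continuous_shift.
  move=> x; apply: (@continuousM R 'rV[R]_n (fun=> k.+1%:R) (fun y => _ - F y) x).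
    exact: cst_continuous.
  exact: (@continuousB R _ 'rV[R]_n _ F x (cs x) (cF x)).
have DE k x : D k x = k.+1%:R * (F (k.+1%:R^-1 *: e_ i + x) - F x).
  by rewrite /D (addrC x).
have DB k x : `|D k x| <= B.
  have [c Fc] := diff_quotient x i (k0 k) CF.
  by rewrite DE Fc mulrCA mulfV ?mulr1// pnatr_eq0.
have D0 k x : r + 1 <= `|x| -> D k x = 0.
  move=> xr; rewrite /D !F0 ?subrr ?mulr0//; first by rewrite (le_trans _ xr) ?lerDl.
  set w := _ *: _; have w1 : `|w| <= 1.
    apply: (le_trans (norm_scale_delta _ _)).
    have k1 : k.+1%:R^-1 <= 1 :> R by rewrite invf_le1 ?ltr0n// ler1n.
    by rewrite ger0_norm// ltW.
  have xle : `|x| <= `|x + w| + `|w| by rewrite -{1}(addrK w x) ler_normB.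
  by rewrite -(lerD2r 1) (le_trans xr)// (le_trans xle)// lerD2l.
have intD k : mu.-integrable setT (EFin \o (D k : borel 'rV[R]_n -> R)).
  apply: integrable_bounded_support (DB k) (D0 k); last by rewrite addr_gt0.
  exact: continuous_borel_fun.
have ID k : \int[mu]_x D k x = 0.
  have iFw := integrable_shift (k.+1%:R^-1 *: e_ i) iF.
  rewrite RintegralZl//; last exact: (integrableB measurableT iFw iF).
  by rewrite RintegralB// Rintegral_shift// subrr mulr0.
have Dcvg x : (fun k => D k x) @ \oo --> partial i F x.
  have [+ _] := Ck_on_derivable CF i (I : setT x).
  move=> /cvg_ex[l hl]; have : partial i F x = l by exact/cvg_lim.
  move=> ->; apply/cvgrPdist_lt => e e0.
  move/cvgrPdist_lt : hl => /(_ e e0)[d /= d0 hd]; near=> k.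
  have kd : k.+1%:R^-1 < d by near: k; exact: (near_infty_natSinv_lt (PosNum d0)).
  have /hd : ball (0 : R) d k.+1%:R^-1.
    by rewrite -ball_normE /= sub0r normrN ger0_norm// ltW.
  by rewrite /= invrK /GRing.scale /= -DE; apply; rewrite gt_eqF.
pose g (x : borel 'rV[R]_n) := B * \1_(ball (0 : 'rV[R]_n) (r + 1)) x.
have ig : mu.-integrable setT (EFin \o g).
  apply: (@integrable_bounded_support g B (r + 1)).
  - apply: measurable_funM => //; apply: measurable_indic.
    exact: open_borel (ball_open _ _).
  - by rewrite addr_gt0.
  - move=> x; rewrite /g indicE normrM (ger0_norm B0).
    by case: (_ \in _); rewrite ?normr1 ?normr0 ?mulr1 ?mulr0.
  - move=> x xr; rewrite /g indicE memNset ?mulr0// -ball_normE /= sub0r normrN.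
    by rewrite ltNge xr.
have Dg (x : 'rV[R]_n) k : (`|(D k x)%:E| <= (g x)%:E)%E.
  rewrite lee_fin /g indicE; have [xr|xr] := ltP `|x| (r + 1).
    by rewrite mem_set ?mulr1//= -ball_normE /= sub0r normrN.
  by rewrite D0// normr0 mulr_ge0.
have mD k : measurable_fun setT ((fun x => (D k x)%:E) : borel 'rV[R]_n -> \bar R).
  by apply/measurable_EFinP; exact: continuous_borel_fun.
have mdF : measurable_fun setT ((fun x => (partial i F x)%:E) : borel 'rV[R]_n -> \bar R).
  by apply/measurable_EFinP; exact: continuous_borel_fun.
have lim0 : {ae mu, forall x, [set: borel 'rV[R]_n] x ->
    (fun k => (D k x)%:E) @ \oo --> (partial i F x)%:E}.
  apply: aeW => x _; apply: cvg_comp (Dcvg x) _; exact: cvg_id.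
have dom : {ae mu, forall x k, [set: borel 'rV[R]_n] x ->
    (`|(D k x)%:E| <= (EFin \o g) x)%E}.
  by apply: aeW => x k _; exact: Dg.
have [_ _ lim] := dominated_convergence measurableT mD mdF lim0 ig dom.
rewrite /Rintegral; suff -> : (\int[mu]_x (partial i F x)%:E = 0)%E by [].
apply: cvg_unique lim _; first exact: ereal_hausdorff.
rewrite (_ : (fun _ => _) = cst 0%E); first exact: cvg_cst.
apply/funext => k /=; rewrite -[LHS]fineK; first by have := ID k; rewrite /Rintegral => ->.
exact: integrable_fin_num (intD k).
Unshelve. all: by end_near. Qed.

End IntegrationByParts.

(** * The Laplacian on smooth functions of bounded support *)

Section EuclideanLaplacian.
Context {R : realType}.
Variable n : nat.
Implicit Types (f g F chi : 'rV[R]_n -> R).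
Local Notation mu := (@lebesgue_row R n).

(** The sign is that of [laplacian_real], which makes the operator nonnegative. *)
Definition nlap f : 'rV[R]_n -> R :=
  fun x => - \sum_i partial i (partial i f) x.

Definition Cc f : Prop := smooth_on setT f /\ bounded_support f.

Lemma Cc_continuous f : Cc f -> continuous f.
Proof. by move=> [sf _] x; exact: (sf 0%N).1. Qed.

Lemma Cc_integrable f : Cc f ->
  mu.-integrable setT (EFin \o (f : borel 'rV[R]_n -> R)).
Proof.
by move=> Cf; apply: integrable_continuous_support; [exact: Cc_continuous|exact: Cf.2].
Qed.

Lemma Cc_partial f i : Cc f -> Cc (partial i f).
Proof.
move=> [sf bf]; split; last exact: bounded_support_partial.
by move=> k; exact: Ck_on_partial (sf k.+1).
Qed.

Lemma Cc_add f g : Cc f -> Cc g -> Cc (fun x => f x + g x).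
Proof.
move=> [sf [r r0 f0]] [sg [s s0 g0]]; split.
  by move=> k; exact: Ck_onD openT (sf k) (sg k).
exists (Num.max r s) => [|x]; first by rewrite lt_max r0.
by rewrite ge_max => /andP[/f0 -> /g0 ->]; rewrite addr0.
Qed.

Lemma Cc_mulr f g : smooth_on setT f -> Cc g -> Cc (fun x => f x * g x).
Proof.
move=> sf [sg [s s0 g0]]; split.
  by move=> k; exact: Ck_onM openT (sf k) (sg k).
by exists s => // x /g0 ->; rewrite mulr0.
Qed.

Lemma Cc_mul f g : Cc f -> Cc g -> Cc (fun x => f x * g x).
Proof. by move=> [sf _]; exact: Cc_mulr. Qed.

Lemma smooth_cst (c : R) : smooth_on setT (fun _ : 'rV[R]_n => c).
Proof. by move=> k; exact: Ck_on_cst. Qed.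

Lemma Cc_sub f g : Cc f -> Cc g -> Cc (fun x => f x - g x).
Proof.
move=> Cf Cg; have := Cc_add Cf (Cc_mulr (@smooth_cst (-1)) Cg).
by congr Cc; apply/funext => x; rewrite mulN1r.
Qed.

Lemma Cc_sum I (r : seq I) (F : I -> 'rV[R]_n -> R) :
  (forall i, Cc (F i)) -> Cc (fun x => \sum_(i <- r) F i x).
Proof.
move=> CF; elim: r => [|i r ih].
  split; last by exists 1 => // x _; rewrite big_nil.
  move=> k; rewrite (_ : (fun _ => _) = fun=> 0); first exact: Ck_on_cst.
  by apply/funext => x; rewrite big_nil.
rewrite (_ : (fun _ => _) = fun x => F i x + \sum_(j <- r) F j x).
  exact: Cc_add.
by apply/funext => x; rewrite big_cons.
Qed.

Lemma Cc_nlap f : Cc f -> Cc (nlap f).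
Proof.
move=> Cf; have Cs : Cc (fun x => \sum_i partial i (partial i f) x).
  by apply: Cc_sum => i; do 2 apply: Cc_partial.
have := Cc_mulr (@smooth_cst (-1)) Cs.
by congr Cc; apply/funext => x; rewrite mulN1r.
Qed.

Lemma Cc_sqint f : Cc f -> sqint mu f.
Proof.
move=> Cf; split; first by apply: continuous_borel_fun; exact: Cc_continuous.
by have := Cc_integrable (Cc_mul Cf Cf); apply: eq_integrable.
Qed.

Lemma Rintegral_sum d (T : measurableType d) (nu : {measure set T -> \bar R})
    I (r : seq I) (F : I -> T -> R) :
  (forall i, nu.-integrable setT (EFin \o F i)) ->
  \int[nu]_x (\sum_(i <- r) F i x) = \sum_(i <- r) \int[nu]_x F i x.
Proof.
move=> iF; suff: nu.-integrable setT (EFin \o (fun x => \sum_(i <- r) F i x)) /\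
    \int[nu]_x (\sum_(i <- r) F i x) = \sum_(i <- r) \int[nu]_x F i x by case.
elim: r => [|i r [ih1 ih2]].
  rewrite (_ : (fun _ => _) = fun=> 0); last by apply/funext => x; rewrite big_nil.
  split; first exact: integrable0.
  by rewrite big_nil /Rintegral integral0.
rewrite (_ : (fun _ => _) = fun x => F i x + \sum_(j <- r) F j x); last first.
  by apply/funext => x; rewrite big_cons.
by split; [exact: integrable_add|rewrite big_cons RintegralD// ih2].
Qed.

Lemma partialM f g i : Ck_on 1 setT f -> Ck_on 1 setT g ->
  partial i (fun x => f x * g x) = fun x => f x * partial i g x + g x * partial i f x.
Proof.
move=> Cf Cg; apply/funext => x; have fi := Ck_on_derivable Cf i (I : setT x).
have gi := Ck_on_derivable Cg i (I : setT x).
by rewrite {1}/partial; have [_ ->] := is_deriveM fi gi.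
Qed.

Lemma partialD f g i : Ck_on 1 setT f -> Ck_on 1 setT g ->
  partial i (fun x => f x + g x) = fun x => partial i f x + partial i g x.
Proof.
move=> Cf Cg; apply/funext => x; have fi := Ck_on_derivable Cf i (I : setT x).
have gi := Ck_on_derivable Cg i (I : setT x).
by rewrite {1}/partial; have [_ ->] := is_deriveD fi gi.
Qed.

Lemma partialB f g i : Ck_on 1 setT f -> Ck_on 1 setT g ->
  partial i (fun x => f x - g x) = fun x => partial i f x - partial i g x.
Proof.
move=> Cf Cg; apply/funext => x; have fi := Ck_on_derivable Cf i (I : setT x).
have gi := Ck_on_derivable Cg i (I : setT x).
by rewrite {1}/partial; have [_ ->] := is_deriveB fi gi.
Qed.

Lemma nlapB f g : Cc f -> Cc g ->
  nlap (fun x => f x - g x) = fun x => nlap f x - nlap g x.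
Proof.
move=> Cf Cg; apply/funext => x; rewrite /nlap -opprB opprK addrC -sumrB.
apply: (congr1 -%R); apply: eq_bigr => i _.
rewrite (partialB i (Cf.1 1%N) (Cg.1 1%N)).
by rewrite (partialB i ((Cc_partial i Cf).1 1%N) ((Cc_partial i Cg).1 1%N)).
Qed.

(** Green's formula: [f_ii g - f g_ii] is the [i]-th partial derivative of
    [f_i g - f g_i], whose integral vanishes. *)
Lemma nlap_sym f g : Cc f -> Cc g -> ip mu (nlap f) g = ip mu f (nlap g).
Proof.
move=> Cf Cg.
have key i : \int[mu]_x (partial i (partial i f) x * g x) =
    \int[mu]_x (f x * partial i (partial i g) x).
  have Cfi := Cc_partial i Cf; have Cgi := Cc_partial i Cg.
  have Cfii := Cc_partial i Cfi; have Cgii := Cc_partial i Cgi.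
  pose F (x : 'rV[R]_n) := partial i f x * g x - f x * partial i g x.
  have CF : Cc F by apply: Cc_sub; exact: Cc_mul.
  apply/eqP; rewrite -subr_eq0 -RintegralB//; last 2 first.
  - exact: Cc_integrable (Cc_mul Cfii Cg).
  - exact: Cc_integrable (Cc_mul Cf Cgii).
  apply/eqP; rewrite -[RHS](integral_partial0 i (CF.1 1%N) CF.2).
  apply: eq_Rintegral => x _; rewrite /F.
  rewrite (partialB i ((Cc_mul Cfi Cg).1 1%N) ((Cc_mul Cf Cgi).1 1%N)).
  rewrite (partialM i (Cfi.1 1%N) (Cg.1 1%N)) (partialM i (Cf.1 1%N) (Cgi.1 1%N)).
  move: (partial i (partial i f) x) (partial i (partial i g) x) => p q.
  by move: (partial i f x) (partial i g x) (f x) (g x) => u v w y; ring.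
rewrite /ip.
transitivity (- \sum_i \int[mu]_x (partial i (partial i f) x * g x)).
  rewrite -Rintegral_sum; last first.
    by move=> i; apply: Cc_integrable; apply: Cc_mul => //; do 2 apply: Cc_partial.
  rewrite -mulN1r -RintegralZl//; last first.
    apply: Cc_integrable; apply: Cc_sum => i; apply: Cc_mul => //.
    by do 2 apply: Cc_partial.
  by apply: eq_Rintegral => x _; rewrite /nlap mulNr mulr_suml mulN1r.
under eq_bigr do rewrite key.
rewrite -Rintegral_sum; last first.
  by move=> i; apply: Cc_integrable; apply: Cc_mul => //; do 2 apply: Cc_partial.
rewrite -mulN1r -RintegralZl//; last first.
  apply: Cc_integrable; apply: Cc_sum => i; apply: Cc_mul => //.
  by do 2 apply: Cc_partial.
by apply: eq_Rintegral => x _; rewrite /nlap mulN1r mulrN mulr_sumr.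
Qed.

End EuclideanLaplacian.

(** * Cutoffs in dimension greater than 4 *)

Section Cutoff.
Context {R : realType}.
Variable n : nat.
Implicit Types (f g chi : 'rV[R]_n -> R).
Local Notation mu := (@lebesgue_row R n).

Lemma ip_le_ball g (M s : R) : Cc g -> 0 < s -> (forall x, `|g x| <= M) ->
  (forall x, s <= `|x| -> g x = 0) -> ip mu g g <= M ^+ 2 * (2 * s) ^+ n.
Proof.
move=> Cg s0 gM g0.
have mball : measurable (ball 0 s : set (borel 'rV[R]_n)).
  by apply: open_borel; exact: ball_open.
have i1 : mu.-integrable setT (EFin \o (\1_(ball 0 s) : borel 'rV[R]_n -> R)).
  apply/integrableP; split; first by apply/measurable_EFinP; exact: measurable_indic.
  rewrite (eq_integral (fun x : borel 'rV[R]_n => (\1_(ball (0 : 'rV[R]_n) s) x)%:E)); last first.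
    by move=> x _ /=; rewrite ger0_norm.
  by rewrite integral_indic// setIT lebesgue_row_ball// ltry.
have -> : M ^+ 2 * (2 * s) ^+ n =
    \int[mu]_x (M ^+ 2 * (\1_(ball 0 s) : borel 'rV[R]_n -> R) x).
  by rewrite RintegralZl// /Rintegral integral_indic// setIT lebesgue_row_ball.
apply: le_Rintegral => //.
- exact: Cc_integrable (Cc_mul Cg Cg).
- exact: integrable_scale.
move=> x _; rewrite indicE; have [xs|xs] := ltP `|x : 'rV[R]_n| s.
  rewrite mem_set; last by rewrite -ball_normE /= sub0r normrN.
  rewrite mulr1 -expr2 -[leLHS]ger0_norm ?sqr_ge0// normrX.
  by apply: lerXn2r (gM x); rewrite nnegrE ?(le_trans _ (gM x)).
by rewrite g0// mulr0 mulr_ge0 ?sqr_ge0.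
Qed.

Lemma Cc_bounds f : Cc f -> exists2 B : R, 0 <= B &
  forall x, [/\ `|f x| <= B, forall i, `|partial i f x| <= B &
    forall i, `|partial i (partial i f) x| <= B].
Proof.
move=> Cf.
have bd g : Cc g -> exists2 B : R, 0 <= B & forall x, `|g x| <= B.
  by move=> Cg; apply: bounded_support_le Cg.2; exact: Cc_continuous.
have [B B0 fB] := bd _ Cf.
have /choice[B1 HB1] : forall i, exists B : R, 0 <= B /\ forall x, `|partial i f x| <= B.
  by move=> i; have [b b0 h] := bd _ (Cc_partial i Cf); exists b.
have /choice[B2 HB2] : forall i, exists B : R, 0 <= B /\
    forall x, `|partial i (partial i f) x| <= B.
  by move=> i; have [b b0 h] := bd _ (Cc_partial i (Cc_partial i Cf)); exists b.
have s1 : 0 <= \sum_i B1 i by apply: sumr_ge0 => i _; case: (HB1 i).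
have s2 : 0 <= \sum_i B2 i by apply: sumr_ge0 => i _; case: (HB2 i).
have l1 i : B1 i <= \sum_i B1 i.
  by rewrite (bigD1 i)//= lerDl sumr_ge0// => j _; case: (HB1 j).
have l2 i : B2 i <= \sum_i B2 i.
  by rewrite (bigD1 i)//= lerDl sumr_ge0// => j _; case: (HB2 j).
exists (B + \sum_i B1 i + \sum_i B2 i); first by rewrite !addr_ge0.
move=> x; split=> [|i|i].
- by have := fB x; lra.
- have := (HB1 i).2 x; have := l1 i; lra.
- have := (HB2 i).2 x; have := l2 i; lra.
Qed.

Lemma partial_cst (c : R) i : partial i (fun _ : 'rV[R]_n => c) = fun=> 0.
Proof. by apply/funext => x; rewrite /partial derive_cst. Qed.

Lemma nlap_eq (U : set 'rV[R]_n) f g : open U ->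
  (forall x, U x -> f x = g x) -> forall x, U x -> nlap f x = nlap g x.
Proof.
move=> oU fg x Ux; apply: (congr1 -%R); apply: eq_bigr => i _.
by apply: partial_eq Ux => // y Uy; exact: partial_eq Uy.
Qed.

Lemma nlap_cst (c : R) : nlap (fun _ : 'rV[R]_n => c) = fun=> 0.
Proof.
apply/funext => x; rewrite /nlap big1 ?oppr0// => i _.
by rewrite !partial_cst.
Qed.

(** Each derivative that falls on the rescaled cutoff costs a factor [c]. *)
Lemma nlap_cutoffE f chi (c : R) x : Cc f -> Cc chi ->
  nlap (fun x => f x * chi (c *: x)) x =
  - \sum_i (c ^+ 2 * (f x * partial i (partial i chi) (c *: x)) +
            2 * c * (partial i f x * partial i chi (c *: x)) +
            partial i (partial i f) x * chi (c *: x)).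
Proof.
move=> Cf Cchi; rewrite /nlap; apply: (congr1 -%R); apply: eq_bigr => i _.
have S g : Cc g -> Ck_on 1 setT (fun x => g (c *: x)).
  by move=> Cg; apply: Ck_on_scale; exact: (Cg.1 1%N).
have Cfi := Cc_partial i Cf; have Cci := Cc_partial i Cchi.
have Z g : Cc g -> Ck_on 1 setT (fun x => c * g (c *: x)).
  by move=> Cg; exact: Ck_onM openT (Ck_on_cst _ _ _) (S g Cg).
rewrite (partialM i (Cf.1 1%N) (S _ Cchi)) (partial_scale i c (Cchi.1 1%N)).
rewrite partialD; last 2 first.
- exact: Ck_onM openT (Cf.1 1%N) (Z _ Cci).
- exact: Ck_onM openT (S _ Cchi) (Cfi.1 1%N).
rewrite (partialM i (Cf.1 1%N) (Z _ Cci)) (partialM i (S _ Cchi) (Cfi.1 1%N)).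
rewrite (partialM i (Ck_on_cst _ _ c) (S _ Cci)) (partial_scale i c (Cci.1 1%N)).
rewrite (partial_scale i c (Cchi.1 1%N)) partial_cst.
move: (partial i (partial i chi) _) (partial i (partial i f) _) => p q.
move: (partial i chi _) (partial i f _) (chi _) (f _) => u v w y.
by ring.
Qed.

(** Take [h x = f x * chi (x / t)] for a bump function [chi].  It is bounded
    uniformly in [t], [nlap h] is bounded by a multiple of [t^-2], and both
    vanish outside the ball of radius [3 t]; the squared norms are of order
    [t^n] and [t^(n - 4)], and tend to 0 because the dimension exceeds 4. *)
Lemma cutoff_small f (e : R) : (4 < n)%N -> Cc f -> 0 < e ->
  exists h, [/\ Cc h, \forall x \near (0 : 'rV[R]_n), h x = f x,
    ip mu h h < e & ip mu (nlap h) (nlap h) < e].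
Proof.
move=> n4 Cf e0; have [chi [schi chi0 chi1]] := @bump_exists R n.
have Cchi : Cc chi by split=> //; exists 2.
have [B B0 fB] := Cc_bounds Cf; have [C C0 cC] := Cc_bounds Cchi.
(* Four terms of Leibniz' rule, with multiplicity, in each of [n] coordinates. *)
pose M := n%:R * (4 * (B * C)).
have BC0 : 0 <= B * C by rewrite mulr_ge0.
have M0 : 0 <= M by rewrite !mulr_ge0.
(* The supports lie in a cube of side [6 t]. *)
pose K := ((B * C) ^+ 2 + M ^+ 2) * 6 ^+ n.
have K0 : 0 <= K by rewrite mulr_ge0 ?exprn_ge0// addr_ge0 ?sqr_ge0.
pose t := Num.min 1 (e / (K + 1)).
have t0 : 0 < t by rewrite lt_min ltr01 divr_gt0// ltr_wpDl.
have t1 : t <= 1 by rewrite ge_min lexx.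
have Kt : K * t < e.
  have : t <= e / (K + 1) by rewrite ge_min lexx orbT.
  rewrite ler_pdivlMr ?ltr_wpDl// => le; apply: lt_le_trans le.
  by rewrite mulrC ltr_pM2l// ltrDl.
have ti1 : 1 <= t^-1 by rewrite invf_ge1.
have ti0 : 0 < t^-1 by rewrite invr_gt0.
pose h (x : 'rV[R]_n) := f x * chi (t^-1 *: x).
have z x : 2 * t <= `|x| -> 2 <= `|t^-1 *: x|.
  by rewrite normrZ gtr0_norm// ler_pdivlMl// mulrC.
have Ch : Cc h.
  rewrite /h; have Cs : Cc (fun x => chi (t^-1 *: x)).
    split; first by move=> k; exact: Ck_on_scale (schi k).
    by exists (2 * t) => [|x /z /chi0//]; rewrite mulr_gt0.
  by have := Cc_mul Cf Cs.
have hB x : `|h x| <= B * C.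
  have [f1 _ _] := fB x; have [c1 _ _] := cC (t^-1 *: x).
  by rewrite normrM ler_pM.
have nlapB x : `|nlap h x| <= M * t^-1 ^+ 2.
  rewrite nlap_cutoffE// normrN; apply: (le_trans (ler_norm_sum _ _ _)).
  have -> : M * t^-1 ^+ 2 = \sum_(i < n) (4 * (B * C) * t^-1 ^+ 2).
    by rewrite sumr_const card_ord -[RHS]mulr_natl /M !mulrA.
  apply: ler_sum => i _.
  have [f1 f2 f3] := fB x; have [c1 c2 c3] := cC (t^-1 *: x).
  have b1 : `|f x * partial i (partial i chi) (t^-1 *: x)| <= B * C.
    by rewrite normrM ler_pM.
  have b2 : `|partial i f x * partial i chi (t^-1 *: x)| <= B * C.
    by rewrite normrM ler_pM.
  have b3 : `|partial i (partial i f) x * chi (t^-1 *: x)| <= B * C.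
    by rewrite normrM ler_pM.
  have t21 : 1 <= t^-1 ^+ 2 by rewrite exprn_ege1.
  have tt2 : t^-1 <= t^-1 ^+ 2 by rewrite expr2 ler_peMl// ltW.
  apply: (le_trans (ler_normD _ _)).
  have a1 : `|t^-1 ^+ 2 * (f x * partial i (partial i chi) (t^-1 *: x)) +
      2 * t^-1 * (partial i f x * partial i chi (t^-1 *: x))| <=
      t^-1 ^+ 2 * (B * C) + 2 * t^-1 ^+ 2 * (B * C).
    apply: (le_trans (ler_normD _ _)); apply: lerD.
      by rewrite normrM ger0_norm ?sqr_ge0// ler_wpM2l// sqr_ge0.
    rewrite normrM; apply: ler_pM => //.
    have -> : `|2 * t^-1| = 2 * t^-1 by rewrite ger0_norm// mulr_ge0// ltW.
    exact: ler_wpM2l.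
  have a2 : B * C <= t^-1 ^+ 2 * (B * C) by rewrite ler_peMl.
  apply: (le_trans (lerD a1 (le_trans b3 a2))).
  by rewrite le_eqVlt; apply/orP; left; apply/eqP; ring.
have t4 : t^-1 ^+ 4 * t ^+ n <= t.
  rewrite exprVn -[in t ^+ n](subnKC n4) exprD mulrA.
  rewrite (exprS t 4) (mulrC t) mulrA mulVf ?mul1r; last by rewrite expf_neq0// gt_eqF.
  by rewrite ler_piMr ?(ltW t0)// exprn_ile1// ltW.
have tn : t ^+ n <= t.
  by apply: le_trans t4; apply: ler_peMl; [exact: exprn_ge0 (ltW t0)|exact: exprn_ege1].
have e6 : (2 * (3 * t)) ^+ n = 6 ^+ n * t ^+ n.
  by rewrite -exprMn; congr (_ ^+ _); ring.
exists h; split=> //.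
- have sc : (fun x : 'rV[R]_n => t^-1 *: x) @ (0 : 'rV[R]_n) --> (0 : 'rV[R]_n).
    have := @scaler_continuous R 'rV[R]_n t^-1 0.
    by rewrite /continuous_at scaler0.
  have scx : \forall x \near (0 : 'rV[R]_n), chi (t^-1 *: x) = 1 by exact: (sc _ chi1).
  by apply: filterS scx => x xc; rewrite /h xc mulr1.
- have h0 x : 3 * t <= `|x| -> h x = 0.
    move=> xt; have /z /chi0 c0 : 2 * t <= `|x| by apply: le_trans xt; rewrite ler_pM2r// ler_nat.
    by rewrite /h c0 mulr0.
  have t30 : 0 < 3 * t by rewrite mulr_gt0.
  apply: (le_lt_trans (ip_le_ball Ch t30 hB h0)); apply: le_lt_trans Kt.
  rewrite e6 (mulrA (_ ^+ 2)); apply: ler_pM => //.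
  - by rewrite mulr_ge0 ?sqr_ge0 ?exprn_ge0.
  - by rewrite exprn_ge0// ltW.
  by rewrite /K; apply: ler_wpM2r; rewrite ?exprn_ge0// lerDl sqr_ge0.
- (* [h] vanishes on this open set, hence so do its derivatives; the radius [3 t]
     leaves room for the strict inequality. *)
  have oU : open [set x : 'rV[R]_n | 2 * t < `|x|].
    apply: (@open_comp _ _ (fun x : 'rV[R]_n => `|x|) [set y : R | 2 * t < y]).
      by move=> x _; exact: norm_continuous.
    exact: open_gt.
  have h0 x : 3 * t <= `|x| -> nlap h x = 0.
    move=> xt; have Ux : 2 * t < `|x| by apply: lt_le_trans xt; rewrite ltr_pM2r// ltr_nat.
    rewrite (nlap_eq oU (g := fun=> 0) _ Ux) ?nlap_cst// => y /ltW/z/chi0 c0.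
    by rewrite /h c0 mulr0.
  have t30 : 0 < 3 * t by rewrite mulr_gt0.
  apply: (le_lt_trans (ip_le_ball (Cc_nlap Ch) t30 nlapB h0)).
  apply: le_lt_trans Kt; rewrite e6.
  have -> : (M * t^-1 ^+ 2) ^+ 2 * (6 ^+ n * t ^+ n) =
      M ^+ 2 * 6 ^+ n * (t^-1 ^+ 4 * t ^+ n).
    by rewrite exprMn -exprM; ring.
  apply: ler_pM => //.
  - by rewrite mulr_ge0 ?sqr_ge0 ?exprn_ge0.
  - by rewrite mulr_ge0 ?exprn_ge0 ?ltW.
  by rewrite /K; apply: ler_wpM2r; rewrite ?exprn_ge0// lerDr sqr_ge0.
Qed.

End Cutoff.

(** * Manifolds with one flat chart *)

Lemma near_eq_diff (R : realType) (V W : normedModType R) (f g : V -> W) (x : V) :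
  (\forall y \near x, f y = g y) -> differentiable f x ->
  differentiable g x /\ 'd g x = 'd f x :> (V -> W).
Proof.
move=> fg dfx; have [dc fE] := (diff_locallyP x f).1 dfx.
have E : g \o shift x = cst (g x) + 'd f x +o_ (0 : V) id.
  apply/eqaddoP => e e0; have := (eqaddoP _ _ _ _).1 fE e e0.
  have fgs : \forall h \near (0 : V), f (h + x) = g (h + x) 
    by have := @continuous_shift R V x 0; rewrite /continuous_at add0r => /(_ _ fg).
  apply: filterS2 fgs => h fgh.
  suff -> : (g \o shift x - (cst (g x) + 'd f x)) h =
      (f \o shift x - (cst (f x) + 'd f x)) h by [].
  rewrite -![(_ - _ : _ -> _) _]/(_ - _) -![(_ + _ : _ -> _) _]/(_ + _) /=.
  by rewrite fgh (nbhs_singleton fg).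
have dE := diff_unique dc E.
by split; [apply/diff_locallyP; rewrite dE|rewrite dE].
Qed.

Lemma near_eq_jacobian (R : realType) m n (f g : 'rV[R]_m -> 'rV[R]_n) x :
  (\forall y \near x, f y = g y) -> differentiable f x ->
  jacobian g x = jacobian f x.
Proof.
move=> fg df; have [_ dE] := near_eq_diff fg df.
exact: (congr1 (fun h : 'rV[R]_m -> 'rV[R]_n => lin1_mx h) dE).
Qed.

Section FlatManifold.
Context {R : realType}.
Variables (n : nat) (S : ptopologicalType).
Variables (emb : S -> 'rV[R]_n) (ret : 'rV[R]_n -> S).
Let U : set 'rV[R]_n := range emb.
Hypothesis embK : cancel emb ret.
Hypothesis emb_continuous : continuous emb.
Hypothesis U_open : open U.
Hypothesis ret_continuous : {within U, continuous ret}.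
Hypothesis S_connected : connected [set: S].

(** One global chart [emb], with [ret] its inverse, extended arbitrarily outside
    the image of [emb].  Both R^n and the punctured space are of this form. *)
Definition flat_atlas : atlas_data R :=
  AtlasData (fun _ : S => setT) (fun=> emb) (fun=> ret).

Lemma retK x : U x -> emb (ret x) = x.
Proof. by move=> [y _ <-]; rewrite embK. Qed.

Lemma range_emb y : U (emb y).
Proof. by exists y. Qed.

Lemma open_ret (O' : set S) : open O' -> open (U `&` ret @^-1` O').
Proof.
move=> oO; rewrite openE => x [Ux Ox]; have Ux' : nbhs x U by exact: open_nbhs_nbhs.
have := ret_continuous; rewrite (continuous_open_subspace _ U_open) => cr.
have : nbhs (ret x) O' by exact: open_nbhs_nbhs.
by move=> /(cr x (mem_set Ux)) h; exact: filterI.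
Qed.

Lemma flat_smooth_manifold : is_smooth_manifold flat_atlas.
Proof.
split => /=.
- move=> p q pq; apply: (can_inj embK); apply: (@norm_hausdorff _ 'rV[R]_n).
  move=> A B /= nA nB; have := pq _ _ (emb_continuous nA) (emb_continuous nB).
  by move=> [z [Az Bz]]; exists (emb z).
- exists (range (fun p => emb @^-1` rational_ball p)).
    by apply: sub_countable (card_image_le _ _) _; exact: countableP.
  split=> [_ [p _ <-]|x A].
    by move/continuousP: emb_continuous; apply; exact: open_rational_ball.
  rewrite nbhsE => -[B [oB Bx] BA].
  have : nbhs (emb x) (U `&` ret @^-1` B).
    apply: open_nbhs_nbhs; split; first exact: open_ret.
    by split; [exact: range_emb|rewrite /= embK].
  move=> /rational_ball_nbhs[p px pO].
  exists (emb @^-1` rational_ball p); first by split=> //; exists p.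
  by move=> y /= /pO[_]; rewrite /= embK => /BA.
- exact: S_connected.
- by [].
- by move=> p; exact: openT.
- by [].
- by move=> p x _; exact: embK.
- by move=> p; exact: continuous_subspaceT.
- by move=> p; exact: ret_continuous.
- split; first by move=> x; exact: cvg_id.
  move=> p q j k; rewrite (_ : @in_charts_dom R flat_atlas _ p q = U); last first.
    by apply/seteqP; split=> [x []|x Ux].
  apply: (Ck_on_eq U_open _ (Ck_on_coord k U j)) => x Ux.
  by rewrite /in_charts /= retK.
Qed.

Let g : flat_atlas -> 'rV[R]_(Defs.dim flat_atlas) -> 'M[R]_(Defs.dim flat_atlas) :=
  fun _ _ => 1%:M.

Lemma flat_metric_preservingP (f : S -> S) :
  @metric_preserving R flat_atlas g f <->
  forall x, U x -> let J := jacobian (emb \o f \o ret) x in J *m J^T = 1%:M.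
Proof.
split=> h.
  by move=> x Ux; have := h point point x (conj Ux I); rewrite /= /g !mulmx1.
by move=> p q x [Ux _] /=; rewrite /g !mulmx1; exact: h.
Qed.

Lemma jacobian_id m (x : 'rV[R]_m) : jacobian id x = 1%:M.
Proof. by apply/matrixP => i j; rewrite mxE diff_val !mxE eqxx eq_sym. Qed.

Lemma sqr_norm_gt0 m (v : 'rV[R]_m) : v != 0 -> 0 < (v *m v^T) 0 0.
Proof.
move=> v0; have [j vj] : exists j, v 0 j != 0.
  apply/existsP; apply: contraNT v0; rewrite negb_exists => /forallP h.
  by apply/eqP/rowP => j; rewrite mxE; apply/eqP; have := h j; rewrite negbK.
rewrite mxE (bigD1 j)//= mxE -expr2 ltr_wpDr//; last by rewrite exprn_even_gt0.
by apply: sumr_ge0 => k _; rewrite mxE -expr2 sqr_ge0.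
Qed.

Definition flat_manifold : riemannian_manifold R.
Proof.
refine (@RiemannianManifold R flat_atlas g flat_smooth_manifold _ _ _ _).
- by move=> p i j k; exact: Ck_on_cst.
- by move=> p x _; rewrite /g trmx1.
- by move=> p x _ v v0; rewrite /g mulmx1; exact: sqr_norm_gt0.
- apply/flat_metric_preservingP => x Ux J.
  have idE : \forall y \near x, id y = (emb \o idfun \o ret) y.
    by apply: (near_open U_open Ux) => y Uy /=; rewrite retK.
  have did : differentiable (id : 'rV[R]_n -> 'rV[R]_n) x by exact: ex_diff.
  have -> : J = 1%:M := etrans (near_eq_jacobian idE did) (jacobian_id x).
  by rewrite mul1mx trmx1.
Defined.

Lemma flat_vol_density p x : @vol_density R flat_manifold p x = 1.
Proof. by rewrite /vol_density /= /g det1 sqrtr1. Qed.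

Lemma flat_laplacian (u : S -> R) q :
  @laplacian_real R flat_manifold u q = nlap (u \o ret) (emb q).
Proof.
rewrite /laplacian_real /= flat_vol_density invr1 mulN1r /nlap; congr (- _).
apply: eq_bigr => i _; rewrite (bigD1 i)//= big1 ?addr0 => [|j ji].
  congr (partial i _ _); apply/funext => y.
  by rewrite flat_vol_density /g invmx1 mxE eqxx !mul1r.
rewrite (_ : (fun y => _) = fun=> 0) ?partial_cst//.
by apply/funext => y; rewrite flat_vol_density /g invmx1 mxE eq_sym (negPf ji) mulr0 mul0r.
Qed.

End FlatManifold.

Section FlatVolume.
Context {R : realType}.
Variables (n : nat) (S : ptopologicalType).
Variables (emb : S -> 'rV[R]_n) (ret : 'rV[R]_n -> S).
Hypothesis embK : cancel emb ret.
Hypothesis emb_continuous : continuous emb.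
Hypothesis U_open : open (range emb).
Hypothesis ret_continuous : {within range emb, continuous ret}.
Hypothesis S_connected : connected [set: S].
Local Notation M :=
  (flat_manifold embK emb_continuous U_open ret_continuous S_connected).
Local Notation leb := (@lebesgue_row R n).
Hypothesis mret : measurable_fun setT (ret : borel 'rV[R]_n -> borel S).
Hypothesis retK_ae : {ae leb, forall x, emb (ret x) = x}.

(** The volume density is 1, and the images under [emb] and the preimages under
    [ret] differ by points [x] where [emb (ret x)] is not [x]. *)
Lemma flat_volume (mu : {measure set (borel M) -> \bar R}) :
  (forall A : set (borel S), measurable A -> mu A = leb (ret @^-1` A)) ->
  is_volume_measure mu.
Proof.
move=> muE p A mA _; rewrite muE//.
have imE : emb @` A = range emb `&` ret @^-1` A.
  apply/seteqP; split=> [_ [y Ay <-]|x [[y _ <-]]] /=.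
    by split; [exists y|rewrite embK].
  by rewrite embK => Ay; exists y.
have mr : measurable (ret @^-1` A : set (borel 'rV[R]_n)).
  by rewrite -[X in measurable X]setTI; exact: mret.
have mim : measurable (emb @` A : set (borel 'rV[R]_n)).
  by rewrite imE; apply: measurableI => //; exact: open_borel.
transitivity (lebesgue_int (fun x : 'rV[R]_n => (\1_(emb @` A) x)%:E)); last first.
  by congr lebesgue_int; apply/funext => x; rewrite flat_vol_density mulr1.
rewrite lebesgue_intE; last 2 first.
- by apply/measurable_EFinP; exact: measurable_indic.
- by move=> x; rewrite lee_fin.
rewrite -[ret @^-1` A]setIT -integral_indic//.
apply: ae_eq_integral => //; try by apply/measurable_EFinP; exact: measurable_indic.
apply: (@filterS _ _ (ae_filter_ringOfSetsType leb) _ _ _ retK_ae) => x /= rx _.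
congr (_%:E); rewrite imE.
rewrite !indicE in_setI (_ : x \in range emb)//.
by rewrite inE -rx; exists (ret x).
Qed.

End FlatVolume.

(** * Maps with orthogonal Jacobian *)

Section EuclideanIsometries.
Context {R : realType}.

(** [diff] is a choice function whose default value is the zero map. *)
Lemma not_differentiable_diff0 (V W : normedModType R) (f : V -> W) (x v : V) :
  ~ differentiable f x -> 'd f x v = 0.
Proof.
move=> ndf; rewrite /diff; case: xgetP => [L _ [cL fL]|_ //].
exfalso; apply: ndf; apply/diffP.
by apply: (@getPex _ (fun df : {linear V -> W} => continuous df /\ forall y,
  f y = f (lim (nbhs x)) + df (y - lim (nbhs x))
          +o_(y \near x) (y - lim (nbhs x)))); exists L.
Qed.

Variable n : nat.
Implicit Types (u v w x y : 'rV[R]_n).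

Definition dot u v : R := \sum_i u 0 i * v 0 i.

Lemma dotE u v : dot u v = (u *m v^T) 0 0.
Proof. by rewrite mxE; apply: eq_bigr => i _; rewrite mxE. Qed.

Lemma dotC u v : dot u v = dot v u.
Proof. by apply: eq_bigr => i _; rewrite mulrC. Qed.

Lemma dotDl u v w : dot (u + v) w = dot u w + dot v w.
Proof. by rewrite -big_split; apply: eq_bigr => i _; rewrite mxE mulrDl. Qed.

Lemma dotZl a u w : dot (a *: u) w = a * dot u w.
Proof. by rewrite mulr_sumr; apply: eq_bigr => i _; rewrite mxE mulrA. Qed.

Lemma dotNl u w : dot (- u) w = - dot u w.
Proof. by rewrite -scaleN1r dotZl mulN1r. Qed.

Lemma dotDr u v w : dot w (u + v) = dot w u + dot w v.
Proof. by rewrite dotC dotDl !(dotC w). Qed.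

Lemma dotZr a u w : dot w (a *: u) = a * dot w u.
Proof. by rewrite dotC dotZl dotC. Qed.

Lemma dotNr u w : dot w (- u) = - dot w u.
Proof. by rewrite dotC dotNl dotC. Qed.

Lemma dot_ge0 u : 0 <= dot u u.
Proof. by apply: sumr_ge0 => i _; rewrite -expr2 sqr_ge0. Qed.

Lemma dot_eq0 u : dot u u = 0 -> u = 0.
Proof.
move=> /eqP; rewrite psumr_eq0; last by move=> i _; rewrite -expr2 sqr_ge0.
move=> /allP h; apply/rowP => i; rewrite mxE; apply/eqP.
by have := h i (mem_index_enum i); rewrite mulf_eq0 orbb.
Qed.

(** Where a map is not differentiable its Jacobian takes the default value 0,
    which is not orthogonal; so the metric condition alone already yields
    differentiability. *)
Lemma jacobian_orthogonal_differentiable (F : 'rV[R]_n -> 'rV[R]_n) x : (0 < n)%N ->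
  jacobian F x *m (jacobian F x)^T = 1%:M -> differentiable F x.
Proof.
move=> n0 JJ; apply: contrapT => ndF.
have J0 : jacobian F x = 0.
  by apply/matrixP => i j; rewrite [LHS]mxE not_differentiable_diff0// !mxE.
move: JJ; rewrite J0 mul0mx => /matrixP/(_ (Ordinal n0) (Ordinal n0)).
by rewrite !mxE eqxx => /eqP; rewrite eq_sym oner_eq0.
Qed.

Lemma is_derive_dot (F : 'rV[R]_n -> 'rV[R]_n) x v w : differentiable F x ->
  is_derive x v (fun y => dot (F y) w) (dot (v *m jacobian F x) w).
Proof.
move=> dF; have Fv : derivable F x v by exact: diff_derivable.
have h i : is_derive x v (fun y => F y 0 i) ((v *m jacobian F x) 0 i).
  split; first exact: (derivable_mxP F x v).1 Fv 0 i.
  by rewrite -deriveEjacobian// (derive_mx Fv) mxE.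
rewrite (_ : (fun y => _) = \sum_(i < n) (fun y => F y 0 i * w 0 i)); last first.
  by apply/funext => y; rewrite fct_sumE.
have hM i : is_derive x v (fun y => F y 0 i * w 0 i) ((v *m jacobian F x) 0 i * w 0 i).
  have := is_deriveM (h i) (is_derive_cst (w 0 i) x v).
  by move=> /is_derive_eq; apply; rewrite scaler0 add0r /GRing.scale /= mulrC.
exact: is_derive_sum.
Qed.

(** At the mean value point the increment [w] of [F] satisfies
    [<v J, w> = <w, w>], so that [0 <= |v J - w|^2 = |v|^2 - |w|^2]. *)
Lemma orthogonal_jacobian_lipschitz (F : 'rV[R]_n -> 'rV[R]_n) y v : (0 < n)%N ->
  (forall t : R, 0 <= t <= 1 ->
    jacobian F (t *: v + y) *m (jacobian F (t *: v + y))^T = 1%:M) ->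
  dot (F (v + y) - F y) (F (v + y) - F y) <= dot v v.
Proof.
move=> n0 JJ; set w := F (v + y) - F y.
pose J t := jacobian F (t *: v + y).
have D (t : R) : 0 <= t <= 1 -> is_derive t (1 : R)
    (fun s : R => dot (F (s *: v + y)) w) (dot (v *m J t) w).
  move=> t01; apply: (@is_derive_along R _ (fun x => dot (F x) w)).
  by apply: is_derive_dot; apply: jacobian_orthogonal_differentiable => //; exact: JJ.
have [||c] := @MVT_segment R (fun s => dot (F (s *: v + y)) w)
    (fun t => dot (v *m J t) w) 0 1 ler01.
- by move=> t; rewrite in_itv /= => /andP[t0 t1]; apply: D; rewrite !ltW.
- apply: derivable_within_continuous => t; rewrite in_itv /= => /D[]//.
rewrite in_itv /= => c01; rewrite scale1r scale0r add0r subr0 mulr1.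
rewrite -dotNl -dotDl -/w => wE.
have vJ : dot (v *m J c) (v *m J c) = dot v v.
  by rewrite !dotE trmx_mul mulmxA -(mulmxA v) JJ// mulmx1.
have h := dot_ge0 (v *m J c - w).
rewrite dotDl !dotDr !dotNl !dotNr vJ opprK (dotC w (v *m J c)) -wE in h.
by move: h; move: (dot v v) (dot w w) => a b; lra.
Qed.

(** By polarization [F] preserves [dot], and then
    [|F (x + y) - F x - F y|^2] expands to 0. *)
Lemma isometry0_linear (F : 'rV[R]_n -> 'rV[R]_n) :
  (forall x y, dot (F x - F y) (F x - F y) = dot (x - y) (x - y)) -> F 0 = 0 ->
  (forall x y, F (x + y) = F x + F y) /\ (forall a x, F (a *: x) = a *: F x).
Proof.
move=> isoF F0.
have n2 x : dot (F x) (F x) = dot x x by have := isoF x 0; rewrite F0 !subr0.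
have dF x y : dot (F x) (F y) = dot x y.
  have h := isoF x y.
  rewrite !dotDl !dotDr !dotNl !dotNr !n2 (dotC (F y)) (dotC y) in h.
  by move: h; move: (dot (F x) (F y)) (dot x y) (dot x x) (dot y y) => *; lra.
split=> [x y|a x]; apply/eqP; rewrite -subr_eq0; apply/eqP/dot_eq0.
  rewrite opprD !(dotDl, dotDr, dotNl, dotNr) !dF !(dotDl, dotDr) (dotC y x).
  by ring.
by rewrite !(dotDl, dotDr, dotNl, dotNr, dotZl, dotZr) !dF !(dotZl, dotZr); ring.
Qed.

End EuclideanIsometries.

(** * Euclidean space is naturally reductive *)

Lemma is_derive_affine (R : realType) (a b t : R) :
  is_derive t (1 : R) (fun s : R => a + s * b) b.
Proof.
have := is_deriveD (is_derive_cst a t (1 : R))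
  (is_deriveM (is_derive_id t (1 : R)) (is_derive_cst b t (1 : R))).
by move/is_derive_eq; apply; rewrite scaler0 !add0r /GRing.scale /= mulr1.
Qed.

Lemma derive0_interval_cst (R : realType) (J : set R) (f : R -> R) :
  is_interval J -> (forall s, J s -> is_derive s (1 : R) f 0) ->
  forall a b, J a -> J b -> f a = f b.
Proof.
move=> iJ df a b; wlog ab : a b / a <= b => [hw Ja Jb|Ja Jb].
  by have [/hw|/ltW /hw h] := leP a b; [exact|apply/esym; exact: h].
have inJ s : a <= s <= b -> J s by exact: iJ.
have [||c _] := @MVT_segment R f (fun=> 0) a b ab.
- by move=> s; rewrite in_itv /= => /andP[/ltW h1 /ltW h2]; apply/df/inJ/andP.
- by apply: derivable_within_continuous => s; rewrite in_itv /= => /inJ/df[].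
by rewrite mul0r => /eqP; rewrite subr_eq0 => /eqP ->.
Qed.

Section Euclidean.
Context {R : realType}.
Variable n : nat.
Local Notation E := 'rV[R]_n.

Definition segment_path (x y : E) : set E :=
  [set t *: (y - x) + x | t in `[0, 1]%classic].

Lemma segment_path_connected x y : connected (segment_path x y).
Proof.
apply: connected_continuous_connected; first exact: segment_connected.
apply: continuous_subspaceT => t.
apply: (@continuousD R E R (fun s => s *: (y - x)) (fun=> x) t).
  exact: scalel_continuous.
exact: cst_continuous.
Qed.

Lemma euclid_connected : connected [set: E].
Proof.
rewrite (_ : setT = \bigcup_(x in [set: E]) segment_path 0 x).
  apply: bigcup_connected => [|x _]; last exact: segment_path_connected.
  by exists 0 => x _; exists 0; rewrite ?scale0r ?addr0//= in_itv /= lexx ler01.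
apply/seteqP; split=> // x _; exists x => //; exists 1.
  by rewrite /= in_itv /= ler01 lexx.
by rewrite scale1r subr0 addr0.
Qed.

Lemma range_id : range (@id E) = setT.
Proof. by apply/seteqP; split=> // x _; exists x. Qed.

Lemma open_range_id : open (range (@id E)).
Proof. by rewrite range_id; exact: openT. Qed.

Lemma id_within : {within range (@id E), continuous (@id E)}.
Proof. by apply: continuous_subspaceT => x; exact: cvg_id. Qed.

Lemma id_continuous : continuous (@id E).
Proof. by move=> x; exact: cvg_id. Qed.

Definition euclid : riemannian_manifold R :=
  @flat_manifold R n E id id (fun=> erefl) id_continuous open_range_id id_within
    euclid_connected.

Lemma euclid_metric_preservingP (f : E -> E) :
  metric_preserving (@metric R euclid) f <->
  forall x, jacobian f x *m (jacobian f x)^T = 1%:M.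
Proof.
split=> [/(flat_metric_preservingP id id f) h x|h].
  by apply: h; exists x.
by apply/(flat_metric_preservingP id id f) => x _; exact: h.
Qed.

Lemma euclid_smooth_map (f : E -> E) : continuous f ->
  (forall j, smooth_on setT (fun x => f x 0 j)) -> @smooth_map R euclid f.
Proof. by move=> cf sf; split=> // p q j k; apply: Ck_on_sub (sf j k). Qed.

Lemma euclid_smooth_mapP (f : E -> E) : @smooth_map R euclid f ->
  continuous f /\ forall j, smooth_on setT (fun x => f x 0 j).
Proof.
move=> [cf sf]; split=> // j k; apply: Ck_on_sub (sf point point j k).
by move=> x _; split=> //; exists x.
Qed.

Lemma jacobian_add_cst (F : E -> E) c x : differentiable F x ->
  jacobian (fun y => F y + c) x = jacobian F x.
Proof.
move=> dF; have dc : differentiable (cst c : E -> E) x by exact: ex_diff.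
have dFc : 'd (F + cst c) x = 'd F x :> (E -> E).
  apply: etrans (diffD dF dc) _; apply/funext => y.
  have d0 : 'd (cst c : E -> E) x y = 0.
    exact: (congr1 (fun h : E -> E => h y) (diff_cst c x)).
  exact: etrans (congr1 (fun z => 'd F x y + z) d0) (addr0 _).
exact: (congr1 (fun h : E -> E => lin1_mx h) dFc).
Qed.

Lemma smooth_add_cst (F : E -> E) c : @smooth_map R euclid F ->
  @smooth_map R euclid (fun x => F x + c).
Proof.
move=> /euclid_smooth_mapP[cF sF]; apply: euclid_smooth_map => [x|j k].
  by apply: (@continuousD R E E F (fun=> c)); [exact: cF|exact: cst_continuous].
apply: Ck_on_eq openT _ (Ck_onD openT (sF j k) (Ck_on_cst _ _ (c 0 j))) => x _.
by rewrite mxE.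
Qed.

Lemma smooth_id : @smooth_map R euclid id.
Proof.
by apply: euclid_smooth_map => [|j k]; [exact: id_continuous|exact: Ck_on_coord].
Qed.

Lemma translation_isometry (c : E) : @Defs.isometry R euclid (fun x : E => x + c).
Proof.
split.
  apply/euclid_metric_preservingP => x.
  have did : differentiable (id : E -> E) x by exact: ex_diff.
  by rewrite (jacobian_add_cst _ did) jacobian_id mul1mx trmx1.
exists (fun x : E => x - c); split; [exact: addrK|exact: subrK| |];
  exact: smooth_add_cst smooth_id.
Qed.

Lemma euclid_homogeneous : homogeneous euclid.
Proof.
move=> p q; exists (fun x : E => x + (q - p)); first exact: translation_isometry.
by rewrite addrC subrK.
Qed.

Lemma is_derive_entry (V : normedModType R) (F : V -> E) x v (a : E) i :
  is_derive x v F a -> is_derive x v (fun y => F y 0 i) (a 0 i).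
Proof.
move=> [dF <-]; split; first exact: (derivable_mxP F x v).1 dF 0 i.
by rewrite (derive_mx dF) mxE.
Qed.

Lemma is_derive_row (V : normedModType R) (F : V -> E) x v (a : E) :
  (forall i, is_derive x v (fun y => F y 0 i) (a 0 i)) -> is_derive x v F a.
Proof.
move=> h; have dF : derivable F x v.
  by apply/derivable_mxP => i j; rewrite ord1; have [] := h j.
split=> //; rewrite (derive_mx dF); apply/rowP => i; rewrite mxE.
by have [_ ->] := h i.
Qed.

Definition const_field (v : E) : @vector_field R euclid := fun=> v.

Lemma translations_generate v :
  @generates R euclid (fun t p => p + t *: v) (const_field v).
Proof.
split.
  split=> [t|s t p|].
  - exact: translation_isometry.
  - by rewrite scalerDl [s *: v + _]addrC addrA.
  - move=> z; apply: (@continuousD R E (R * E)%type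
      (fun z : R * E => z.2) (fun z : R * E => z.1 *: v)).
      exact: cvg_snd.
    by apply: (@continuous_comp _ _ _ (fun z : R * E => z.1) (fun t => t *: v));
      [exact: cvg_fst|exact: scalel_continuous].
move=> p; apply: is_derive_row => i /=.
rewrite (_ : (fun t => _) = (fun t : R => p 0 i + t * v 0 i)); last first.
  by apply/funext => t; rewrite !mxE.
exact: is_derive_affine.
Qed.

Section OneParameterSubgroups.
Variable gamma : R -> E -> E.
Hypothesis gammaP : @one_parameter_subgroup R euclid gamma.

Lemma gamma0 p : gamma 0 p = p.
Proof.
have [isog addg _] := gammaP; have [_ [h [hK _ _ _]]] := isog 0.
by apply: (can_inj hK); rewrite -addg addr0.
Qed.

Lemma gammaNK t p : gamma (- t) (gamma t p) = p.
Proof. by have [_ addg _] := gammaP; rewrite -addg addNr gamma0. Qed.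

Lemma gammaKN t p : gamma t (gamma (- t) p) = p.
Proof. by rewrite -{1}(opprK t) gammaNK. Qed.

Lemma gamma_dist t (x y : E) : (0 < n)%N ->
  dot (gamma t x - gamma t y) (gamma t x - gamma t y) = dot (x - y) (x - y).
Proof.
move=> n0; have lip s (p q : E) :
    dot (gamma s p - gamma s q) (gamma s p - gamma s q) <= dot (p - q) (p - q).
  have [/(_ s)[/euclid_metric_preservingP JJ _] _ _] := gammaP.
  have := @orthogonal_jacobian_lipschitz R n (gamma s) q (p - q) n0 (fun t _ => JJ _).
  by rewrite subrK.
apply/le_anti; rewrite lip /=.
by have := lip (- t) (gamma t x) (gamma t y); rewrite !gammaNK.
Qed.

Lemma gamma_affine t : (0 < n)%N -> let A x := gamma t x - gamma t 0 in
  (forall x y, A (x + y) = A x + A y) /\ (forall a x, A (a *: x) = a *: A x).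
Proof.
move=> n0 A; apply: isometry0_linear => [x y|]; last by rewrite /A subrr.
by rewrite -(gamma_dist t x y n0) /A opprB addrA subrK.
Qed.

(** The difference between [gamma t p] and [p + t v] has derivative 0 at every
    time, by the group law. *)
Lemma constant_flow (v : E) : @generates R euclid gamma (const_field v) ->
  forall t p, gamma t p = p + t *: v.
Proof.
move=> [_ dg] t p; apply/rowP => i; rewrite !mxE.
have [_ addg _] := gammaP.
have D s : is_derive s (1 : R) (fun t => gamma t p 0 i - (0 + t * v 0 i)) 0.
  have h0 := is_derive_entry i (dg (gamma s p)).
  have h1 : is_derive s (1 : R) (fun t => gamma t p 0 i) (v 0 i).
    rewrite (_ : (fun t => _) = (fun h => gamma h (gamma s p) 0 i) \o (fun t => t - s)).
      rewrite -[X in is_derive _ _ _ X]mulr1; apply: is_derive1_comp.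
        by rewrite subrr; exact: h0.
      by apply: is_derive_eq; rewrite subr0.
    by apply/funext => r /=; rewrite -addg subrK.
  by have /is_derive_eq := is_deriveB h1 (is_derive_affine 0 (v 0 i) s); apply; rewrite subrr.
have := is_derive_0_is_cst t 0 D; rewrite gamma0 mul0r !add0r subr0.
by move=> <-; rewrite subrK.
Qed.

(** As every [gamma t] is affine, its linear parts again form a group; it fixes
    the origin and provides the isotropy component of a Killing field. *)
Lemma linear_part_subgroup : (0 < n)%N ->
  @one_parameter_subgroup R euclid (fun t p => gamma t p - gamma t 0).
Proof.
move=> n0; have [isog addg cg] := gammaP.
have AB t x y : gamma t (x - y) - gamma t 0 =
    (gamma t x - gamma t 0) - (gamma t y - gamma t 0).
  have [addA _] := gamma_affine t n0.
  by have := addA (x - y) y; rewrite subrK => ->; rewrite addrK.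
split=> [t|s t p|z].
- have [/euclid_metric_preservingP JJ [h [_ _ sg _]]] := isog t; split.
    apply/euclid_metric_preservingP => x.
    have dg := jacobian_orthogonal_differentiable n0 (JJ x).
    by rewrite (jacobian_add_cst (- gamma t 0) dg).
  exists (fun p => gamma (- t) p - gamma (- t) 0); split.
  + by move=> p; rewrite AB !gammaNK sub0r opprK subrK.
  + by move=> p; rewrite AB !gammaKN sub0r opprK subrK.
  + exact: smooth_add_cst.
  + have [_ [h' [_ _ sg' _]]] := isog (- t); exact: smooth_add_cst.
- by rewrite !addg AB opprB addrA subrK.
- have cs : continuous (fun z : R * E => gamma z.1 0).
    move=> y A nA; have [[P Q] /= [nP nQ] PQ] := cg (y.1, 0) A nA.
    exists (P, setT) => /=; first by split; [exact: nP|exact: filterT].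
    by move=> [s q] [/= Ps _]; apply: (PQ (s, 0)); split=> //=; exact: nbhs_singleton nQ.
  exact: (@continuousB R E (R * E)%type (fun z => gamma z.1 z.2)
    (fun z => gamma z.1 0) z (cg z) (cs z)).
Qed.

End OneParameterSubgroups.

Definition translations : set (@vector_field R euclid) :=
  [set X | exists v, X = const_field v].

Lemma is_derive_unique (V W : normedModType R) (f : V -> W) x v a b :
  is_derive x v f a -> is_derive x v f b -> a = b.
Proof. by move=> [_ <-] [_ <-]. Qed.

(** [L x - x] is homogeneous in [x], so that it vanishes as soon as the
    displacement is bounded. *)
Lemma bounded_displacement (L : E -> E) (c : E) (C : R) :
  (forall a x, L (a *: x) = a *: L x) ->
  (forall x, dot (L x + c - x) (L x + c - x) <= C) -> forall x, L x = x.
Proof.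
move=> LZ bd x; apply/eqP; rewrite -subr_eq0; apply/eqP/dot_eq0.
have [z zE] : exists z, z = L x - x by exists (L x - x).
rewrite -zE; apply/eqP; rewrite eq_le dot_ge0 andbT leNgt; apply/negP => z0.
have C0 : 0 <= C by exact: le_trans (dot_ge0 _) (bd 0).
(* The parallelogram law at [s x] and [- s x] removes the cross term with [c]. *)
have key s : s ^+ 2 * dot z z <= C.
  have E1 r : L (r *: x) + c - r *: x = r *: z + c.
    by rewrite LZ zE scalerBr addrAC.
  have h1 := bd (s *: x); have h2 := bd (- s *: x).
  rewrite E1 in h1; rewrite E1 in h2; move: h1 h2 (dot_ge0 c).
  rewrite !dotDl !dotDr !dotZl !dotZr (dotC c z).
  by move: (dot z z) (dot z c) (dot c c) => p q r; nra.
pose s := (C + 1) / dot z z + 1.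
have h0 : 0 <= (C + 1) / dot z z by rewrite divr_ge0 ?addr_ge0// ltW.
have h1 : (C + 1) / dot z z * dot z z = C + 1 by rewrite divfK// gt_eqF.
have := key s; rewrite /s; move: h0 h1 z0.
by move: ((C + 1) / dot z z) (dot z z) => p q; nra.
Qed.

(** Conjugating translations by the 1-Lipschitz map [h] gives isometries that
    move every point by a bounded amount; their linear part is the identity. *)
Lemma Ad_translation (h : E -> E) (v : E) (Y : @vector_field R euclid) :
  (0 < n)%N -> @Defs.isometry R euclid h -> @Ad R euclid h (const_field v) Y ->
  translations Y.
Proof.
move=> n0 [/euclid_metric_preservingP Jh [h' [_ h'K _ _]]] [g [g' [gX gY gg]]].
have flow := constant_flow gX.1 gX; have [g'P dY] := gY.
have g't t q : g' t q = q + g' t 0.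
  have [_ LZ] := gamma_affine g'P t n0.
  have bd x : dot ((g' t x - g' t 0) + g' t 0 - x) ((g' t x - g' t 0) + g' t 0 - x)
      <= dot (t *: v) (t *: v).
    rewrite subrK -[x]h'K gg flow.
    have := @orthogonal_jacobian_lipschitz R n h (h' x) (t *: v) n0 (fun t _ => Jh _).
    by rewrite (addrC (t *: v)).
  by have E0 := bounded_displacement LZ bd q; rewrite -[LHS](subrK (g' t 0)) E0.
exists (Y 0); apply/funext => q; rewrite /const_field.
apply: (is_derive_unique (dY q)) => /=.
rewrite (_ : (fun t => _) = (fun t => q + g' t 0)); last by apply/funext => t.
have := is_deriveD (is_derive_cst q (0 : R) (1 : R)) (dY 0).
by move/is_derive_eq; apply; rewrite add0r.
Qed.

(** A Killing field [X] splits as [(X - X 0) + X 0], where the first summand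
    vanishes at the origin and the second is constant. *)
Lemma translations_reductive : (0 < n)%N ->
  @reductive_decomposition R euclid (0 : E) translations.
Proof.
move=> n0; split.
- by move=> _ [v ->]; exists (fun t p => p + t *: v); exact: translations_generate.
- split; first by exists 0.
  by move=> a _ _ [v ->] [w ->]; exists (a *: v + w).
- move=> X [[g [_ dX] iso] [v Xv]]; apply/funext => p; rewrite Xv /const_field.
  have := dX 0; rewrite Xv /const_field => d0; apply: is_derive_unique d0 _.
  rewrite (_ : (fun t => _) = cst (0 : E)); first exact: is_derive_cst.
  by apply/funext => t /=; have [_ ->] := iso t.
- move=> X [g [gP dX]]; exists (fun p => X p - X 0), (const_field (X 0)); split.
  + exists (fun t p => g t p - g t 0); last first.
      by move=> t; split; [have [] := linear_part_subgroup gP n0|rewrite /= subrr].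
    split; first exact: linear_part_subgroup.
    by move=> p; exact: is_deriveB (dX p) (dX 0).
  + by exists (X 0).
  + by move=> p; rewrite /const_field subrK.
- by move=> h X Y [ih _] [v ->] AdXY; exact: Ad_translation ih AdXY.
Qed.

(** The Christoffel symbols vanish and the geodesic equation becomes [c'' = 0]. *)
Lemma euclid_geodesic (J : set R) (c : R -> E) : is_interval J -> J 0 ->
  @geodesic R euclid J c -> c 0 = 0 -> exists v, forall t, J t -> c t = t *: v.
Proof.
move=> iJ J0 gc c0; pose x k (s : R) : R := c s 0 k.
have G t k : J t -> [/\ derivable (x k) t 1, derivable (derive1 (x k)) t 1 &
    derive1 (derive1 (x k)) t = 0].
  move=> Jt; have [_ /(_ 0 I k)[d1 d2 eq]] := gc t Jt; split=> //.
  move: eq; rewrite big1 ?addr0// => i _; rewrite big1// => j _.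
  rewrite (_ : christoffel _ _ _ _ _ = 0) ?mul0r// /christoffel.
  rewrite big1 ?mulr0// => l _.
  by rewrite !partial_cst addr0 subr0 mulr0.
have dx t k : J t -> is_derive t (1 : R) (x k) (derive1 (x k) t).
  by move=> Jt; have [d1 _ _] := G t k Jt; rewrite derive1E; exact: derivableP.
have d2 t k : J t -> is_derive t (1 : R) (derive1 (x k)) 0.
  by move=> Jt; have [_ d <-] := G t k Jt; rewrite derive1E; exact: derivableP.
exists (\row_k derive1 (x k) 0) => t Jt; apply/rowP => k; rewrite !mxE.
have vt s : J s -> derive1 (x k) s = derive1 (x k) 0.
  by move=> Js; apply: (derive0_interval_cst iJ _ Js J0) => r; exact: d2.
have D s : J s -> is_derive s (1 : R) (fun r => x k r - (0 + r * derive1 (x k) 0)) 0.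
  move=> Js; have := is_deriveB (dx s k Js) (is_derive_affine 0 (derive1 (x k) 0) s).
  by move/is_derive_eq; apply; rewrite vt// subrr.
have := derive0_interval_cst iJ D Jt J0; rewrite /x c0 mxE mul0r !add0r oppr0.
by move/eqP; rewrite subr_eq0 => /eqP.
Qed.

Lemma euclid_naturally_reductive : (0 < n)%N -> naturally_reductive euclid.
Proof.
move=> n0; split; first exact: euclid_homogeneous.
exists 0, translations; split; first exact: translations_reductive.
move=> J c _ iJ J0 gc c0; have [v cv] := euclid_geodesic iJ J0 gc c0.
exists (const_field v); first by exists v.
exists (fun t p => p + t *: v); first exact: translations_generate.
by move=> t /cv ->; rewrite add0r.
Qed.

Lemma euclid_noncompact : (0 < n)%N -> noncompact euclid.
Proof.
move=> n0 /compact_bounded[M [_ /(_ (M + 1))]]; rewrite ltrDl ltr01 => /(_ isT) h.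
have := h (const_mx (`|M| + 2)) I => /=.
rewrite leNgt => /negP; apply.
apply: lt_le_trans (coord_norm_le _ (Ordinal n0)); rewrite mxE.
rewrite ger0_norm ?addr_ge0//; have := ler_norm M; lra.
Qed.

End Euclidean.

(** * The punctured space is not homogeneous *)

Section Punctured.
Context {R : realType}.
Variable m : nat.
Local Notation n := m.+2.
Local Notation E := 'rV[R]_n.

Definition e0 : E := delta_mx 0 0.
Definition e1 : E := delta_mx 0 (lift ord0 ord0).

Lemma e0E i : e0 0 i = (i == ord0)%:R.
Proof. by rewrite mxE eqxx. Qed.

Lemma scale_e0_neq0 (a : R) : a != 0 -> a *: e0 != 0.
Proof.
apply: contraNneq => /rowP/(_ ord0); rewrite !mxE !eqxx mulr1 => ->.
exact: eqxx.
Qed.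

Definition nonzero : set E := [set x | x != 0].

Definition punctured : Type := set_type nonzero.
HB.instance Definition _ := Topological.on punctured.

Lemma e0_nonzero : e0 \in nonzero.
Proof. by rewrite inE /nonzero /= -[e0]scale1r scale_e0_neq0// oner_eq0. Qed.

HB.instance Definition _ :=
  isPointed.Build punctured (exist _ e0 e0_nonzero : punctured).

Definition emb (y : punctured) : E := \val y.

(** The value at the origin is arbitrary. *)
Definition ret (x : E) : punctured :=
  if pselect (x \in nonzero) is left h then exist _ x h : punctured else point.

Lemma ret_val x : x != 0 -> emb (ret x) = x.
Proof.
by move=> x0; rewrite /ret; case: pselect => // -[]; rewrite inE.
Qed.

Lemma emb_neq0 y : emb y != 0.
Proof. by case: y => x /= h; rewrite /emb /=; rewrite inE in h. Qed.

Lemma embK : cancel emb ret.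
Proof.
by move=> y; apply: val_inj; rewrite -[LHS]/(emb _) ret_val ?emb_neq0.
Qed.

Lemma range_emb_nonzero : range emb = nonzero.
Proof.
apply/seteqP; split=> [_ [y _ <-]|x x0]; first exact: emb_neq0.
by exists (ret x) => //; exact: ret_val.
Qed.

Lemma emb_continuous : continuous emb.
Proof. exact: initial_continuous. Qed.

Lemma open_range_emb : open (range emb).
Proof.
rewrite range_emb_nonzero (_ : nonzero = ~` [set 0]).
  apply: closed_openC; apply: compact_closed; first exact: norm_hausdorff.
  exact: compact_set1.
by apply/seteqP; split=> x /=; [move=> /eqP|move=> /eqP].
Qed.

Lemma ret_within : {within range emb, continuous ret}.
Proof.
apply: (@continuous_comp_initial _ _ _ (set_val : set_type nonzero -> E)).
apply: (@subspace_eq_continuous E (range emb) E (id : subspace (range emb) -> E)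
  (set_val \o ret : subspace (range emb) -> E)).
  by move=> x; rewrite inE range_emb_nonzero => x0 /=; rewrite -[RHS]/(emb _) ret_val.
by apply: continuous_subspaceT => x; exact: cvg_id.
Qed.

Lemma segment_ret_connected (x y : E) : segment_path x y `<=` range emb ->
  connected (ret @` segment_path x y).
Proof.
move=> sU; apply: connected_continuous_connected; first exact: segment_path_connected.
exact: continuous_subspaceW sU ret_within.
Qed.

Lemma segment_start (x y : E) : segment_path x y x.
Proof. by exists 0; rewrite ?scale0r ?add0r//= in_itv /= lexx ler01. Qed.

Lemma segment_end (x y : E) : segment_path x y y.
Proof. by exists 1; rewrite ?scale1r ?subrK//= in_itv /= lexx ler01. Qed.

Lemma e0_e1_segment : segment_path e0 e1 `<=` range emb.
Proof.
move=> _ [t _ <-]; rewrite range_emb_nonzero /nonzero /=; apply/eqP => /rowP h.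
have := h (lift ord0 ord0); have := h ord0; rewrite !mxE /= => h0 h1.
move: h0 h1; rewrite !mulr1n !mulr0n; lra.
Qed.

(** A nonzero point lies on at most one of the lines that join the origin to
    [e0] and to [e1]. *)
Lemma segment_to (x : E) : x != 0 ->
  segment_path e0 x `<=` range emb \/ segment_path e1 x `<=` range emb.
Proof.
move=> x0; rewrite range_emb_nonzero; apply: contrapT => /not_orP[].
move=> /existsNP[z /not_implyP[[t _ <-] /negP/negPn/eqP/rowP ht]].
move=> /existsNP[w /not_implyP[[s _ <-] /negP/negPn/eqP/rowP hs]].
move/eqP: x0; apply; apply/rowP => i; rewrite mxE.
have t0 := ht ord0; have t1 := ht (lift ord0 ord0).
have s1 := hs (lift ord0 ord0); have si := hs i.
rewrite !mxE /= in t0 t1 s1 si; rewrite !mulr1n !mulr0n in t0 t1 s1.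
have tn : t != 0 by apply/eqP => tz; move: t0; rewrite tz; lra.
have x1 : x 0 (lift ord0 ord0) = 0.
  apply/eqP; have : t * x 0 (lift ord0 ord0) = 0 by lra.
  by move/eqP; rewrite mulf_eq0 (negPf tn).
have sE : s = 1 by rewrite x1 in s1; lra.
by move: si; rewrite sE; lra.
Qed.

(** Every point is joined to [e0] by a segment, or by two segments through
    [e1]. *)
Lemma punctured_connected : connected [set: punctured].
Proof.
pose C (y : punctured) : set punctured := if pselect (segment_path e0 (emb y) `<=` range emb)
  then ret @` segment_path e0 (emb y)
  else ret @` segment_path e0 e1 `|` ret @` segment_path e1 (emb y).
have C0 y : C y (ret e0).
  rewrite /C; case: pselect => _ /=; first by exists e0 => //; exact: segment_start.
  by left; exists e0 => //; exact: segment_start.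
have Cy y : C y y.
  rewrite /C; case: pselect => _ /=; first by exists (emb y); [exact: segment_end|exact: embK].
  by right; exists (emb y); [exact: segment_end|exact: embK].
rewrite (_ : setT = \bigcup_(y in [set: punctured]) C y).
  apply: bigcup_connected => [|y _]; first by exists (ret e0) => y _; exact: C0.
  rewrite /C; case: pselect => [h|h] /=; first exact: segment_ret_connected.
  apply: connectedU.
  - exists (ret e1); split; first by exists e1 => //; exact: segment_end.
    by exists e1 => //; exact: segment_start.
  - exact: segment_ret_connected e0_e1_segment.
  - apply: segment_ret_connected.
    by have [|//] := segment_to (emb_neq0 y).
by apply/seteqP; split=> // y _; exists y.
Qed.

Definition punctured_euclid : riemannian_manifold R :=
  @flat_manifold R n punctured emb ret embK emb_continuous open_range_emb ret_within
    punctured_connected.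

Lemma punctured_noncompact : noncompact punctured_euclid.
Proof.
move=> cS; have : compact (emb @` [set: punctured]).
  by apply: continuous_compact cS; apply: continuous_subspaceT; exact: emb_continuous.
rewrite range_emb_nonzero => /compact_bounded[M [_ /(_ (M + 1))]].
rewrite ltrDl ltr01 => /(_ isT) h.
have a0 : 0 < `|M| + 2 by rewrite ltr_wpDl.
have := h _ (scale_e0_neq0 (lt0r_neq0 a0)) => /=.
rewrite leNgt => /negP; apply.
apply: lt_le_trans (coord_norm_le _ ord0); rewrite !mxE !eqxx mulr1.
rewrite (gtr0_norm a0); have := ler_norm M; lra.
Qed.

Lemma dot_scale_e0 (a : R) : dot (a *: e0) (a *: e0) = a ^+ 2.
Proof.
rewrite dotZl dotZr (_ : dot e0 e0 = 1) ?mulr1//.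
rewrite /dot (bigD1 ord0)//= !e0E eqxx mulr1 big1 ?addr0// => i i0.
by rewrite e0E (negPf i0) mul0r.
Qed.

(** A ball for the Euclidean norm rather than the sup norm: it is [dot] that
    isometries preserve. *)
Definition unit_ball_2e0 : set E := [set x | dot (x - 2 *: e0) (x - 2 *: e0) <= 1].

Lemma unit_ball_compact : compact unit_ball_2e0.
Proof.
apply: bounded_closed_compact.
  exists 3; split=> [|M M3 x /= x1]; first exact: num_real.
  apply/ltW/(le_lt_trans _ M3)/norm_row_le => // i.
  have xi : (x 0 i - 2 * (i == ord0)%:R) ^+ 2 <= 1.
    apply: le_trans x1; rewrite /dot (bigD1 i)//= !mxE eqxx /= -expr2 lerDl.
    by apply: sumr_ge0 => j _; rewrite -expr2 sqr_ge0.
  by move: xi; case: eqP => _ /=; rewrite ?mulr1n ?mulr0n => xi; rewrite ler_norml; nra.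
rewrite (_ : unit_ball_2e0 = (fun x : E => dot (x - 2 *: e0) (x - 2 *: e0)) @^-1`
  [set t | t <= 1])//.
apply: closed_comp; last exact: closed_le.
move=> x _.
have CQ : Ck_on 0 setT (fun x : E => dot (x - 2 *: e0) (x - 2 *: e0)).
  apply: Ck_on_sum openT _ => i.
  have Cxi : Ck_on 0 setT (fun x : E => (x - 2 *: e0) 0 i).
    apply: Ck_on_eq openT _ (Ck_onD openT (Ck_on_coord 0 setT i)
      (Ck_on_cst 0 setT (- (2 *: e0) 0 i))) => y _.
    by rewrite !mxE.
  exact: (Ck_onM openT Cxi Cxi).
exact: CQ.1.
Qed.

Lemma unit_ball_sub : unit_ball_2e0 `<=` range emb.
Proof.
move=> x; rewrite range_emb_nonzero /nonzero /= => x1; apply/eqP => x0.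
move: x1; rewrite /unit_ball_2e0 /= x0 sub0r dotNl dotNr opprK dot_scale_e0; lra.
Qed.

(** Let an isometry [f] map [e0] to [2 e0].  The points [(1 - t) e0] with
    [0 <= t < 1] are joined to [e0] by segments of length less than 1, so that
    [f] maps them into the closed unit ball around [2 e0].  This ball is compact
    and avoids the origin, hence its preimage under [f] is compact too; but the
    points [(1 - t) e0] of that preimage converge to the missing origin. *)
Lemma punctured_not_homogeneous : ~ homogeneous punctured_euclid.
Proof.
move=> /(_ (ret e0) (ret (2 *: e0)))[f [mf [h [fK hK sf sh]]] fe0].
have JJ := (flat_metric_preservingP emb ret f).1 mf.
pose F (x : E) := emb (f (ret x)).
have F0 : F e0 = 2 *: e0 by rewrite /F fe0 ret_val ?scale_e0_neq0.
have Fball (t : R) : 0 <= t < 1 -> unit_ball_2e0 (F ((1 - t) *: e0)).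
  move=> /andP[t0 t1]; rewrite /unit_ball_2e0 /= -F0.
  have st (s : R) : s *: (- t *: e0) + e0 = (1 - s * t) *: e0.
    by rewrite scalerA -[X in _ + X]scale1r -scalerDl mulrN addrC.
  have := @orthogonal_jacobian_lipschitz R n F e0 (- t *: e0) (ltn0Sn _).
  have -> : - t *: e0 + e0 = (1 - t) *: e0 by rewrite -[X in _ + X]scale1r -scalerDl addrC.
  rewrite dot_scale_e0 sqrrN => lip.
  apply: (le_trans (lip _)); last by rewrite exprn_ile1// ltW.
  move=> s /andP[s0 s1]; apply: JJ; rewrite st range_emb_nonzero.
  by apply: scale_e0_neq0; rewrite gt_eqF//; nra.
(* The preimage of the ball under [f]. *)
pose K := (fun x => emb (h (ret x))) @` unit_ball_2e0.
have cK : compact K.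
  apply: continuous_compact unit_ball_compact => x.
  apply: (@continuous_comp (subspace unit_ball_2e0) punctured E ret (fun y => emb (h y))).
    exact: continuous_subspaceW unit_ball_sub ret_within x.
  apply: (@continuous_comp punctured punctured E h emb); last exact: emb_continuous.
  exact: sh.1.
have K0 : K 0.
  have clK : closed K by apply: compact_closed cK; exact: norm_hausdorff.
  apply: clK.
  move=> B /nbhs_ballP[d /= d0 dB].
  pose s := Num.min (d / 2) 1.
  have s0 : 0 < s by rewrite lt_min ltr01 divr_gt0.
  have s1 : s <= 1 by rewrite ge_min lexx orbT.
  have sd : s < d.
    by rewrite gt_min ltr_pdivrMr// ltr_pMr// ltr1n.
  exists (s *: e0); split.
    exists (F (s *: e0)).
      have := Fball (1 - s); rewrite subKr; apply.
      by rewrite subr_ge0 s1 ltrBlDr ltrDl.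
    by rewrite /F embK fK ret_val// scale_e0_neq0// gt_eqF.
  apply: dB; rewrite -ball_normE /= sub0r normrN.
  by apply: le_lt_trans (norm_scale_delta _ _) _; rewrite gtr0_norm.
have [x _ x0] := K0; have := emb_neq0 (h (ret x)).
by rewrite x0 eqxx.
Qed.

End Punctured.

(** * A core of the Euclidean Laplacian *)

Section ComplexTestFunctions.
Context {R : realType}.
Variable n : nat.
Local Notation E := 'rV[R]_n.
Local Notation mu := (@lebesgue_row R n).
Implicit Types f g : E -> R[i].
Local Notation re f := (fun x => complex.Re (f x)).
Local Notation im f := (fun x => complex.Im (f x)).

Definition CcC f : Prop := Cc (re f) /\ Cc (im f).

Definition nlapC f : E -> R[i] := fun x => nlap (re f) x +i* nlap (im f) x.

Lemma complex_neq0 (z : R[i]) : z != 0 -> complex.Re z != 0 \/ complex.Im z != 0.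
Proof. by case: z => a b; rewrite eq_complex /= negb_and => /orP. Qed.

Lemma complex_re_neq0 (z : R[i]) : complex.Re z != 0 -> z != 0.
Proof. by apply: contraNneq => ->. Qed.

Lemma complex_im_neq0 (z : R[i]) : complex.Im z != 0 -> z != 0.
Proof. by apply: contraNneq => ->. Qed.

Lemma compact_bounded_support (A : set E) (u : E -> R) :
  compact A -> (forall x, u x != 0 -> A x) -> bounded_support u.
Proof.
move=> /compact_bounded[M [_ MA]] uA; exists (`|M| + 2) => [|x xM].
  by rewrite ltr_wpDl.
apply/eqP; apply: contraTT xM => /uA Ax; rewrite -ltNge.
apply: le_lt_trans (MA (`|M| + 1) _ x Ax) _; last by rewrite ltrD2l ltr1n.
by rewrite (le_lt_trans (ler_norm M))// ltrDl.
Qed.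

Lemma compact_closure_support f : bounded_support (re f) -> bounded_support (im f) ->
  compact (closure [set x | f x != 0]).
Proof.
move=> [r r0 fr] [s s0 fs].
pose B := closed_ball (0 : E) (r + s).
have BE x : B x -> `|x| <= r + s.
  by rewrite /B closed_ballE ?addr_gt0// /closed_ball_ /= sub0r normrN.
have cB : compact B.
  apply: bounded_closed_compact; last exact: closed_ball_closed.
  exists (r + s); split=> [|M rsM x /BE xrs]; first exact: num_real.
  exact: le_trans xrs (ltW rsM).
apply: subclosed_compact cB _; first exact: closed_closure.
rewrite (closure_id B).1; last exact: closed_ball_closed.
apply: closure_subset => x /= fx; rewrite /B closed_ballE ?addr_gt0//.
rewrite /closed_ball_ /= sub0r normrN leNgt; apply/negP => rsx.
have [h1 h2] : r <= `|x| /\ s <= `|x| by split; lra.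
by move: (complex_neq0 fx); rewrite fr// fs// eqxx => -[].
Qed.

Lemma CcC_L2 f : CcC f -> L2 mu f.
Proof. by move=> [fr fi]; apply/L2P; split; exact: Cc_sqint. Qed.

Lemma CcC_nlap f : CcC f -> CcC (nlapC f).
Proof. by move=> [fr fi]; split; exact: Cc_nlap. Qed.

Lemma CcC_sub f g : CcC f -> CcC g -> CcC (fun x => f x - g x).
Proof.
move=> [fr fi] [gr gi]; split.
  by have := Cc_sub fr gr; congr Cc; apply/funext => x; rewrite ReB.
by have := Cc_sub fi gi; congr Cc; apply/funext => x; rewrite ImB.
Qed.

Lemma nlapCB f g : CcC f -> CcC g ->
  nlapC (fun x => f x - g x) = fun x => nlapC f x - nlapC g x.
Proof.
move=> [fr fi] [gr gi]; apply/funext => x.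
have reE : re (fun x => f x - g x) = (fun x => re f x - re g x).
  by apply/funext => y; rewrite ReB.
have imE : im (fun x => f x - g x) = (fun x => im f x - im g x).
  by apply/funext => y; rewrite ImB.
by apply: complex_eqP; rewrite ?ReB ?ImB /nlapC ?reE ?imE /= nlapB.
Qed.

Lemma nlapC_sym f g : CcC f -> CcC g ->
  inner mu (nlapC f) g = inner mu f (nlapC g).
Proof.
move=> Cf Cg; have f2 := CcC_L2 Cf; have g2 := CcC_L2 Cg.
have Af2 := CcC_L2 (CcC_nlap Cf); have Ag2 := CcC_L2 (CcC_nlap Cg).
have [fr fi] := Cf; have [gr gi] := Cg.
apply: complex_eqP.
  apply: etrans (Re_inner Af2 g2) (etrans _ (esym (Re_inner f2 Ag2))).
  exact: (congr2 +%R (nlap_sym fr gr) (nlap_sym fi gi)).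
apply: etrans (Im_inner Af2 g2) (etrans _ (esym (Im_inner f2 Ag2))).
exact: (congr2 (fun a b => a - b) (nlap_sym fi gr) (nlap_sym fr gi)).
Qed.

Definition vanishing_at0 : set (E -> R[i]) :=
  [set f | CcC f /\ \forall x \near (0 : E), f x = 0].

(** Subtract from the real and imaginary parts of [f] their small cutoffs near
    the origin. *)
Lemma vanishing_at0_dense f (e : R) : (4 < n)%N -> CcC f -> 0 < e ->
  exists g, [/\ vanishing_at0 g, sqnorm mu (fun x => f x - g x) < e &
    sqnorm mu (fun x => nlapC f x - nlapC g x) < e].
Proof.
move=> n4 Cf e0; have [fr fi] := Cf; have e20 : 0 < e / 2 by rewrite divr_gt0.
(* Each part contributes half of the bound on the squared norm. *)
have [h [Ch h0 hs hl]] := cutoff_small n4 fr e20.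
have [k [Ck k0 ks kl]] := cutoff_small n4 fi e20.
pose c x : R[i] := h x +i* k x.
have Cc' : CcC c by [].
have Cg := CcC_sub Cf Cc'.
have fgE : (fun x => f x - (f x - c x)) = c.
  by apply/funext => x; rewrite opprB addrC subrK.
exists (fun x => f x - c x); split.
- split=> //; apply: filterS2 h0 k0 => x hx kx.
  by rewrite /c hx kx; case: (f x) => a b /=; rewrite subrr.
- have c2 := CcC_L2 Cc'; rewrite fgE [ltRHS]splitr.
  by apply: le_lt_trans (ltrD hs ks); rewrite le_eqVlt; apply/orP; left;
     apply/eqP; exact: (Re_inner c2 c2).
- have Ac2 := CcC_L2 (CcC_nlap Cc'); rewrite -nlapCB// fgE [ltRHS]splitr.
  by apply: le_lt_trans (ltrD hl kl); rewrite le_eqVlt; apply/orP; left;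
     apply/eqP; exact: (Re_inner Ac2 Ac2).
Qed.

Lemma friedrichs_vanishing_at0 u w : (4 < n)%N ->
  friedrichs mu CcC nlapC u w <-> friedrichs mu vanishing_at0 nlapC u w.
Proof.
move=> n4; apply: friedrichs_core.
- by move=> f [].
- exact: CcC_L2.
- by move=> f Cf; exact/CcC_L2/CcC_nlap.
- exact: CcC_sub.
- exact: nlapCB.
- exact: nlapC_sym.
- by move=> f e; exact: vanishing_at0_dense.
Qed.

Lemma euclid_test_function (f : E -> R[i]) :
  @test_function R (euclid n) f <-> CcC f.
Proof.
split=> [[sr si cf]|[[sr br] [si bi]]].
  have cl x : f x != 0 -> closure [set y | f y != 0] x.
    by move=> fx; apply: subset_closure.
  split; split.
  - by move=> k; rewrite -range_id; exact: (sr point).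
  - by apply: compact_bounded_support cf _ => x /complex_re_neq0; exact: cl.
  - by move=> k; rewrite -range_id; exact: (si point).
  - by apply: compact_bounded_support cf _ => x /complex_im_neq0; exact: cl.
split.
- by move=> p k; apply: Ck_on_sub (sr k).
- by move=> p k; apply: Ck_on_sub (si k).
- exact: compact_closure_support.
Qed.

Lemma euclid_laplacian (f : E -> R[i]) : @laplacian R (euclid n) f = nlapC f.
Proof. by apply/funext => x; rewrite /laplacian !flat_laplacian. Qed.

End ComplexTestFunctions.

(** * Test functions on the punctured space *)

Section PuncturedTestFunctions.
Context {R : realType}.
Variable m : nat.
Local Notation n := m.+2.
Local Notation E := 'rV[R]_n.
Local Notation P := (@punctured R m).
Local Notation embP := (@emb R m).
Local Notation retP := (@ret R m).
Local Notation MP := (@punctured_euclid R m).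
Local Notation re f := (fun x => complex.Re (f x)).
Local Notation im f := (fun x => complex.Im (f x)).

(** The closure of the support avoids the origin, hence is a compact subset of
    the image of [emb], and its image under [ret] is compact. *)
Lemma vanishing_at0_res (f : E -> R[i]) : vanishing_at0 f ->
  @test_function R MP (fun y => f (embP y)).
Proof.
move=> [[[sr [r r0 fr]] [si [s s0 fs]]] f0].
have smooth (u : E -> R) : smooth_on setT u -> smooth_on (range embP) (u \o embP \o retP).
  move=> su k; apply: (Ck_on_eq (@open_range_emb R m) _ (Ck_on_sub (@subsetT _ _) (su k))).
  by move=> x; rewrite range_emb_nonzero => x0 /=; rewrite ret_val.
split; [by move=> p; exact: smooth sr|by move=> p; exact: smooth si|].
pose K : set E := closure [set x | f x != 0].
have cK : compact K.
  by apply: compact_closure_support; [exists r|exists s].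
have KU : K `<=` range embP.
  move=> x Kx; rewrite range_emb_nonzero /nonzero /=; apply/eqP => x0.
  by move: Kx f0; rewrite x0 => /(_ _ _)/[apply] -[y [/= /eqP]].
have cR : compact (retP @` K).
  by apply: continuous_compact cK; exact: continuous_subspaceW KU (@ret_within R m).
have hP : hausdorff_space P := manifold_hausdorff (manifoldP MP).
have clR : closed (retP @` K) by exact: (compact_closed hP cR).
apply: subclosed_compact cR _; first exact: closed_closure.
rewrite ((closure_id _).1 clR); apply: closure_subset => y /= fy.
by exists (embP y); [exact: subset_closure|exact: embK].
Qed.

(** Extension by zero.  The support is compact in the punctured space, hence
    closed in R^n; its complement is a neighbourhood of the origin and, together
    with the image of [emb], an open cover on which smoothness is checked. *)
Lemma test_function_extend (f' : P -> R[i]) : @test_function R MP f' ->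
  exists2 f, vanishing_at0 f & (fun y => f (embP y)) = f'.
Proof.
move=> [sr si cf].
pose K : set E := embP @` closure [set y | f' y != 0].
have cK : compact K.
  by apply: continuous_compact cf; apply: continuous_subspaceT; exact: emb_continuous.
have clK : closed K by apply: compact_closed cK; exact: norm_hausdorff.
have oK : open (~` K) by exact: closed_openC.
pose f (x : E) : R[i] := if x == 0 then 0 else f' (retP x).
have fK x : ~ K x -> f x = 0.
  rewrite /f; case: eqP => // /eqP x0 Kx; apply/eqP; apply: contrapT => /negP fx.
  by apply: Kx; exists (retP x); [exact: subset_closure|exact: ret_val].
have K0 : ~ K 0 by move=> [y _ y0]; move: (emb_neq0 y); rewrite y0 eqxx.
have cover : setT `<=` range embP `|` ~` K.
  move=> x _; rewrite range_emb_nonzero.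
  by have [->|x0] := eqVneq x 0; [right|left].
have smooth (u : R[i] -> R) : u 0 = 0 ->
    smooth_on (range embP) (u \o f' \o retP) -> smooth_on setT (fun x => u (f x)).
  move=> u0 su k; apply: Ck_on_sub cover _; apply: Ck_on_setU.
    apply: (Ck_on_eq (@open_range_emb R m) _ (su k)) => x.
    by rewrite range_emb_nonzero => x0; rewrite /f (negPf x0).
  by apply: (Ck_on_eq oK _ (Ck_on_cst _ _ 0)) => x /fK ->.
have supp (u : R[i] -> R) : u 0 = 0 -> bounded_support (fun x => u (f x)).
  move=> u0; apply: compact_bounded_support cK _ => x; apply: contraNP => /fK ->.
  by rewrite u0.
exists f.
  split; last by apply: near_open oK K0 fK.
  split; split; try exact: supp.
  - exact: smooth (sr point).
  - exact: smooth (si point).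
by apply/funext => y; rewrite /f (negPf (emb_neq0 y)) embK.
Qed.

Lemma punctured_test_functionE :
  @test_function R MP = [set (fun y => f (embP y)) | f in @vanishing_at0 R n].
Proof.
apply/seteqP; split=> [f' /test_function_extend//|_ [f f0 <-]].
exact: vanishing_at0_res.
Qed.

Lemma punctured_laplacian (f : E -> R[i]) :
  @laplacian R MP (fun y => f (embP y)) = fun y => nlapC f (embP y).
Proof.
apply/funext => y; rewrite /laplacian !flat_laplacian.
apply: (congr2 (fun a b => a +i* b));
  apply: (nlap_eq (@open_range_emb R m)); try exact: range_emb;
  by move=> x; rewrite range_emb_nonzero => x0 /=; rewrite ret_val.
Qed.

End PuncturedTestFunctions.

(** * Isospectrality *)

Lemma friedrichs_ae {R : realType} {d : measure_display} {X : measurableType d}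
    (mu : {measure set X -> \bar R}) (D : set (X -> R[i]))
    (A : (X -> R[i]) -> (X -> R[i])) (u w w' : X -> R[i]) :
  (forall f, D f -> L2 mu f) -> L2 mu w' -> ae_eq2 mu w w' ->
  friedrichs mu D A u w -> friedrichs mu D A u w'.
Proof.
move=> D_L2 w2' ww [u2 w2 cl adj]; split=> // f Df.
by rewrite adj//; exact: inner_ae w2 w2' (D_L2 _ Df) ww.
Qed.

Section Isospectral.
Context {R : realType}.
Variable m : nat.
Local Notation n := m.+2.
Local Notation E := 'rV[R]_n.
Local Notation P := (@punctured R m).
Local Notation embP := (@emb R m).
Local Notation retP := (@ret R m).
Local Notation MP := (@punctured_euclid R m).
Local Notation mu := (@lebesgue_row R n).

(** The origin lies in cubes of arbitrarily small volume. *)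
Lemma lebesgue_row_set1 : mu [set 0] = 0%E.
Proof.
have m0 : measurable ([set 0] : set (borel E)).
  rewrite -[[set 0]]setCK; apply: measurableC; apply: open_borel.
  by apply: closed_openC; apply: compact_closed; [exact: norm_hausdorff|exact: compact_set1].
apply/eqP; rewrite eq_le measure_ge0 andbT; apply/lee_addgt0Pr => e e0.
rewrite add0e; pose r := Num.min (e / 4) (1 / 4).
have r0 : 0 < r by rewrite lt_min !divr_gt0.
have rb : r <= e / 4 /\ r <= 1 / 4 by rewrite !ge_min !lexx orbT.
apply: le_trans (_ : ((2 * r) ^+ n)%:E <= _)%E.
  rewrite -lebesgue_row_ball//; apply: le_measure; rewrite ?inE//.
    by apply: open_borel; exact: ball_open.
  by move=> x ->; exact: ballxx.
rewrite lee_fin exprS.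
have h : (2 * r) ^+ m.+1 <= 1 by apply: exprn_ile1; lra.
have h0 : 0 <= (2 * r) ^+ m.+1 by apply: exprn_ge0; lra.
by move: ((2 * r) ^+ m.+1) h h0 => t h h0; nra.
Qed.

Lemma retK_ae : {ae mu, forall x, embP (retP x) = x}.
Proof.
exists [set 0]; split; last 2 first.
- exact: lebesgue_row_set1.
- move=> x /= h; apply: contrapT => x0; apply: h; apply: ret_val; exact/eqP.
rewrite -[[set 0]]setCK; apply: measurableC; apply: open_borel.
by apply: closed_openC; apply: compact_closed; [exact: norm_hausdorff|exact: compact_set1].
Qed.

Lemma measurable_emb : measurable_fun setT (embP : borel P -> borel E).
Proof. by apply: continuous_borel_map; exact: emb_continuous. Qed.

(** The preimage of an open set is open, possibly with the origin added. *)
Lemma measurable_ret : measurable_fun setT (retP : borel E -> borel P).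
Proof.
apply: (@measurability _ _ (borel E) (borel P) setT retP (@open P)) => //.
move=> _ [V oV <-]; rewrite setTI.
have oU := @open_ret R n P embP retP (@open_range_emb R m) (@ret_within R m) V oV.
have [V0|V0] := pselect (V (retP 0)).
  rewrite (_ : retP @^-1` V = (range embP `&` retP @^-1` V) `|` ~` range embP).
    apply: measurableU; first exact: open_borel.
    by apply: measurableC; apply: open_borel; exact: open_range_emb.
  rewrite range_emb_nonzero; apply/seteqP; split=> [x Vx|x [[]//|]].
    by have [->|x0] := eqVneq x 0; [right; rewrite /nonzero /= eqxx|left].
  by rewrite /nonzero /= => /negP/negPn/eqP ->.
rewrite (_ : retP @^-1` V = range embP `&` retP @^-1` V); first exact: open_borel.
rewrite range_emb_nonzero; apply/seteqP; split=> [x Vx|x []//].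
by split=> //; apply: contra_notN V0 => /eqP <-.
Qed.

Local Notation mu' := (pushforward_measure mu measurable_ret).

Lemma euclid_volume : @is_volume_measure R (euclid n) mu.
Proof.
by apply: flat_volume => //; exact: aeW.
Qed.

Lemma punctured_volume : @is_volume_measure R MP mu'.
Proof. by apply: flat_volume => //; [exact: measurable_ret|exact: retK_ae]. Qed.

Lemma euclid_laplace_beltrami u w :
  @laplace_beltrami R (euclid n) mu u w <-> friedrichs mu (@CcC R n) (@nlapC R n) u w.
Proof.
have tf : @test_function R (euclid n) = @CcC R n.
  by apply/seteqP; split=> f /euclid_test_function.
have lp : @laplacian R (euclid n) = @nlapC R n.
  by apply/funext => f; exact: euclid_laplacian.
by rewrite /laplace_beltrami tf lp.
Qed.

Lemma punctured_laplace_beltrami u w :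
  @laplace_beltrami R MP mu' u w <->
  friedrichs mu (@vanishing_at0 R n) (@nlapC R n) (fun x => u (retP x)) (fun x => w (retP x)).
Proof.
apply: (friedrichs_pull measurable_emb measurable_ret (@embK R m) retK_ae).
- by move=> f [/CcC_L2].
- by move=> f [/CcC_nlap/CcC_L2].
- move=> f g [Cf f0] [Cg g0]; split; first exact: CcC_sub.
  by apply: filterS2 f0 g0 => x -> ->; rewrite subrr.
- exact: punctured_test_functionE.
- by move=> f _; exact: punctured_laplacian.
Qed.

(** Pullback along [ret] carries the operator of the punctured space to the
    Friedrichs extension of the Laplacian on functions that vanish near the
    origin, which is that of all test functions. *)
Lemma euclid_punctured_isospectral : (4 < n)%N -> isospectral (euclid n) MP.
Proof.
move=> n4; exists mu, mu'; split; [exact: euclid_volume|exact: punctured_volume|].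
exists (fun f x => f (retP x)).
  exact: pull_unitary measurable_emb measurable_ret (@embK R m) retK_ae.
move=> u v u2 v2; split=> [[w /punctured_laplace_beltrami Aw wv]|].
  apply/euclid_laplace_beltrami/friedrichs_vanishing_at0 => //.
  by apply: friedrichs_ae wv Aw => // f [/CcC_L2].
move=> /euclid_laplace_beltrami/friedrichs_vanishing_at0 => /(_ n4) Av.
have vv := @pull_res_ae R _ _ (borel P) (borel E) mu embP retP retK_ae v.
exists (fun y => v (embP y)) => //.
apply: (punctured_laplace_beltrami u (fun y => v (embP y))).2.
apply: (friedrichs_ae _ _ _ Av).
- by move=> f [/CcC_L2].
- exact: (L2_pull mu measurable_emb measurable_ret (@embK R m)
    (fun y => v (embP y))).1 (L2_res measurable_emb measurable_ret (@embK R m) retK_ae v2).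
- by apply: (@filterS _ _ (ae_filter_ringOfSetsType mu) _ _ _ vv) => x ->.
Qed.

End Isospectral.

Theorem theorem2p3 (R : realType) :
  exists M M' : riemannian_manifold R,
    [/\ noncompact M, noncompact M', isospectral M M' &
        (naturally_reductive M /\ ~ naturally_reductive M') \/
        (naturally_reductive M' /\ ~ naturally_reductive M)].
Proof.
exists (euclid 5), (punctured_euclid 3); split.
- exact: euclid_noncompact.
- exact: punctured_noncompact.
- exact: euclid_punctured_isospectral.
- left; split; first exact: euclid_naturally_reductive.
  by move=> [/punctured_not_homogeneous].
Qed.
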